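(* Let $l\ge1$. $(V_l,|0\rangle,T,Y(\cdot,z))$ is a vertex algebra isomorphic to the vertex algebra of invariants of $O(2l)$ in the Fock space $\mathcal F^{\otimes l}$ of $l$ pairs of fermionic fields with half-integral modes. Under this isomorphism the generating fields are $$W^n(z)=\tfrac12\sum_{k=1}^l\big(:\partial_z^n\psi^{-,k}(z)\,\psi^{+,k}(z):+:\partial_z^n\psi^{+,k}(z)\,\psi^{-,k}(z):\big),\qquad n\ge1\text{ odd}.$$
   Context: $\hat{\mathcal D}=\mathcal D\oplus\mathbb CC$, $\mathcal D$ spanned by $t^kf(D)$ ($k\in\mathbb Z$, $f\in\mathbb C[w]$, $D=t\partial_t$), $C$ central, $[t^rf(D),t^sg(D)]=t^{r+s}(f(D+s)g(D)-f(D)g(D+r))+\Psi\,C$, $\Psi$ antisymmetric, $\Psi=\sum_{-r\le j\le-1}f(j)g(j+r)$ if $r=-s\ge0$, $\Psi=0$ if $r+s\ne0$. $\hat{\mathcal D}^+$ is the subalgebra spanned by $C$ and $t^kg(D+(k+1)/2)$, $k\in\mathbb Z$, $g$ an odd polynomial. $W^n_k=-\frac12(t^{k+n}\partial_t^n+(-1)^{n+1}\partial_t^nt^{k+n})$ ($n\geq 1$ odd, $k\in\mathbb Z$), $W^n(z)=\sum_kW^n_kz^{-k-n-1}$. $V_c$ is the irreducible quotient of the $\hat{\mathcal D}^+$-module induced from the one-dimensional module over $\mathrm{span}\{W^n_k:n\text{ odd},\ n+k\ge0\}\oplus\mathbb CC$ on which the $W^n_k$ act by $0$ and $C$ by $c$;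 $|0\rangle$ is its generator. $T=W^1_{-1}$ and $Y(W^{n_j}_{-k_j-n_j-1}\cdots W^{n_1}_{-k_1-n_1-1}|0\rangle,z)=\ :\partial_z^{(k_j)}W^{n_j}(z)\cdots\partial_z^{(k_1)}W^{n_1}(z):$ for odd $n_i\ge1$, $k_i\ge0$, $\partial_z^{(k)}=\partial_z^k/k!$. $\psi^{\pm,p}(z)=\sum_{n\in\frac12+\mathbb Z}\psi^{\pm,p}_nz^{-n-1/2}$ ($1\le p\le l$), $[\psi^{+,p}_m,\psi^{-,q}_n]_+=\delta_{pq}\delta_{m+n,0}$, other anticommutators zero; $\mathcal F^{\otimes l}$ is the Fock space generated by the vacuum killed by all $\psi^{\pm,p}_n$, $n>0$, with its natural free-fermion vertex superalgebra structure; $:\ :$ is normal ordering. $O(2l)$ acts on $\mathcal F^{\otimes l}$ by automorphisms fixing the vacuum and acting linearly on the span of the $2l$ fields $\psi^{\pm,p}(z)$, preserving the symmetric form with $(\psi^{+,p},\psi^{-,q})=\delta_{pq}$, $(\psi^{\pm,p},\psi^{\pm,q})=0$. *)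

(* Defs.v *)
From HB Require Import structures.
From mathcomp Require Import all_boot all_order all_algebra.
From mathcomp Require Import finmap generic_quotient ring_quotient.
From mathcomp Require Import complex.
From mathcomp Require Import boolp classical_sets cardinality fsbigop reals.
From mathcomp Require Import monalg ring.

Set Implicit Arguments.
Unset Strict Implicit.
Unset Printing Implicit Defensive.

Import Order.TTheory GRing.Theory Num.Theory.

Local Open Scope classical_set_scope.
Local Open Scope quotient_scope.
Local Open Scope ring_scope.

Section LinearAlgebra.
Variable K : fieldType.

(* [{malg K[T]}] is only used as the K-vector space with basis [T]. *)
Definition linext (T : choiceType) (V : lmodType K) (f : T -> V)
    (x : {malg K[T]}) : V :=
  \sum_(k <- msupp x) x@_k *: f k.

Lemma linextE (T : choiceType) (V : lmodType K) (f : T -> V) (E : {fset T})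
    (x : {malg K[T]}) : (msupp x `<=` E)%fset ->
  linext f x = \sum_(k <- E) x@_k *: f k.
Proof.
move=> sxE; rewrite /linext (big_fset_incl _ sxE) // => k kE kx.
by rewrite mcoeff_outdom // scale0r.
Qed.

Lemma linext_is_linear (T : choiceType) (V : lmodType K) (f : T -> V) :
  linear (linext f).
Proof.
move=> a x y; set E := (msupp x `|` msupp y `|` msupp (a *: x + y))%fset.
have sx : (msupp x `<=` E)%fset by apply/fsubsetP=> k kx; rewrite !inE kx.
have sy : (msupp y `<=` E)%fset by apply/fsubsetP=> k ky; rewrite !inE ky orbT.
have sz : (msupp (a *: x + y) `<=` E)%fset.
  by apply/fsubsetP=> k kz; rewrite 2!inE kz !orbT.
rewrite (linextE f sx) (linextE f sy) (linextE f sz) scaler_sumr -big_split /=.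
by apply: eq_bigr => k _; rewrite mcoeffD mcoeffZ scalerDl scalerA.
Qed.

HB.instance Definition _ (T : choiceType) (V : lmodType K) (f : T -> V) :=
  GRing.isLinear.Build K {malg K[T]} V *:%R (linext f) (linext_is_linear f).

Lemma linextU (T : choiceType) (V : lmodType K) (f : T -> V) (k : T) :
  linext f << k >> = f k.
Proof.
rewrite (@linextE _ _ f [fset k]%fset) ?msuppU_le //.
by rewrite big_seq_fset1 mcoeffUU scale1r.
Qed.

Definition subspace (V : lmodType K) (A : set V) : Prop :=
  A 0 /\ forall a u v, A u -> A v -> A (a *: u + v).

Definition lspan (V : lmodType K) (S : set V) : set V :=
  smallest (@subspace V) S.

Lemma subspace_lspan (V : lmodType K) (S : set V) : subspace (lspan S).
Proof.
split=> [A [[]]//|a u v Su Sv A SA]; case: (SA) => -[_ AL] _.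
by apply: AL; [exact: Su | exact: Sv].
Qed.

Definition in_lspan (V : lmodType K) (S : set V) : pred V :=
  fun v => v \in lspan S.

Lemma in_lspan_submod (V : lmodType K) (S : set V) : submod_closed (in_lspan S).
Proof.
have [S0 SL] := subspace_lspan S.
by split=> [|a u v uS vS]; apply/mem_set; [|apply: SL; apply/set_mem].
Qed.

HB.instance Definition _ (V : lmodType K) (S : set V) :=
  GRing.isSubmodClosed.Build K V (in_lspan S) (in_lspan_submod S).

Definition lspan_zmod (V : lmodType K) (S : set V) : zmodClosed V :=
  GRing.ZmodClosed.clone V (in_lspan S) _.

(* The quotient of [V] by the subspace spanned by [S]. *)
Definition lquot (V : lmodType K) (S : set V) : Type :=
  Quotient.quot (lspan_zmod S).
HB.instance Definition _ (V : lmodType K) (S : set V) :=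
  GRing.Zmodule.on (lquot S).

Definition lclass (V : lmodType K) (S : set V) : V -> lquot S :=
  \pi_(Quotient.quot (lspan_zmod S)).
Definition lrepr (V : lmodType K) (S : set V) : lquot S -> V :=
  fun q => repr (q : (Quotient.quot (lspan_zmod S))).

Section Quotient.
Variables (V : lmodType K) (S : set V).

Lemma lreprK : cancel (@lrepr V S) (@lclass V S).
Proof. exact: reprK. Qed.

Lemma lclass_eq u v : (lclass S u == lclass S v) = in_lspan S (u - v).
Proof. by symmetry; exact: (Quotient.idealrBE (lspan_zmod S)). Qed.

Lemma lrepr_lclass v : lspan S (lrepr (lclass S v) - v).
Proof.
by apply: set_mem; change (in_lspan S (lrepr (lclass S v) - v));
  rewrite -lclass_eq lreprK.
Qed.

Lemma lclass_eqP u v : lspan S (u - v) -> lclass S u = lclass S v.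
Proof. by move=> uvS; apply/eqP; rewrite lclass_eq; apply: mem_set. Qed.

Lemma lclassD u v : lclass S (u + v) = lclass S u + lclass S v.
Proof. exact: (raddfD \pi_(Quotient.quot (lspan_zmod S))). Qed.

Definition lquot_scale (a : K) (q : lquot S) : lquot S :=
  lclass S (a *: lrepr q).

Lemma lquot_scaleE a v : lquot_scale a (lclass S v) = lclass S (a *: v).
Proof.
apply: lclass_eqP; rewrite -scalerBr -[_ *: _]addr0.
have [S0 SL] := subspace_lspan S; exact: SL (lrepr_lclass v) S0.
Qed.

Lemma lquot_scalerA a b q :
  lquot_scale a (lquot_scale b q) = lquot_scale (a * b) q.
Proof. by rewrite -[q]lreprK !lquot_scaleE scalerA. Qed.
Lemma lquot_scale1r : left_id 1 lquot_scale.
Proof. by move=> q; rewrite -[q]lreprK lquot_scaleE scale1r. Qed.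
Lemma lquot_scalerDr : right_distributive lquot_scale +%R.
Proof.
by move=> a p q; rewrite -[p]lreprK -[q]lreprK -lclassD !lquot_scaleE scalerDr
  lclassD.
Qed.
Lemma lquot_scalerDl q : {morph lquot_scale^~ q : a b / a + b}.
Proof. by move=> a b; rewrite -[q]lreprK !lquot_scaleE scalerDl lclassD. Qed.

HB.instance Definition _ := GRing.Zmodule_isLmodule.Build K (lquot S)
  lquot_scalerA lquot_scale1r lquot_scalerDr lquot_scalerDl.

Lemma lclass_is_linear : linear (lclass S).
Proof. by move=> a u v; rewrite lclassD -lquot_scaleE. Qed.
HB.instance Definition _ :=
  GRing.isLinear.Build K V (lquot S) *:%R (lclass S) lclass_is_linear.

End Quotient.
End LinearAlgebra.

(* The module U(A) (x)_(U(P)) K_chi over the Lie subalgebra [A] of [L], where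
   [P] is a subalgebra of [A] acting on the line K_chi through [chi]: it is
   presented by words [x_1; ...; x_k] in elements of [A], which stand for
   x_1 ... x_k (x) 1. *)
Section InducedModule.
Variables (K : fieldType) (L : lmodType K) (br : L -> L -> L).
Variables (A P : set L) (chi : L -> K).

Local Notation words := {malg K[seq A]}.

Inductive induced_rel : set words :=
| IndLinear (a : K) (x y z : A) (u v : seq A) :
    val z = a *: val x + val y ->
    induced_rel (<< u ++ z :: v >> - a *: << u ++ x :: v >> - << u ++ y :: v >>)
| IndBracket (x y z : A) (u v : seq A) :
    val z = br (val x) (val y) ->
    induced_rel (<< u ++ x :: y :: v >> - << u ++ y :: x :: v >>
                 - << u ++ z :: v >>)
| IndCharacter (x : A) (u : seq A) :
    P (val x) -> induced_rel (<< rcons u x >> - chi (val x) *: << u >>).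

Definition induced : Type := lquot induced_rel.
HB.instance Definition _ := GRing.Lmodule.on induced.

Definition induced_gen : induced := lclass induced_rel << [::] >>.

Definition word_cons (x : A) : words -> words :=
  linext (fun w => << x :: w >> : words).

Definition induced_act (x : A) (m : induced) : induced :=
  lclass induced_rel (word_cons x (lrepr m)).

(* The left ideal spanned by the relations is stable, so that the choice of
   representative in [induced_act] is immaterial. *)
Lemma induced_actE (x : A) (w : words) :
  induced_act x (lclass induced_rel w) = lclass induced_rel (word_cons x w).
Proof.
suff stab u : lspan induced_rel u -> lspan induced_rel (word_cons x u).
  by apply: lclass_eqP; rewrite -linearB; apply: stab; apply: lrepr_lclass.
move=> uS; apply: (uS [set u | lspan induced_rel (word_cons x u)]).
split=> [|{u uS} _ [a y y' z u v e|y y' z u v e|y u e]].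
- have [S0 SL] := subspace_lspan induced_rel.
  by split=> [|a p q] /=; rewrite /word_cons ?linear0 // linearP; apply: SL.
- rewrite /= /word_cons !linearB linearZ /= !linextU -!cat_cons.
  by apply: sub_gen_smallest; apply: IndLinear.
- rewrite /= /word_cons !linearB /= !linextU -!cat_cons.
  by apply: sub_gen_smallest; apply: IndBracket.
- rewrite /= /word_cons !linearB linearZ /= !linextU -rcons_cons.
  by apply: sub_gen_smallest; apply: IndCharacter.
Qed.

End InducedModule.

Section IrreducibleQuotient.
Variables (K : fieldType) (A : Type) (M : lmodType K) (act : A -> M -> M).

Definition submodule (N : set M) : Prop :=
  subspace N /\ forall x m, N m -> N (act x m).

Definition proper_submodules : set (set M) :=
  [set N | submodule N /\ N <> setT].

(* The quotient by the sum of all proper submodules; it is irreducible as soon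
   as that sum is itself proper. *)
Definition max_submodule : set M := \bigcup_(N in proper_submodules) N.

Definition irr_quotient : Type := lquot max_submodule.
HB.instance Definition _ := GRing.Lmodule.on irr_quotient.

Definition irr_act (x : A) (q : irr_quotient) : irr_quotient :=
  lclass max_submodule (act x (lrepr q)).

Lemma irr_actE (x : A) (m : M) : linear (act x) ->
  irr_act x (lclass max_submodule m) = lclass max_submodule (act x m).
Proof.
move=> actL.
have actB u v : act x (u - v) = act x u - act x v.
  by rewrite addrC -scaleN1r actL scaleN1r addrC.
have act0 : act x 0 = 0 by have := actB 0 0; rewrite !subrr.
suff stab u : lspan max_submodule u -> lspan max_submodule (act x u).
  by apply: lclass_eqP; rewrite -actB; apply: stab; apply: lrepr_lclass.
move=> uS; have [S0 SL] := subspace_lspan max_submodule.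
apply: (uS [set u | lspan max_submodule (act x u)]).
split=> [|{u uS} u [N [[Nsub Nact] NT] Nu]].
  by split=> [|a p q]; rewrite /= ?act0 ?actL //; apply: SL.
by apply: sub_gen_smallest; exists N => //; apply: Nact.
Qed.

End IrreducibleQuotient.

Section LieAlgebra.
Variable K : fieldType.

(* t^k D^j is encoded as << (k, j) >>, and [tD k f] is t^k f(D). *)
Definition diffop : Type := {malg K[(int * nat)%type]}.
HB.instance Definition _ := GRing.Lmodule.on diffop.

Definition tD (k : int) (f : {poly K}) : diffop :=
  \sum_(j < size f) f`_j *: << (k, j : nat) >>.

Lemma tDE (k : int) (f : {poly K}) (n : nat) : (size f <= n)%N ->
  tD k f = \sum_(j < n) f`_j *: << (k, j : nat) >>.
Proof.
move=> le_fn; rewrite /tD (big_ord_widen n (fun j => f`_j *: << (k, j) >>)) //.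
rewrite big_mkcond; apply: eq_bigr => j _; case: ltnP => // le_fj.
by rewrite nth_default // scale0r.
Qed.

Lemma tD_is_linear (k : int) : linear (tD k).
Proof.
move=> a f g; set n := maxn (size f) (size g).
have sf : (size f <= n)%N by apply: leq_maxl.
have sg : (size g <= n)%N by apply: leq_maxr.
have sh : (size (a *: f + g)%R <= n)%N.
  rewrite (leq_trans (size_polyD _ _)) // geq_max sg andbT.
  exact: leq_trans (size_scale_leq _ _) sf.
rewrite (tDE k sf) (tDE k sg) (tDE k sh) scaler_sumr -big_split /=.
by apply: eq_bigr => j _; rewrite coefD coefZ scalerDl scalerA.
Qed.
HB.instance Definition _ (k : int) :=
  GRing.isLinear.Build K {poly K} diffop *:%R (tD k) (tD_is_linear k).

Definition diffop_mul (x y : diffop) : diffop :=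
  linext (fun a : int * nat => linext (fun b : int * nat =>
    tD (a.1 + b.1) (('X^(a.2) \Po ('X + b.1%:~R%:P)) * 'X^(b.2))) y) x.

Lemma diffop_mulE (r s : int) (f g : {poly K}) :
  diffop_mul (tD r f) (tD s g) = tD (r + s) ((f \Po ('X + s%:~R%:P)) * g).
Proof.
rewrite /diffop_mul [X in linext _ X]/tD linear_sum /= comp_polyE mulr_suml.
rewrite linear_sum; apply: eq_bigr => i _.
rewrite linearZ /= linextU -scalerAl linearZ; congr (_ *: _).
rewrite [X in linext _ X]/tD linear_sum /= -[g in RHS]coefK poly_def mulr_sumr.
rewrite linear_sum; apply: eq_bigr => j _.
by rewrite linearZ /= linextU /= -scalerAr linearZ comp_Xn_poly.
Qed.

Definition psi_cocycle_pos (r : nat) (f g : {poly K}) : K :=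
  \sum_(i < r) f.[(i%:Z - r%:Z)%:~R] * g.[i%:R].

(* Psi(t^r f(D), t^s g(D)); in the sum j = i - r runs over -r, ..., -1. *)
Definition psi_cocycle_mono (r s : int) (f g : {poly K}) : K :=
  if r + s == 0 then
    match r with
    | Posz r' => psi_cocycle_pos r' f g
    | Negz r' => - psi_cocycle_pos r'.+1 g f
    end
  else 0.

Definition psi_cocycle (x y : diffop) : K :=
  \sum_(a <- msupp x) \sum_(b <- msupp y)
    x@_a * y@_b * psi_cocycle_mono a.1 b.1 'X^(a.2) 'X^(b.2).

(* (x, b) stands for x + b C. *)
Definition Dhat : Type := (diffop * K^o)%type.
HB.instance Definition _ := GRing.Lmodule.on Dhat.

Definition Dhat_br (x y : Dhat) : Dhat :=
  (diffop_mul x.1 y.1 - diffop_mul y.1 x.1, psi_cocycle x.1 y.1).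

Definition Dhat_C : Dhat := (0, 1).

Inductive Dhat_plus_gen : set Dhat :=
| DhatPlusC : Dhat_plus_gen Dhat_C
| DhatPlusOdd (k : int) (g : {poly K}) :
    g \Po (- 'X) = - g ->
    Dhat_plus_gen (tD k (g \Po ('X + ((k + 1)%:~R / 2)%:P)), 0).

Definition Dhat_plus : set Dhat := lspan Dhat_plus_gen.

Definition ddt : diffop := tD (-1) 'X.

Definition ddt_pow (n : nat) : diffop := iter n (diffop_mul ddt) (tD 0 1).

Definition W (n : nat) (k : int) : Dhat :=
  (- 2^-1 *: (diffop_mul (tD (k + n%:Z) 1) (ddt_pow n)
              + (-1) ^+ n.+1 *: diffop_mul (ddt_pow n) (tD (k + n%:Z) 1)), 0).

Lemma ddt_powE (n : nat) :
  ddt_pow n = tD (- n%:Z) (\prod_(i < n) ('X - i%:R%:P)).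
Proof.
elim: n => [|n IHn]; first by rewrite big_ord0.
rewrite /ddt_pow iterS -/(ddt_pow n) IHn diffop_mulE comp_polyX.
rewrite big_ord_recr /= mulrC.
have -> : -1 - n%:Z = - n.+1%:Z by rewrite -opprD -addn1 PoszD addrC.
have -> // : (- n%:Z)%:~R%:P = - n%:R%:P :> {poly K}.
by rewrite mulrNz polyCN.
Qed.

Lemma W_Dhat_plus (n : nat) (k : int) :
  (2 : K) != 0 -> odd n -> Dhat_plus (W n k).
Proof.
move=> two n_odd; apply: sub_gen_smallest.
pose c : K := (k + 1)%:~R / 2.
pose p : {poly K} := \prod_(i < n) ('X - (c + i%:R)%:P).
pose g : {poly K} := - 2^-1 *: (p - (p \Po (- 'X))).
pose A : {poly K} := \prod_(i < n) ('X - i%:R%:P).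
pose B : {poly K} := A \Po ('X + (k + n%:Z)%:~R%:P).
have c2 : c + c = (k + 1)%:~R.
  by rewrite -mulr2n -mulr_natr divfK.
have pA : p \Po ('X + c%:P) = A.
  rewrite /p rmorph_prod; apply: eq_bigr => i _ /=.
  by rewrite comp_polyB comp_polyX comp_polyC polyCD; ring.
have pB : (p \Po (- 'X)) \Po ('X + c%:P) = - B.
  rewrite /B /A /p !rmorph_prod /=.
  rewrite [in RHS](reindex_inj rev_ord_inj) /= -[RHS]mulN1r.
  have -> : -1 = \prod_(i < n) (-1) :> {poly K}.
    by rewrite prodr_const card_ord -signr_odd n_odd expr1.
  rewrite -big_split; apply: eq_bigr => i _ /=.
  rewrite !(comp_polyB, comp_polyX, comp_polyC) raddfN /= comp_polyX.
  rewrite mulN1r opprB polyCD.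
  have -> : (k + n%:Z)%:~R = c + c + (n - i.+1)%:R + i%:R :> K.
    rewrite c2 natrB ?ltn_ord // -addn1 natrD !intrD -!pmulrn.
    ring.
  rewrite !polyCD; ring.
have g_odd : g \Po (- 'X) = - g.
  rewrite /g comp_polyZ comp_polyB -comp_polyA raddfN /= comp_polyX opprK.
  by rewrite comp_polyXr -scalerN opprB.
have -> : W n k = (tD k (g \Po ('X + c%:P)), 0); last first.
  exact: DhatPlusOdd.
have -> : g \Po ('X + c%:P) = - 2^-1 *: (A + B).
  by rewrite /g comp_polyZ comp_polyB pA pB opprK.
rewrite linearZ /= linearD /= /W.
congr (_ *: (_ + _), _).
  rewrite ddt_powE diffop_mulE comp_polyC mul1r.
  by have -> : k + n%:Z - n%:Z = k by rewrite addrK.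
rewrite ddt_powE diffop_mulE -signr_odd /= n_odd expr0 scale1r mulr1.
by have -> : - n%:Z + (k + n%:Z) = k by rewrite addrC addrK.
Qed.

Inductive Dhat_parabolic_gen : set Dhat :=
| ParabolicC : Dhat_parabolic_gen Dhat_C
| ParabolicW (n : nat) (k : int) : odd n -> 0 <= n%:Z + k ->
    Dhat_parabolic_gen (W n k).

Definition Dhat_parabolic : set Dhat := lspan Dhat_parabolic_gen.

(* [vac_char c (W n k) = 0] and [vac_char c Dhat_C = c]. *)
Definition vac_char (c : K) (x : Dhat) : K := c * x.2.

Definition vac_induced (c : K) : Type :=
  induced Dhat_br Dhat_plus Dhat_parabolic (vac_char c).
HB.instance Definition _ (c : K) := GRing.Lmodule.on (vac_induced c).

Definition Vc (c : K) : Type :=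
  irr_quotient (@induced_act _ _ Dhat_br Dhat_plus Dhat_parabolic (vac_char c)).
HB.instance Definition _ (c : K) := GRing.Lmodule.on (Vc c).

Definition Vc_vac (c : K) : Vc c :=
  lclass _ (induced_gen Dhat_br Dhat_plus Dhat_parabolic (vac_char c)).

(* Extended by 0 to elements of [Dhat] outside [Dhat_plus]. *)
Definition Vc_act (c : K) (x : Dhat) (v : Vc c) : Vc c :=
  if insub x is Some y then irr_act (y : Dhat_plus) v else 0.

Definition Vc_T (c : K) : Vc c -> Vc c := Vc_act (W 1 (-1)).

End LieAlgebra.

(* A field a(z) = \sum_m a_(m) z^(-m-1) is given by its modes m |-> a_(m). *)
Definition field (V : Type) : Type := int -> V -> V.

Section Fields.
Variables (K : fieldType) (V : lmodType K).

Definition fid : field V := fun m v => if m == -1 then v else 0.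

Definition fderiv (a : field V) : field V :=
  fun m v => - m%:~R *: a (m - 1) v.

Definition fderiv_div (k : nat) (a : field V) : field V :=
  fun m v => (k`!%:R)^-1 *: iter k fderiv a m v.

(* :a(z)b(z): = a(z)_- b(z) + (-1)^(p(a)p(b)) b(z) a(z)_+, where a(z)_+ and
   a(z)_- collect the modes a_(j) with j >= 0 and j < 0; [s] is p(a)p(b). *)
Definition nop (s : bool) (a b : field V) : field V := fun m v =>
  \sum_(j \in [set j : int | j < 0]) a j (b (m - j - 1) v)
  + (-1) ^+ s *: \sum_(j \in [set j : int | 0 <= j]) b (m - j - 1) (a j v).

(* :a_1(z) a_2(z) ... a_k(z): nested from the right, for fields a_i paired with
   their parities. *)
Fixpoint nops (s : seq (bool * field V)) : field V :=
  match s with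
  | [::] => fid
  | (p, a) :: s' => nop (p && odd (count fst s')) a (nops s')
  end.

Record vertex_algebra (vac : V) (T : V -> V) (Y : V -> field V) : Prop :=
  VertexAlgebra {
  va_linear_T : linear T;
  va_linear_Y : forall m b, linear (fun a => Y a m b);
  va_linear_mode : forall a m, linear (Y a m);
  va_field : forall a b, exists N : int, forall m, N <= m -> Y a m b = 0;
  va_vacuum : Y vac = fid;
  va_T_vacuum : T vac = 0;
  va_creation : forall a m, 0 <= m -> Y a m vac = 0;
  va_creation_value : forall a, Y a (-1) vac = a;
  va_translation : forall a m b, T (Y a m b) - Y a m (T b) = fderiv (Y a) m b;
  (* (z - w)^N [Y(a,z), Y(b,w)] = 0, coefficient of z^(-m-1) w^(-n-1) *)
  va_locality : forall a b, exists N : nat, forall (m n : int) v,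
    \sum_(j < N.+1) ((-1) ^+ j * 'C(N, j)%:R) *:
      (Y a (m + N%:Z - j%:Z) (Y b (n + j%:Z) v)
       - Y b (n + j%:Z) (Y a (m + N%:Z - j%:Z) v)) = 0
}.

End Fields.

(* [phi] is an isomorphism of vertex algebras from V onto the subspace [N] of
   V', which is thereby closed under the operations of V'. *)
Record vertex_iso_onto (K : fieldType) (V V' : lmodType K)
    (vac : V) (T : V -> V) (Y : V -> field V)
    (vac' : V') (T' : V' -> V') (Y' : V' -> field V') (N : set V')
    (phi : V -> V') : Prop := VertexIsoOnto {
  vi_linear : linear phi;
  vi_injective : injective phi;
  vi_image : range phi = N;
  vi_vacuum : phi vac = vac';
  vi_T : forall v, phi (T v) = T' (phi v);
  vi_Y : forall u m v, phi (Y u m v) = Y' (phi u) m (phi v)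
}.

Section VcFields.
Variables (K : fieldType) (c : K).

(* W^n(z) = \sum_k W^n_k z^(-k-n-1), whence W^n_(m) = W^n_(m-n). *)
Definition Wfield (n : nat) : field (Vc c) :=
  fun m v => Vc_act (W K n (m - n%:Z)) v.

(* For s = [:: (n_j, k_j); ...; (n_1, k_1)]. *)
Definition Vc_state (s : seq (nat * nat)) : Vc c :=
  foldr (fun p v => Vc_act (W K p.1 (- p.2%:Z - p.1%:Z - 1)) v) (Vc_vac c) s.

Definition Vc_state_field (s : seq (nat * nat)) : field (Vc c) :=
  nops [seq (false, fderiv_div p.2 (Wfield p.1)) | p <- s].

End VcFields.

Arguments Wfield {K} c n m v.
Arguments Vc_state {K} c s.
Arguments Vc_state_field {K} c s m v.

Section Fock.
Variables (K : fieldType) (l : nat).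

(* [lshift l p] and [rshift l p] index psi^{+,p} and psi^{-,p}; the pair (i, n)
   indexes the creation operator psi^i_{-n-1/2}. *)
Definition cmode : Type := ('I_(l + l) * nat)%type.
HB.instance Definition _ := Choice.on cmode.

Definition conj_idx (i : 'I_(l + l)) : 'I_(l + l) :=
  match split i with inl p => rshift l p | inr p => lshift l p end.

Definition mode_le (x y : cmode) : bool :=
  (x.1 < y.1)%N || (x.1 == y.1) && (x.2 <= y.2)%N.

(* << S >> is the product of the psi_x, x in S, in increasing order, applied to
   the vacuum. *)
Definition Fock : Type := {malg K[{fset cmode}]}.
HB.instance Definition _ := GRing.Lmodule.on Fock.

Definition Fock_vac : Fock := << fset0 >>.

Definition fermi_sign (x : cmode) (S : {fset cmode}) : K :=
  (-1) ^+ count (fun y => (y != x) && mode_le y x) S.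

Definition create (x : cmode) : Fock -> Fock :=
  linext (fun S : {fset cmode} =>
    if x \in S then 0 else fermi_sign x S *: << (x |` S)%fset >> : Fock).

Definition annihilate (x : cmode) : Fock -> Fock :=
  linext (fun S : {fset cmode} =>
    if x \in S then fermi_sign x S *: << (S `\ x)%fset >> else 0 : Fock).

(* psi^i(z) = \sum_m psi^i_(m) z^(-m-1) with psi^i_(m) = psi^i_{m+1/2}; note
   that Negz n = - (n + 1). *)
Definition psi (i : 'I_(l + l)) : field Fock := fun m =>
  match m with
  | Posz n => annihilate (conj_idx i, n)
  | Negz n => create (i, n)
  end.

Definition psi_plus (p : 'I_l) : field Fock := psi (lshift l p).
Definition psi_minus (p : 'I_l) : field Fock := psi (rshift l p).

Definition modes (S : {fset cmode}) : seq cmode := sort mode_le S.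

Definition Fock_Y (v : Fock) : field Fock := fun m w =>
  linext (fun S : {fset cmode} =>
    nops [seq (true, fderiv_div x.2 (psi x.1)) | x <- modes S] m w) v.

(* In a vertex algebra T a = a_(-2)|0>. *)
Definition Fock_T (v : Fock) : Fock := Fock_Y v (-2) Fock_vac.

Definition form_mx : 'M[K]_(l + l) := block_mx 0 1%:M 1%:M 0.

Definition O_group : set 'M[K]_(l + l) :=
  [set g | g^T *m form_mx *m g = form_mx].

(* g psi^i(z) = \sum_j g_ji psi^j(z) *)
Definition O_act (g : 'M[K]_(l + l)) : Fock -> Fock :=
  linext (fun S : {fset cmode} =>
    foldr (fun x v => \sum_j g j x.1 *: psi j (Negz x.2) v) Fock_vac (modes S)).

Definition O_invariants : set Fock :=
  [set v | forall g, O_group g -> O_act g v = v].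

Definition Wfermi (n : nat) : field Fock := fun m v =>
  2^-1 *: \sum_(p < l)
    (nop true (iter n (@fderiv K Fock) (psi_minus p)) (psi_plus p) m v
     + nop true (iter n (@fderiv K Fock) (psi_plus p)) (psi_minus p) m v).

End Fock.

(* Main.v *)
(* The normally ordered bilinears sum_i :psi^i'_p psi^i_q: (i' the conjugate
   index of i) commute with O(2l) and give a representation rho of D^+ on Fock
   space in which C acts by l and W^n_k by the modes of the fermionic fields
   W^n(z).  It produces a map from the induced module to the O(2l)-invariants,
   sending words to words, and everything reduces to two facts: the vacuum
   generates the invariants under D^+, and every nonzero D^+-submodule of the
   invariants contains the vacuum.  Since odd polynomials interpolate, a
   D^+-submodule is stable under each bilinear separately.  On an invariant
   vector the Casimir identity of O(2l) (infinitesimal root subgroups and torus,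
   no general invariant theory) expresses the diagonal operator
   sum_a N_a (2l + 2a - N_a), N_a the number of fermions in slot a, through
   bilinears applied to vectors of smaller energy.  Its kernel among the
   invariants is spanned by the vacuum, because the only other candidate, with
   slot 0 full, changes sign under a reflection; induction on the energy proves
   both facts.  On the module side, L_0 = W^1_0 separates the generator from
   the words of positive energy, so the kernel of the map is the largest proper
   submodule.  The vertex algebra structure is transported from Fock space, where
   locality is Dong's lemma and a field is determined by the state it creates. *)
Require Import Defs.
From HB Require Import structures.
From mathcomp Require Import all_boot all_order all_algebra fingroup perm.
From mathcomp Require Import finmap complex boolp classical_sets fsbigop reals monalg.
From mathcomp Require Import zify ring lra.

Set Implicit Arguments.
Unset Strict Implicit.
Unset Printing Implicit Defensive.

Import Order.TTheory GRing.Theory Num.Theory.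

Local Open Scope ring_scope.

(** * Formal series and the residue form of Dong's lemma *)

(** Operator identities on Fock space are reduced by a Schur argument: an operator commuting with
    all fermions is determined by one vacuum coefficient. There the central charge appears: the 2l
    indices, weighted by the factor 1/2 of the quadratic operators, give l. The Casimir identity
    compares two expressions of one operator. On an invariant vector E_ji and E_i'j' agree, so the
    sum of E_ij E_ji equals that of E_ij E_i'j'. Normal ordering both sides leaves operators indexed
    by slots. The shift 2a arises because each pair of distinct slots is ordered so that the
    operator lowering the energy acts first. As 0 <= N_a <= 2l, the eigenvalue N_a(2l + 2a - N_a) is
    never negative and vanishes only for N_a = 0, or for a = 0 and N_0 = 2l. Infinitesimal
    invariance is obtained without exponentials or limits: root subgroups act by families polynomial
    in t, and the derivative at 0 is the coefficient of t. Root subgroups miss the torus, for which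
    a single diagonal matrix per weight separates the monomials. *)

Section LinearMaps.
Variables (K : fieldType) (U V : lmodType K) (f : U -> V).
Hypothesis fL : linear f.

Lemma lin_add u v : f (u + v) = f u + f v.
Proof. by rewrite -[u]scale1r fL !scale1r. Qed.

Lemma lin_zero : f 0 = 0.
Proof. by apply: (addrI (f 0)); rewrite -lin_add !addr0. Qed.

Lemma lin_scale a u : f (a *: u) = a *: f u.
Proof. by rewrite -[a *: u]addr0 fL lin_zero addr0. Qed.

Lemma lin_opp u : f (- u) = - f u.
Proof. by rewrite -scaleN1r lin_scale scaleN1r. Qed.

Lemma lin_sub u v : f (u - v) = f u - f v.
Proof. by rewrite lin_add lin_opp. Qed.

Lemma lin_sum (I : Type) (r : seq I) (P : pred I) (F : I -> U) :
  f (\sum_(i <- r | P i) F i) = \sum_(i <- r | P i) f (F i).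
Proof.
by apply: (big_morph f); [exact: lin_add | exact: lin_zero].
Qed.

End LinearMaps.

Lemma lin_subf (K : fieldType) (U V : lmodType K) (f g : U -> V) :
  linear f -> linear g -> linear (fun u => f u - g u).
Proof. by move=> fL gL a u v; rewrite fL gL scalerBr opprD addrACA. Qed.

Lemma lin_comp (K : fieldType) (U V W : lmodType K) (f : V -> W) (g : U -> V) :
  linear f -> linear g -> linear (fun u => f (g u)).
Proof. by move=> fL gL a u v; rewrite gL fL. Qed.

Section IntegerSums.
Variables (K : fieldType) (V : lmodType K).
Implicit Types f g : int -> V.

(** A sum with infinite support is 0 by convention, so the linearity and shift rules below carry a
    hypothesis bounding the support on the relevant side. *)
Definition nsum f : V := \sum_(j \in [set j : int | j < 0]%classic) f j.
Definition psum f : V := \sum_(j \in [set j : int | 0 <= j]%classic) f j.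

Definition vanish_low f := exists M : nat, forall j : int, j < - M%:Z -> f j = 0.
Definition vanish_upp f := exists M : nat, forall j : int, M%:Z <= j -> f j = 0.

Lemma nsumE (M : nat) f : (forall j : int, j < - M%:Z -> f j = 0) ->
  nsum f = \sum_(i < M) f (Negz i).
Proof.
move=> f0; rewrite /nsum (fsbigE [seq Negz i | i <- index_iota 0 M]).
- rewrite big_map (eq_bigl xpredT) ?big_mkord // => i.
  by rewrite mem_setE.
- by rewrite map_inj_uniq ?iota_uniq // => i j [].
- by move=> j /= /mapP[i _ ->].
case=> [//|i] _ iM; apply: f0; move: iM.
rewrite mem_map => [|? ? [] //]; rewrite mem_index_iota; lia.
Qed.

Lemma psumE (M : nat) f : (forall j : int, M%:Z <= j -> f j = 0) ->
  psum f = \sum_(i < M) f (Posz i).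
Proof.
move=> f0; rewrite /psum (fsbigE [seq Posz i | i <- index_iota 0 M]).
- rewrite big_map (eq_bigl xpredT) ?big_mkord // => i.
  by rewrite mem_setE.
- by rewrite map_inj_uniq ?iota_uniq // => i j [].
- by move=> j /= /mapP[i _ ->].
case=> [i|//] _ iM; apply: f0; move: iM.
rewrite mem_map => [|? ? [] //]; rewrite mem_index_iota; lia.
Qed.

Lemma eq_nsum f g : (forall j, j < 0 -> f j = g j) -> nsum f = nsum g.
Proof. by move=> fg; apply: eq_fsbigr => j; rewrite inE => /fg. Qed.

Lemma eq_psum f g : (forall j, 0 <= j -> f j = g j) -> psum f = psum g.
Proof. by move=> fg; apply: eq_fsbigr => j; rewrite inE => /fg. Qed.

Lemma nsum0 : nsum (fun=> 0) = 0.
Proof. by apply: fsbig1. Qed.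

Lemma psum0 : psum (fun=> 0) = 0.
Proof. by apply: fsbig1. Qed.

Lemma nsumP a f g : vanish_low f -> vanish_low g ->
  nsum (fun j => a *: f j + g j) = a *: nsum f + nsum g.
Proof.
move=> [M f0] [N g0]; pose L := maxn M N.
have lf j : j < - L%:Z -> f j = 0 by move=> ?; apply: f0; lia.
have lg j : j < - L%:Z -> g j = 0 by move=> ?; apply: g0; lia.
rewrite (nsumE lf) (nsumE lg) (@nsumE L) => [|j jL]; last first.
  by rewrite lf // lg // scaler0 addr0.
by rewrite big_split scaler_sumr.
Qed.

Lemma psumP a f g : vanish_upp f -> vanish_upp g ->
  psum (fun j => a *: f j + g j) = a *: psum f + psum g.
Proof.
move=> [M f0] [N g0]; pose L := maxn M N.
have lf (j : int) : L%:Z <= j -> f j = 0 by move=> ?; apply: f0; lia.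
have lg (j : int) : L%:Z <= j -> g j = 0 by move=> ?; apply: g0; lia.
rewrite (psumE lf) (psumE lg) (@psumE L) => [|j jL]; last first.
  by rewrite lf // lg // scaler0 addr0.
by rewrite big_split scaler_sumr.
Qed.

(** The term at 0 that crosses the cut is the only trace of splitting a series into two halves. In
    [resid_dzw_eq0] the two boundary terms cancel. *)
Lemma nsum_shift f : vanish_low f -> nsum (fun j => f (j + 1)) = f 0 + nsum f.
Proof.
move=> [M f0]; rewrite (@nsumE M.+1) => [|j jM]; last by apply: f0; lia.
rewrite big_ord_recl /= (nsumE f0).
have -> : Negz 0 + 1 = 0 by [].
congr (_ + _); apply: eq_bigr => i _; congr f; rewrite /bump; lia.
Qed.

Lemma psum_shift f : vanish_upp f -> psum f = f 0 + psum (fun j => f (j + 1)).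
Proof.
move=> [M f0]; rewrite (@psumE M.+1) => [|j jM]; last by apply: f0; lia.
rewrite big_ord_recl /= (@psumE M) => [|j jM]; last by apply: f0; lia.
congr (_ + _); apply: eq_bigr => i _; congr f; rewrite /bump; lia.
Qed.

End IntegerSums.

Lemma nsum_lin (K : fieldType) (U V : lmodType K) (g : U -> V) (f : int -> U) :
  linear g -> vanish_low f -> g (nsum f) = nsum (fun j => g (f j)).
Proof.
move=> gL [M f0]; rewrite (nsumE f0) (lin_sum gL) (@nsumE _ _ M) // => j jM.
by rewrite f0 // lin_zero.
Qed.

Lemma psum_lin (K : fieldType) (U V : lmodType K) (g : U -> V) (f : int -> U) :
  linear g -> vanish_upp f -> g (psum f) = psum (fun j => g (f j)).
Proof.
move=> gL [M f0]; rewrite (psumE f0) (lin_sum gL) (@psumE _ _ M) // => j jM.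
by rewrite f0 // lin_zero.
Qed.

Lemma iter_comm (T : Type) (f g : T -> T) : (forall x, f (g x) = g (f x)) ->
  forall n m x, iter n f (iter m g x) = iter m g (iter n f x).
Proof.
move=> fg; have fgm m x : f (iter m g x) = iter m g (f x).
  by elim: m => //= m IHm; rewrite fg IHm.
by elim=> //= n IHn m x; rewrite IHn fgm.
Qed.

Section Differences.
Variables (K : fieldType) (V : lmodType K).

(* Multiplication by [z - w] of the series [\sum F m n z^(-m-1) w^(-n-1)]. *)
Definition dmul (F : int -> int -> V) : int -> int -> V :=
  fun m n => F (m + 1) n - F m (n + 1).

Lemma iter_dmulP N a (F G : int -> int -> V) m n :
  iter N dmul (fun m n => a *: F m n + G m n) m n
  = a *: iter N dmul F m n + iter N dmul G m n.
Proof.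
elim: N m n => //= N IHN m n; rewrite /dmul !IHN scalerBr.
by rewrite opprD addrACA.
Qed.

Lemma iter_dmul0 N : iter N dmul (fun _ _ => 0) = fun _ _ => 0.
Proof. by elim: N => //= N ->; apply/funext=> m; apply/funext=> n; rewrite /dmul subrr. Qed.

Lemma iter_dmul_le N M F : (N <= M)%N ->
  iter N dmul F = (fun _ _ => 0) -> iter M dmul F = fun _ _ => 0.
Proof. by move=> /subnK <- F0; rewrite iterD F0 iter_dmul0. Qed.

Lemma iter_dmul_swap N (F : int -> int -> V) m n :
  iter N dmul (fun m n => F n m) m n = (-1) ^+ N *: iter N dmul F n m.
Proof.
elim: N m n => [|N IHN] m n /=; first by rewrite scale1r.
by rewrite /dmul !IHN -scalerBr exprS mulN1r scaleNr -scalerN opprB.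
Qed.

(** Expansion of (z - w)^N by Pascal's rule. It links the iterated form, convenient in inductions,
    to the binomial form of [va_locality]. *)
Lemma iter_dmulE N (F : int -> int -> V) m n :
  iter N dmul F m n = \sum_(j < N.+1)
    ((-1) ^+ j * 'C(N, j)%:R) *: F (m + N%:Z - j%:Z) (n + j%:Z).
Proof.
elim: N m n => [|N IHN] m n.
  by rewrite big_ord1 /= mul1r scale1r; congr F; lia.
rewrite iterS /dmul !IHN big_ord_recl /= [RHS]big_ord_recl /= -addrA.
congr (_ + _).
  by rewrite !bin0; congr (_ *: F _ _); lia.
rewrite [X in _ = X](eq_bigr (fun i : 'I_N.+1 =>
   ((-1) ^+ i.+1 * 'C(N, i.+1)%:R) *: F (m + N%:Z - i%:Z) (n + i.+1%:Z)
   + ((-1) ^+ i.+1 * 'C(N, i)%:R) *: F (m + N%:Z - i%:Z) (n + i.+1%:Z))).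
  rewrite big_split /=; congr (_ + _).
    rewrite [RHS]big_ord_recr /= bin_small // mulr0 scale0r addr0.
    by apply: eq_bigr => i _; rewrite /bump /=; congr (_ *: F _ _); lia.
  rewrite -sumrN; apply: eq_bigr => i _.
  rewrite exprS mulN1r mulNr scaleNr; congr (- (_ *: F _ _)); lia.
move=> i _; rewrite /bump /= -scalerDl -mulrDr -natrD -binS.
by congr (_ *: F _ _); lia.
Qed.

(* Coefficients of series in [z], [w], [u], with the multiplications by [z - w],
   [z - u] and [w - u]. *)
Let T3 := int -> int -> int -> V.
Definition dzw (F : T3) : T3 := fun j n p => F (j + 1) n p - F j (n + 1) p.
Definition dzu (F : T3) : T3 := fun j n p => F (j + 1) n p - F j n (p + 1).
Definition dwu (F : T3) : T3 := fun j n p => F j (n + 1) p - F j n (p + 1).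

Let sub4 (a b c d : V) : a - b - (c - d) = a - c - (b - d).
Proof. by rewrite !opprD !opprK addrACA. Qed.

Lemma dzw_dzu F : dzw (dzu F) = dzu (dzw F).
Proof. by apply/funext=> j; apply/funext=> n; apply/funext=> p; exact: sub4. Qed.
Lemma dzw_dwu F : dzw (dwu F) = dwu (dzw F).
Proof. by apply/funext=> j; apply/funext=> n; apply/funext=> p; exact: sub4. Qed.
Lemma dzu_dwu F : dzu (dwu F) = dwu (dzu F).
Proof. by apply/funext=> j; apply/funext=> n; apply/funext=> p; exact: sub4. Qed.

Lemma dwuE F j n p : dwu F j n p = dzu F j n p - dzw F j n p.
Proof. by rewrite /dwu /dzu /dzw opprB [RHS]addrC addrA subrK. Qed.

(** These bounds make the residues in z finite: the first holds for products in which the w-field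
    acts before the z-field, the second for the opposite order. The bound may depend on p because
    the u-field may act first of all. *)
Definition low3 (F : T3) := forall p, exists M : nat, forall (j n : int),
  M%:Z <= n -> F j n p = 0.
Definition upp3 (F : T3) := forall p, exists M : nat, forall (j n : int),
  M%:Z <= j -> F j n p = 0.

Lemma low3_dzw F : low3 F -> low3 (dzw F).
Proof.
move=> lF p; have [M F0] := lF p; exists M => j n Mn.
by rewrite /dzw !F0 ?subrr //; lia.
Qed.
Lemma low3_dzu F : low3 F -> low3 (dzu F).
Proof.
move=> lF p; have [M F0] := lF p; have [N G0] := lF (p + 1).
by exists (maxn M N) => j n Mn; rewrite /dzu F0 ?G0 ?subrr //; lia.
Qed.
Lemma low3_dwu F : low3 F -> low3 (dwu F).
Proof.
move=> lF p; have [M F0] := lF p; have [N G0] := lF (p + 1).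
by exists (maxn M N) => j n Mn; rewrite /dwu F0 ?G0 ?subrr //; lia.
Qed.
Lemma upp3_dzw F : upp3 F -> upp3 (dzw F).
Proof.
move=> lF p; have [M F0] := lF p; exists M => j n Mn.
by rewrite /dzw !F0 ?subrr //; lia.
Qed.
Lemma upp3_dzu F : upp3 F -> upp3 (dzu F).
Proof.
move=> lF p; have [M F0] := lF p; have [N G0] := lF (p + 1).
by exists (maxn M N) => j n Mn; rewrite /dzu F0 ?G0 ?subrr //; lia.
Qed.
Lemma upp3_dwu F : upp3 F -> upp3 (dwu F).
Proof.
move=> lF p; have [M F0] := lF p; have [N G0] := lF (p + 1).
by exists (maxn M N) => j n Mn; rewrite /dwu F0 ?G0 ?subrr //; lia.
Qed.

Lemma iter_ind (T : Type) (P : T -> Prop) f n x :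
  (forall x, P x -> P (f x)) -> P x -> P (iter n f x).
Proof. by move=> Pf Px; elim: n => //= n; apply: Pf. Qed.

(* Residue in [z] of [X / (z - w)] expanded in [|z| > |w|], plus [e] times that
   of [Y / (w - z)] expanded in [|w| > |z|]. *)
Definition resid (e : K) (X Y : T3) : int -> int -> V := fun k p =>
  nsum (fun j => X j (k - j - 1) p) + e *: psum (fun j => Y j (k - j - 1) p).

Lemma low3_vanish X k p : low3 X -> vanish_low (fun j => X j (k - j - 1) p).
Proof.
move=> lX; have [M X0] := lX p; exists (M + `|k|)%N => j jM; apply: X0; lia.
Qed.
Lemma upp3_vanish X k p : upp3 X -> vanish_upp (fun j => X j (k - j - 1) p).
Proof. by move=> lX; have [M X0] := lX p; exists M => j jM; apply: X0. Qed.

Lemma residP e a X X' Y Y' k p : low3 X -> low3 X' -> upp3 Y -> upp3 Y' ->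
  resid e (fun j n p => a *: X j n p + X' j n p)
          (fun j n p => a *: Y j n p + Y' j n p) k p
  = a *: resid e X Y k p + resid e X' Y' k p.
Proof.
move=> lX lX' uY uY'; rewrite /resid nsumP; try exact: low3_vanish.
rewrite psumP; try exact: upp3_vanish.
by rewrite !scalerDr !scalerA mulrC addrACA.
Qed.

Lemma dmul_resid e X Y : low3 X -> upp3 Y ->
  dmul (resid e X Y) = resid e (dwu X) (dwu Y).
Proof.
move=> lX uY; apply/funext=> k; apply/funext=> p.
pose Xw j n p := X j (n + 1) p; pose Yw j n p := Y j (n + 1) p.
pose Xu j n p := X j n (p + 1); pose Yu j n p := Y j n (p + 1).
have lXw : low3 Xw by move=> q; have [M X0] := lX q; exists M => j n ?; apply: X0; lia.
have lXu : low3 Xu by move=> q; have [M X0] := lX (q + 1); exists M => j n ?; apply: X0.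
have uYw : upp3 Yw by move=> q; have [M X0] := uY q; exists M => j n ?; apply: X0.
have uYu : upp3 Yu by move=> q; have [M X0] := uY (q + 1); exists M => j n ?; apply: X0.
have dX : dwu X = (fun j n p => -1 *: Xu j n p + Xw j n p).
  by apply/funext=> j; apply/funext=> n; apply/funext=> q; rewrite scaleN1r addrC.
have dY : dwu Y = (fun j n p => -1 *: Yu j n p + Yw j n p).
  by apply/funext=> j; apply/funext=> n; apply/funext=> q; rewrite scaleN1r addrC.
rewrite dX dY residP // scaleN1r addrC /dmul; congr (_ + _).
rewrite /resid; congr (_ + _ *: _).
  by apply: eq_nsum => j _; congr X; lia.
by apply: eq_psum => j _; congr Y; lia.
Qed.

(** A factor z - w cancels both expansions of 1/(z - w), so each sum telescopes to its boundary
    coefficient, and the two coefficients cancel by [X = e *: Y]. *)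
Lemma resid_dzw_eq0 e X Y : low3 X -> upp3 Y ->
  (forall j n p, X j n p = e *: Y j n p) ->
  resid e (dzw X) (dzw Y) = fun _ _ => 0.
Proof.
move=> lX uY XY; apply/funext=> k; apply/funext=> p.
pose f j := X j (k - j) p; pose g j := Y j (k - j) p.
have lf : vanish_low f.
  have [M X0] := lX p; exists (M + `|k|)%N => j jM; apply: X0; lia.
have ug : vanish_upp g.
  by have [M Y0] := uY p; exists M => j jM; apply: Y0.
have lf1 : vanish_low (fun j => f (j + 1)).
  by have [M f0] := lf; exists M.+1 => j jM; apply: f0; lia.
have ug1 : vanish_upp (fun j => g (j + 1)).
  by have [M g0] := ug; exists M => j jM; apply: g0; lia.
rewrite /resid.
have -> : nsum (fun j => dzw X j (k - j - 1) p) = f 0.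
  rewrite (eq_nsum (g := fun j => -1 *: f j + f (j + 1))) => [|j _].
    by rewrite nsumP // scaleN1r nsum_shift // addrC addrK.
  by rewrite scaleN1r [RHS]addrC /f /dzw; congr (X _ _ _ - X _ _ _); lia.
have -> : psum (fun j => dzw Y j (k - j - 1) p) = - g 0.
  rewrite (eq_psum (g := fun j => -1 *: g j + g (j + 1))) => [|j _].
    by rewrite psumP // scaleN1r (psum_shift ug) opprD subrK.
  by rewrite scaleN1r [RHS]addrC /g /dzw; congr (Y _ _ _ - Y _ _ _); lia.
by rewrite /f /g XY scalerN subrr.
Qed.

Let Z : T3 := fun _ _ _ => 0.
Let iterZ d N : d Z = Z -> iter N d Z = Z.
Proof. by move=> dZ; elim: N => //= N ->. Qed.
Let dzwZ : dzw Z = Z.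
Proof. by apply/funext=> j; apply/funext=> n; apply/funext=> p; exact: subrr. Qed.
Let dzuZ : dzu Z = Z.
Proof. by apply/funext=> j; apply/funext=> n; apply/funext=> p; exact: subrr. Qed.

(* Dong's lemma: as [w - u = (z - u) - (z - w)], a high power of [w - u] is a
   combination of [(z - w)^al (z - u)^be] with [al] or [be] large. *)
Lemma dong_resid e N (X Y : T3) : low3 X -> upp3 Y ->
  (forall j n p, iter N dzw X j n p = e *: iter N dzw Y j n p) ->
  iter N dzu (iter N dwu X) = Z -> iter N dzu (iter N dwu Y) = Z ->
  iter (N.+1 + N + N) dmul (resid e X Y) = fun _ _ => 0.
Proof.
move=> lX uY zwXY zuX zuY.
pose H al be := resid e (iter al dzw (iter be dzu (iter N dwu X)))
                        (iter al dzw (iter be dzu (iter N dwu Y))).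
have lH al be : low3 (iter al dzw (iter be dzu (iter N dwu X))).
  apply: (iter_ind (P := low3)) low3_dzw _; apply: (iter_ind (P := low3)) low3_dzu _.
  exact: (iter_ind (P := low3)) low3_dwu _.
have uH al be : upp3 (iter al dzw (iter be dzu (iter N dwu Y))).
  apply: (iter_ind (P := upp3)) upp3_dzw _; apply: (iter_ind (P := upp3)) upp3_dzu _.
  exact: (iter_ind (P := upp3)) upp3_dwu _.
have H_step al be : dmul (H al be) =
    fun k p => -1 *: H al.+1 be k p + H al be.+1 k p.
  rewrite /H dmul_resid //; apply/funext=> k; apply/funext=> p.
  rewrite -residP; [|exact: lH|exact: lH|exact: uH|exact: uH].
  have E F : dwu (iter al dzw (iter be dzu F)) = fun j n p =>
      -1 *: iter al.+1 dzw (iter be dzu F) j n p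
      + iter al dzw (iter be.+1 dzu F) j n p.
    apply/funext=> j; apply/funext=> n; apply/funext=> q.
    rewrite dwuE scaleN1r addrC; congr (_ + _).
    have /(_ 1%N al) /= <- // := iter_comm (fun F => esym (dzw_dzu F)).
  by rewrite !E.
(* After N factors z - w the series [X] and [e *: Y] coincide; one more factor kills the residue. *)
have H_zw al be : (N < al)%N -> H al be = fun _ _ => 0.
  move=> Nal; have [al' ->] : exists al', al = (al' + N).+1.
    by exists (al - N.+1)%N; lia.
  rewrite /H !iterS; apply: resid_dzw_eq0 => [||j n p]; first exact: lH.
    exact: uH.
  - have E F : iter (al' + N) dzw (iter be dzu (iter N dwu F))
        = iter al' dzw (iter be dzu (iter N dwu (iter N dzw F))).
      by rewrite iterD (iter_comm dzw_dzu) (iter_comm dzw_dwu).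
    rewrite !E.
    have -> : iter N dzw X = fun j n p => e *: iter N dzw Y j n p.
      by apply/funext=> ?; apply/funext=> ?; apply/funext=> ?.
    have scal d M F : (forall F, d (fun j n p => e *: F j n p)
        = fun j n p => e *: d F j n p) ->
      iter M d (fun j n p => e *: F j n p) = fun j n p => e *: iter M d F j n p.
      by move=> dE; elim: M => //= M ->.
    by do !rewrite scal; [|move=> F; do 3!apply/funext=> ?; exact: esym (scalerBr _ _ _)..].
have H_zu al be : (N <= be)%N -> H al be = fun _ _ => 0.
  move=> Nbe; rewrite /H -(subnK Nbe) iterD zuX [iter (_ + N) _ _]iterD zuY.
  rewrite !(iterZ _ dzuZ) !(iterZ _ dzwZ); apply/funext=> k; apply/funext=> p.
  by rewrite /resid nsum0 psum0 scaler0 addr0.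
(* Each of the r factors w - u raises [al] or [be] by one. Once their sum reaches 2N + 1, either
   [al > N] or [be >= N]. *)
have main r al be : (N.+1 + N <= al + be + r)%N ->
    iter r dmul (H al be) = fun _ _ => 0.
  elim: r al be => [|r IHr] al be le_r.
    case: (ltnP N al) => Nal; first exact: H_zw.
    by apply: H_zu; lia.
  rewrite iterSr H_step; apply/funext=> k; apply/funext=> p.
  by rewrite iter_dmulP !IHr ?scaler0 ?addr0 //; lia.
(* The last N factors w - u are absorbed into X and Y, where the locality with the third field uses
   them. *)
rewrite iterD; have -> : iter N dmul (resid e X Y) = H 0%N 0%N.
  rewrite /H /=; elim: (N) => //= M ->; rewrite dmul_resid //.
    exact: (iter_ind (P := low3)) low3_dwu _.
  exact: (iter_ind (P := upp3)) upp3_dwu _.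
by apply: main.
Qed.

End Differences.

Section FieldCalculus.
Variables (K : fieldType) (V : lmodType K).
Implicit Types a b c : field V.

Definition lfield a := (forall m, linear (a m)) /\
  forall v, exists M : nat, forall m : int, M%:Z <= m -> a m v = 0.

Definition scomm (s : bool) a b (v : V) : int -> int -> V :=
  fun m n => a m (b n v) - (-1) ^+ s *: b n (a m v).

Definition local s a b := exists N, forall v,
  iter N (@dmul K V) (scomm s a b v) = fun _ _ => 0.

Lemma nopE s a b m v : nop s a b m v =
  nsum (fun j => a j (b (m - j - 1) v))
  + (-1) ^+ s *: psum (fun j => b (m - j - 1) (a j v)).
Proof. by []. Qed.

Lemma lfield_low a b k v : (forall m, linear (a m)) -> lfield b ->
  vanish_low (fun j => a j (b (k - j - 1) v)).
Proof.
move=> aL [_ /(_ v)[M b0]]; exists (M + `|k|)%N => j jM.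
by rewrite b0 ?(lin_zero (aL _)) //; lia.
Qed.

Lemma lfield_upp a b k v : lfield a -> (forall m, linear (b m)) ->
  vanish_upp (fun j => b (k - j - 1) (a j v)).
Proof.
move=> [_ /(_ v)[M a0]] bL; exists M => j jM.
by rewrite a0 ?(lin_zero (bL _)).
Qed.

Lemma lfield_comb x a b : lfield a -> lfield b ->
  lfield (fun m v => x *: a m v + b m v).
Proof.
move=> [aL a0] [bL b0]; split=> [m y u v|v].
  by rewrite aL bL !scalerDr !scalerA mulrC addrACA.
have [M aM] := a0 v; have [N bN] := b0 v; exists (maxn M N) => m mM.
by rewrite aM ?bN ?scaler0 ?addr0 //; lia.
Qed.

Lemma lfield0 : lfield (fun _ _ => 0).
Proof. by split=> [m y u v|v]; [rewrite scaler0 addr0 | exists 0%N]. Qed.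

Lemma lfield_fderiv a : lfield a -> lfield (fderiv a).
Proof.
move=> [aL a0]; split=> [m y u v|v].
  by rewrite /fderiv aL scalerDr !scalerA mulrC.
have [M aM] := a0 v; exists M.+1 => m mM.
by rewrite /fderiv aM ?scaler0 //; lia.
Qed.

Lemma lfield_fid : lfield (@fid K V).
Proof.
split=> [m y u v|v]; rewrite /fid; first by case: eqP; rewrite ?scaler0 ?addr0.
by exists 0%N => m m0; case: eqP => // mN; move: m0; rewrite mN.
Qed.

Lemma lfield_nop s a b : lfield a -> lfield b -> lfield (nop s a b).
Proof.
move=> fa fb; have [aL a0] := fa; have [bL b0] := fb; split=> [m y u v|v].
  rewrite !nopE.
  rewrite (eq_nsum (g := fun j => y *: a j (b (m - j - 1) u)
    + a j (b (m - j - 1) v))); last by move=> j _; rewrite bL aL.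
  rewrite (eq_psum (g := fun j => y *: b (m - j - 1) (a j u)
    + b (m - j - 1) (a j v))); last by move=> j _; rewrite aL bL.
  rewrite nsumP; try exact: lfield_low aL fb.
  rewrite psumP; try exact: lfield_upp fa bL.
  by rewrite !scalerDr !scalerA mulrC addrACA.
have [N aN] := a0 v; have /choice[M bM] := b0.
have [B MB] : exists B, forall j : nat, (j < N)%N -> (M (a j v) <= B)%N.
  exists (\max_(j < N) M (a j v)) => j jN.
  by have := leq_bigmax (F := fun j : 'I_N => M (a j v)) (Ordinal jN).
exists (M v + N + B)%N => m mM; rewrite nopE.
rewrite (eq_nsum (g := fun=> 0)) => [|j j0]; last first.
  by rewrite bM ?(lin_zero (aL _)) //; lia.
rewrite (eq_psum (g := fun=> 0)) => [|[j|//] _].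
  by rewrite nsum0 psum0 scaler0 addr0.
have [Nj|jN] := leqP N j; first by rewrite aN ?(lin_zero (bL _)).
by apply: bM; have := MB j jN; move: (M (a j v)) => c; lia.
Qed.

Lemma scommP s x a a' b v : (forall n, linear (b n)) ->
  scomm s (fun m v => x *: a m v + a' m v) b v =
  fun m n => x *: scomm s a b v m n + scomm s a' b v m n.
Proof.
move=> bL; apply/funext=> m; apply/funext=> n; rewrite /scomm bL.
by rewrite scalerBr !scalerDr opprD !scalerA [(-1) ^+ s * x]mulrC addrACA.
Qed.

Lemma local_comb s x a a' b : (forall n, linear (b n)) ->
  local s a b -> local s a' b -> local s (fun m v => x *: a m v + a' m v) b.
Proof.
move=> bL [N abN] [M a'bM]; exists (maxn N M) => v; rewrite scommP //.
apply/funext=> m; apply/funext=> n; rewrite iter_dmulP.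
rewrite (iter_dmul_le (leq_maxl N M) (abN v)).
by rewrite (iter_dmul_le (leq_maxr N M) (a'bM v)) scaler0 addr0.
Qed.

Lemma local0 s b : (forall n, linear (b n)) -> local s (fun _ _ => 0) b.
Proof.
move=> bL; exists 0%N => v; apply/funext=> m; apply/funext=> n.
by rewrite /= /scomm (lin_zero (bL n)) scaler0 subr0.
Qed.

Lemma local_sym s a b : local s a b -> local s b a.
Proof.
move=> [N abN]; exists N => v; apply/funext=> m; apply/funext=> n.
have -> : scomm s b a v = fun m n => - (-1) ^+ s *: scomm s a b v n m
                                      + (fun _ _ => 0) m n.
  apply/funext=> p; apply/funext=> q; rewrite /scomm addr0 scaleNr scalerBr.
  by rewrite scalerA -expr2 sqrr_sign scale1r opprB.
by rewrite iter_dmulP iter_dmul0 iter_dmul_swap abN !scaler0 addr0.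
Qed.

(** Differentiating (z - w)^N lowers the power by one, so a derivative costs one extra factor. *)
Lemma iter_dmul_fderiv N (F : int -> int -> V) :
  iter N (@dmul K V) F = (fun _ _ => 0) ->
  iter N.+1 (@dmul K V) (fun m n => - m%:~R *: F (m - 1) n) = fun _ _ => 0.
Proof.
elim: N F => [|N IHN] F F0.
  move: F0 => /= ->; apply/funext=> m; apply/funext=> n.
  by rewrite /dmul !scaler0 subr0.
rewrite iterSr; set G := dmul _.
(* Leibniz: (z - w) dF/dz is the derivative of (z - w) F minus F. *)
have -> : G = fun m n => -1 *: F m n + - m%:~R *: dmul F (m - 1) n.
  apply/funext=> m; apply/funext=> n; rewrite /G /dmul addrK subrK.
  rewrite intrD opprD scalerDl scalerBr addrAC [RHS]addrC addrAC.
  by congr (_ + _ + _).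
apply/funext=> m; apply/funext=> n; rewrite iter_dmulP F0 scaler0 add0r.
by rewrite IHN // -iterSr.
Qed.

Lemma local_fderiv s a b : (forall n, linear (b n)) ->
  local s a b -> local s (fderiv a) b.
Proof.
move=> bL [N abN]; exists N.+1 => v; rewrite -(iter_dmul_fderiv (abN v)).
congr iter; apply/funext=> m; apply/funext=> n; rewrite /scomm /fderiv.
by rewrite (lin_scale (bL n)) scalerBr !scalerA mulrC.
Qed.

Lemma local_fid b : (forall n, linear (b n)) -> local false (@fid K V) b.
Proof.
move=> bL; exists 0%N => v; apply/funext=> m; apply/funext=> n.
rewrite /= /scomm /fid scale1r; case: eqP => _; first by rewrite subrr.
by rewrite (lin_zero (bL n)) subrr.
Qed.

(** Dong's lemma for superfields. The normally ordered product is a residue in z, so its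
    supercommutator with c is [resid] of two triple products, and the three localities are the three
    hypotheses of [dong_resid]. *)
Lemma local_nop s1 s2 s3 a b c : lfield a -> lfield b -> lfield c ->
  local s1 a b -> local s2 a c -> local s3 b c ->
  local (s2 (+) s3) (nop s1 a b) c.
Proof.
move=> fa fb fc [N1 ab] [N2 ac] [N3 bc]; pose N := (N1 + N2 + N3)%N.
have [[aL a0] [bL b0] [cL c0]] := And3 fa fb fc.
have signE : (-1) ^+ (s2 (+) s3) = (-1) ^+ s2 * (-1) ^+ s3 :> K.
  by rewrite signr_addb.
have abN w : iter N (@dmul K V) (scomm s1 a b w) = fun _ _ => 0.
  by apply: iter_dmul_le (ab w); lia.
have acN w : iter N (@dmul K V) (scomm s2 a c w) = fun _ _ => 0.
  by apply: iter_dmul_le (ac w); lia.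
have bcN w : iter N (@dmul K V) (scomm s3 b c w) = fun _ _ => 0.
  by apply: iter_dmul_le (bc w); lia.
exists (N.+1 + N + N)%N => v; set e := (-1) ^+ (s2 (+) s3) in signE *.
(* [X] and [Y] are the supercommutators with c of a(z)b(w) and of b(w)a(z); the residue uses the
   first for the negative modes of a and the second for the others. *)
pose X j n p := - e *: c p (a j (b n v)) + a j (b n (c p v)).
pose Y j n p := - e *: c p (b n (a j v)) + b n (a j (c p v)).
have lX1 : low3 (fun j n p => c p (a j (b n v))).
  move=> p; have [M bM] := b0 v; exists M => j n Mn.
  by rewrite bM // (lin_zero (aL j)) (lin_zero (cL p)).
have lX2 : low3 (fun j n p => a j (b n (c p v))).
  move=> p; have [M bM] := b0 (c p v); exists M => j n Mn.
  by rewrite bM // (lin_zero (aL j)).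
have uY1 : upp3 (fun j n p => c p (b n (a j v))).
  move=> p; have [M aM] := a0 v; exists M => j n Mn.
  by rewrite aM // (lin_zero (bL n)) (lin_zero (cL p)).
have uY2 : upp3 (fun j n p => b n (a j (c p v))).
  move=> p; have [M aM] := a0 (c p v); exists M => j n Mn.
  by rewrite aM // (lin_zero (bL n)).
have lX : low3 X.
  move=> p; have [M X1] := lX1 p; have [M' X2] := lX2 p; exists (maxn M M') => j n Mn.
  by rewrite /X X1 ?X2 ?scaler0 ?addr0 //; lia.
have uY : upp3 Y.
  move=> p; have [M Y1] := uY1 p; have [M' Y2] := uY2 p; exists (maxn M M') => j n Mn.
  by rewrite /Y Y1 ?Y2 ?scaler0 ?addr0 //; lia.
have -> : scomm (s2 (+) s3) (nop s1 a b) c v = resid ((-1) ^+ s1) X Y.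
  apply/funext=> k; apply/funext=> p; rewrite residP // scaleNr addrC.
  rewrite /scomm -/e nopE (lin_add (cL p)) (lin_scale (cL p)).
  rewrite (nsum_lin (cL p)); last exact: lfield_low aL fb.
  by rewrite (psum_lin (cL p)); last exact: lfield_upp fa bL.
have zw (F : int -> int -> int -> V) M j n p :
    iter M (@dzw K V) F j n p = iter M (@dmul K V) (fun j n => F j n p) j n.
  by elim: M j n => //= M IHM j n; rewrite /dzw /dmul !IHM.
have zu (F : int -> int -> int -> V) M j n p :
    iter M (@dzu K V) F j n p = iter M (@dmul K V) (fun j p => F j n p) j p.
  by elim: M j p => //= M IHM j p; rewrite /dzu /dmul !IHM.
have wu (F : int -> int -> int -> V) M j n p :
    iter M (@dwu K V) F j n p = iter M (@dmul K V) (fun n p => F j n p) n p.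
  by elim: M n p => //= M IHM n p; rewrite /dwu /dmul !IHM.
have dlin (g : V -> V) M (F : int -> int -> V) m n : linear g ->
    iter M (@dmul K V) (fun m n => g (F m n)) m n = g (iter M (@dmul K V) F m n).
  by move=> gL; elim: M m n => //= M IHM m n; rewrite /dmul !IHM (lin_sub gL).
pose T3 := int -> int -> int -> V; pose Z : T3 := fun _ _ _ => 0.
have split3 M x (F G : T3) :
    iter M (@dzu K V) (iter M (@dwu K V) (fun j n p => x *: F j n p + G j n p))
  = fun j n p => x *: iter M (@dzu K V) (iter M (@dwu K V) F) j n p
                 + iter M (@dzu K V) (iter M (@dwu K V) G) j n p.
  have dP (d : T3 -> T3) : (forall F G, d (fun j n p => x *: F j n p + G j n p)
      = fun j n p => x *: d F j n p + d G j n p) ->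
    forall F G, iter M d (fun j n p => x *: F j n p + G j n p)
      = fun j n p => x *: iter M d F j n p + iter M d G j n p.
    by move=> dE F' G'; elim: M => //= M ->.
  rewrite !dP // => F' G'; do 3!apply/funext=> ?;
    by rewrite /dwu /dzu opprD addrACA -scalerBr.
have Z_of_zu M F : (forall n, iter M (@dmul K V) (F n) = fun _ _ => 0) ->
    iter M (@dzu K V) (iter M (@dwu K V) (fun j n p => F n j p)) = Z.
  move=> F0; rewrite (iter_comm (@dzu_dwu K V)).
  have -> : iter M (@dzu K V) (fun j n p => F n j p) = Z.
    by do 3!apply/funext=> ?; rewrite zu F0.
  elim: (M) => //= M' ->; do 3!apply/funext=> ?; exact: subrr.
have Z_of_wu M F : (forall j, iter M (@dmul K V) (F j) = fun _ _ => 0) ->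
    iter M (@dzu K V) (iter M (@dwu K V) (fun j n p => F j n p)) = Z.
  move=> F0; have -> : iter M (@dwu K V) (fun j n p => F j n p) = Z.
    by do 3!apply/funext=> ?; rewrite wu F0.
  elim: (M) => //= M' ->; do 3!apply/funext=> ?; exact: subrr.
apply: dong_resid => // [j n p||].
- rewrite !zw; have -> : (fun j n => X j n p) = fun j n =>
      (-1) ^+ s1 *: Y j n p
      + (- e *: c p (scomm s1 a b v j n) + scomm s1 a b (c p v) j n).
    apply/funext=> j'; apply/funext=> n'; rewrite /X /Y /scomm.
    rewrite (lin_sub (cL p)) (lin_scale (cL p)) scalerBr scalerDr !scalerA.
    rewrite [- e * _]mulrC addrACA [_ + (_ *: c p _ - _)]addrC subrK.
    by rewrite [_ + (a _ _ - _)]addrC subrK.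
  rewrite iter_dmulP -[RHS]addr0; congr (_ + _).
  by rewrite iter_dmulP (dlin (c p)) // !abN (lin_zero (cL p)) scaler0 addr0.
(* Moving c past b and then past a: one term is killed by powers of w - u, the other by powers of z
   - u. *)
- have -> : X = fun j n p =>
      (-1) ^+ s3 *: scomm s2 a c (b n v) j p + a j (scomm s3 b c v n p).
    do 3!apply/funext=> ?; rewrite /X /scomm (lin_sub (aL _)) (lin_scale (aL _)).
    by rewrite scalerBr scalerA [RHS]addrC addrA subrK scaleNr [LHS]addrC signE mulrC.
  rewrite split3 (Z_of_zu N (fun n => scomm s2 a c (b n v))) //.
  rewrite (Z_of_wu N (fun j n p => a j (scomm s3 b c v n p))) => [|j'].
    by do 3!apply/funext=> ?; rewrite scaler0 addr0.
  by do 2!apply/funext=> ?; rewrite (dlin (a j')) // bcN (lin_zero (aL _)).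
- have -> : Y = fun j n p =>
      (-1) ^+ s2 *: scomm s3 b c (a j v) n p + b n (scomm s2 a c v j p).
    do 3!apply/funext=> ?; rewrite /Y /scomm (lin_sub (bL _)) (lin_scale (bL _)).
    by rewrite scalerBr scalerA [RHS]addrC addrA subrK scaleNr [LHS]addrC signE.
  rewrite split3 (Z_of_wu N (fun j => scomm s3 b c (a j v))) //.
  rewrite (Z_of_zu N (fun n j p => b n (scomm s2 a c v j p))) => [|n'].
    by do 3!apply/funext=> ?; rewrite scaler0 addr0.
  by do 2!apply/funext=> ?; rewrite (dlin (b n')) // acN (lin_zero (bL _)).
Qed.

End FieldCalculus.

(** * States and translation covariance *)

Section StateField.
Variables (K : numFieldType) (V : lmodType K) (T : V -> V) (vac : V).
Implicit Types a b : field V.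
Hypothesis TL : linear T.

Definition creative a := forall m : int, 0 <= m -> a m vac = 0.
Definition covariant a := forall m v, T (a m v) - a m (T v) = fderiv a m v.

Lemma creative_fderiv a : creative a -> creative (fderiv a).
Proof.
move=> av [[|m]|//] _; rewrite /fderiv; first by rewrite mulr0z oppr0 scale0r.
by rewrite av ?scaler0 //; lia.
Qed.

Lemma creative_comb x a b : creative a -> creative b ->
  creative (fun m v => x *: a m v + b m v).
Proof. by move=> av bv m m0; rewrite av ?bv // scaler0 addr0. Qed.

Lemma nop_vac s a b m : lfield a -> lfield b -> creative a ->
  nop s a b m vac = nsum (fun j => a j (b (m - j - 1) vac)).
Proof.
move=> fa [bL _] av; rewrite nopE (eq_psum (g := fun=> 0)) => [|j j0].
  by rewrite psum0 scaler0 addr0.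
by rewrite av // lin_zero.
Qed.

Lemma creative_nop s a b : lfield a -> lfield b -> creative a -> creative b ->
  creative (nop s a b).
Proof.
move=> fa fb av bv m m0; rewrite nop_vac // (eq_nsum (g := fun=> 0)) ?nsum0 // => j j0.
by rewrite bv ?(lin_zero (fa.1 _)) //; lia.
Qed.

Lemma nop_state s a b : lfield a -> lfield b -> creative a -> creative b ->
  nop s a b (-1) vac = a (-1) (b (-1) vac).
Proof.
move=> fa fb av bv; rewrite nop_vac // (@nsumE _ _ 1) ?big_ord1 // => j j0.
by rewrite bv ?(lin_zero (fa.1 _)) //; lia.
Qed.

Lemma covariant_fderiv a : covariant a -> covariant (fderiv a).
Proof.
move=> cov m v; rewrite /fderiv (lin_scale TL) -scalerBr cov /fderiv.
by rewrite !scalerA; congr (_ *: _).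
Qed.

Lemma covariant_comb x a b : covariant a -> covariant b ->
  covariant (fun m v => x *: a m v + b m v).
Proof.
move=> ca cb m v; rewrite TL opprD addrACA -scalerBr ca cb /fderiv.
by rewrite scalerDr !scalerA mulrC.
Qed.

(** Summation by parts behind the Leibniz rule for normally ordered products. The half-line has no
    boundary term because the coefficient -j vanishes at j = 0. *)
Lemma nsum_covariant (m : int) (A : int -> V) : vanish_low A ->
  nsum (fun j => - j%:~R *: A (j - 1) + - (m - 1 - j)%:~R *: A j)
  = - m%:~R *: nsum A.
Proof.
move=> vA; pose G j := - (j%:~R : K) *: A (j - 1).
pose H j := - ((m - 1 - j)%:~R : K) *: A j.
have vG : vanish_low G.
  by have [M A0] := vA; exists M => j jM; rewrite /G A0 ?scaler0 //; lia.
have vG1 : vanish_low (fun j => G (j + 1)).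
  by have [M G0] := vG; exists M.+1 => j jM; apply: G0; lia.
have vH : vanish_low H.
  by have [M A0] := vA; exists M => j jM; rewrite /H A0 ?scaler0.
have v0 : vanish_low (fun=> 0 : V) by exists 0%N.
rewrite (eq_nsum (g := fun j => 1 *: G j + H j)) => [|j _]; last by rewrite scale1r.
rewrite nsumP //; have := nsum_shift vG.
rewrite {2}/G mulr0z oppr0 scale0r add0r => <-.
rewrite -nsumP // -[RHS]addr0 -nsum0 -nsumP //; apply: eq_nsum => j _.
rewrite scale1r addr0 /G /H addrK -scalerDl -opprD -intrD.
by congr (- _%:~R *: _); lia.
Qed.

Lemma psum_covariant (m : int) (A : int -> V) : vanish_upp A ->
  psum (fun j => - j%:~R *: A (j - 1) + - (m - 1 - j)%:~R *: A j)
  = - m%:~R *: psum A.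
Proof.
move=> vA; pose G j := - (j%:~R : K) *: A (j - 1).
pose H j := - ((m - 1 - j)%:~R : K) *: A j.
have vG : vanish_upp G.
  by have [M A0] := vA; exists M.+1 => j jM; rewrite /G A0 ?scaler0 //; lia.
have vG1 : vanish_upp (fun j => G (j + 1)).
  by have [M G0] := vG; exists M => j jM; apply: G0; lia.
have vH : vanish_upp H.
  by have [M A0] := vA; exists M => j jM; rewrite /H A0 ?scaler0.
have v0 : vanish_upp (fun=> 0 : V) by exists 0%N.
rewrite (eq_psum (g := fun j => 1 *: G j + H j)) => [|j _]; last by rewrite scale1r.
rewrite psumP //; have := psum_shift vG; rewrite {2}/G mulr0z oppr0 scale0r add0r => ->.
rewrite -psumP // -[RHS]addr0 -psum0 -psumP //; apply: eq_psum => j _.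
rewrite scale1r addr0 /G /H addrK -scalerDl -opprD -intrD.
by congr (- _%:~R *: _); lia.
Qed.

Lemma covariant_nop s a b : lfield a -> lfield b -> covariant a -> covariant b ->
  covariant (nop s a b).
Proof.
move=> fa fb ca cb m v; have [[aL _] [bL _]] := (fa, fb).
pose A j := a j (b (m - 1 - j - 1) v); pose B j := b (m - 1 - j - 1) (a j v).
have vA : vanish_low A := lfield_low _ _ aL fb.
have vB : vanish_upp B := lfield_upp _ _ fa bL.
have vab w : vanish_low (fun j => a j (b (m - j - 1) w)) := lfield_low _ _ aL fb.
have vba w : vanish_upp (fun j => b (m - j - 1) (a j w)) := lfield_upp _ _ fa bL.
have vTab : vanish_low (fun j => T (a j (b (m - j - 1) v))).
  by have [M ab0] := vab v; exists M => j jM; rewrite ab0 // (lin_zero TL).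
have vTba : vanish_upp (fun j => T (b (m - j - 1) (a j v))).
  by have [M ba0] := vba v; exists M => j jM; rewrite ba0 // (lin_zero TL).
rewrite /fderiv !nopE (lin_add TL) (lin_scale TL).
rewrite (nsum_lin TL) // (psum_lin TL) // opprD addrACA -scalerBr.
rewrite [RHS]scalerDr [X in _ = _ + X]scalerA [X in _ = _ + X *: _]mulrC.
rewrite -[X in _ = _ + X]scalerA; congr (_ + _ *: _).
  rewrite addrC -scaleN1r -nsumP // -(nsum_covariant m vA).
  apply: eq_nsum => j _; rewrite scaleN1r addrC.
  rewrite -[T _](subrK (a j (T (b (m - j - 1) v)))) ca -addrA -(lin_sub (aL j)) cb.
  by rewrite /fderiv (lin_scale (aL j)) /A; congr (_ *: a _ (b _ _) + - _%:~R *: a _ (b _ _)); lia.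
rewrite addrC -scaleN1r -psumP // -(psum_covariant m vB).
apply: eq_psum => j _; rewrite scaleN1r addrC.
rewrite -[T _](subrK (b (m - j - 1) (T (a j v)))) cb -addrA -(lin_sub (bL _)) ca.
rewrite /fderiv (lin_scale (bL _)) /B [LHS]addrC.
by congr (_ *: b _ (a _ _) + - _%:~R *: b _ (a _ _)); lia.
Qed.

Lemma iter_fderivE k a m v : iter k (@fderiv K V) a m v =
  (\prod_(i < k) (i%:R - m%:~R)) *: a (m - k%:Z) v.
Proof.
elim: k m => [|k IHk] m; first by rewrite big_ord0 scale1r subr0.
rewrite iterS /fderiv IHk scalerA big_ord_recl sub0r.
congr (_ * _ *: a _ v); last by lia.
by apply: eq_bigr => i _; rewrite lift0 -natr1 intrB mulr1z opprB addrA addrAC.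
Qed.

Lemma fderiv_div_state k a v : fderiv_div k a (-1) v = a (- 1 - k%:Z) v.
Proof.
rewrite /fderiv_div iter_fderivE scalerA.
have -> : \prod_(i < k) (i%:R - (-1)%:~R) = k`!%:R :> K.
  elim: k => [|k IHk]; first by rewrite big_ord0.
  by rewrite big_ord_recr /= IHk opprK natr1 -natrM mulnC.
by rewrite mulVf ?scale1r // pnatr_eq0 -lt0n fact_gt0.
Qed.

(** On the vacuum, covariance is a recursion from mode m to mode m - 1 with factor -m, invertible
    for m < 0 in characteristic 0; the state of the field starts it. *)
Lemma creative_covariant_eq0 a : (forall m, linear (a m)) -> T vac = 0 ->
  creative a -> covariant a -> a (-1) vac = 0 -> forall m, a m vac = 0.
Proof.
move=> aL Tv av cov av1 [m|m]; first exact: av.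
elim: m => [//|m IHm].
have := cov (Negz m) vac; rewrite IHm Tv (lin_zero TL) (lin_zero (aL _)) subr0 /fderiv.
move/esym/eqP; rewrite scaler_eq0 oppr_eq0 intr_eq0 /= => /eqP <-.
by congr a; lia.
Qed.

End StateField.

(** Goddard's uniqueness theorem: locality with a generating field carries the vanishing of a(z)
    from a vector v to its images under the modes of that field. *)
Lemma goddard (K : fieldType) (V : lmodType K) (vac : V) (I : Type) (g : I -> field V)
    (s : I -> bool) (a : field V) :
  (forall P : V -> Prop, P vac -> (forall x u v, P u -> P v -> P (x *: u + v)) ->
     (forall i n v, P v -> P (g i n v)) -> forall v, P v) ->
  (forall i, lfield (g i)) -> (forall m, linear (a m)) -> (forall i, local (s i) a (g i)) ->
  (forall m, a m vac = 0) -> forall m v, a m v = 0.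
Proof.
move=> gen gf aL loc av m v; move: v m; apply: gen => // [x u v au au' m|i n v av0 m].
  by rewrite aL au au' scaler0 addr0.
have [N locN] := loc i; have [M gM] := (gf i).2 v.
(* If (z - w)h = 0 then h is constant along antidiagonals, and each of these enters the region where
   h vanishes. *)
have h0 N' (h : int -> int -> V) : (forall m (n : int), M%:Z <= n -> h m n = 0) ->
    iter N' (@dmul K V) h = (fun _ _ => 0) -> forall m n, h m n = 0.
  elim: N' h => [|N' IHN] h hM; first by move=> /= ->.
  rewrite iterSr => /IHN dh p q.
  have {}dh p' q' : h (p' + 1) q' = h p' (q' + 1).
    apply/eqP; rewrite -subr_eq0; apply/eqP; apply: dh => m' n' Mn.
    by rewrite /dmul !hM ?subrr //; lia.
  have hr r : h p q = h (p - r%:Z) (q + r%:Z).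
    elim: r => [|r ->]; first by rewrite subr0 addr0.
    by rewrite (_ : p - r%:Z = p - r.+1%:Z + 1) ?dh; [congr h|]; lia.
  by rewrite (hr (M + `|q|)%N) hM //; lia.
apply: (h0 N (fun m n => a m (g i n v))) => [p q Mq|].
  by rewrite gM // (lin_zero (aL p)).
rewrite -(locN v); congr iter; apply/funext=> p; apply/funext=> q.
by rewrite /scomm av0 (lin_zero ((gf i).1 q)) scaler0 subr0.
Qed.

(** * Fermions on Fock space *)

Lemma mcoeff_basis (K : fieldType) (T : choiceType) (k k' : T) :
  (<< k >> : {malg K[T]})@_k' = (k == k')%:R.
Proof. exact: mcoeffU. Qed.

Lemma malg_span (K : fieldType) (T : choiceType) (P : {malg K[T]} -> Prop) :
  P 0 -> (forall a u v, P u -> P v -> P (a *: u + v)) ->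
  (forall k, P << k >>) -> forall u, P u.
Proof.
move=> P0 PL Pk u; rewrite (monalgE u); elim/big_ind: _ => // [x y Px Py|k _].
  by rewrite -[x]scale1r; apply: PL.
have -> : << u@_k *g k >> = u@_k *: << k >> + 0 :> {malg K[T]}.
  by apply/malgP => k'; rewrite addr0 mcoeffZ !mcoeffU mulrnAr mulr1.
exact: PL.
Qed.

Lemma malg_lin_ext (K : fieldType) (T : choiceType) (V : lmodType K)
    (f g : {malg K[T]} -> V) : linear f -> linear g ->
  (forall k, f << k >> = g << k >>) -> f =1 g.
Proof.
move=> fL gL fg; apply: malg_span => [|a u v fu fv|//].
  by rewrite (lin_zero fL) (lin_zero gL).
by rewrite fL gL fu fv.
Qed.

Section Fermions.
Variables (K : fieldType) (l : nat).
Local Notation cmode := (cmode l).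
Local Notation F := (Fock K l).
Local Notation create := (@create K l).
Local Notation annihilate := (@annihilate K l).
Implicit Types (x y : cmode) (S : {fset cmode}) (i j : 'I_(l + l)).

Lemma mode_le_anti x y : x != y -> mode_le x y = ~~ mode_le y x.
Proof.
case: x y => [i m] [j n]; rewrite /mode_le /= xpair_eqE -!val_eqE /= => ij; lia.
Qed.

Lemma mode_le_trans : transitive (@mode_le l).
Proof. by move=> [j n] [i m] [k p]; rewrite /mode_le /= -!val_eqE /=; lia. Qed.

Lemma mode_le_total : total (@mode_le l).
Proof. by move=> [i m] [j n]; rewrite /mode_le /= -!val_eqE /=; lia. Qed.

Lemma mode_le_antisym : antisymmetric (@mode_le l).
Proof.
move=> x y /andP[xy yx]; apply/eqP/negPn/negP => xNy.
by move: xy; rewrite mode_le_anti // yx.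
Qed.

Lemma conj_idxK : involutive (@conj_idx l).
Proof.
move=> i; rewrite /conj_idx; case: (splitP i) => p ip.
  rewrite (_ : rshift l p = unsplit (inr p)) // unsplitK.
  by apply: val_inj; rewrite /= ip.
rewrite (_ : lshift l p = unsplit (inl p)) // unsplitK.
by apply: val_inj; rewrite /= ip.
Qed.

Lemma conj_idx_lshift (p : 'I_l) : conj_idx (lshift l p) = rshift l p.
Proof. by rewrite /conj_idx (_ : lshift l p = unsplit (inl p)) // unsplitK. Qed.

Lemma conj_idx_rshift (p : 'I_l) : conj_idx (rshift l p) = lshift l p.
Proof. by rewrite /conj_idx (_ : rshift l p = unsplit (inr p)) // unsplitK. Qed.

Lemma conj_idx_neq i : (conj_idx i == i) = false.
Proof.
rewrite -(splitK i); case: (split i) => p /=.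
  by rewrite conj_idx_lshift -val_eqE /=; have := ltn_ord p; lia.
by rewrite conj_idx_rshift -val_eqE /=; have := ltn_ord p; lia.
Qed.

Lemma conj_idx_eq i j : (conj_idx i == conj_idx j) = (i == j).
Proof. exact: (inj_eq (inv_inj conj_idxK)). Qed.

Lemma conj_idx_eqC i j : (conj_idx i == j) = (i == conj_idx j).
Proof. by rewrite -{1}(conj_idxK j) conj_idx_eq. Qed.

Lemma fermi_signU x y S : y \notin S ->
  fermi_sign K x (y |` S)%fset = (-1) ^+ ((y != x) && mode_le y x) * fermi_sign K x S.
Proof.
move=> yS; rewrite /fermi_sign -exprD; congr (_ ^+ _).
rewrite -!sum1_count big_mkcond big_fsetU1 // -big_mkcond /=.
by case: (_ && _).
Qed.

Lemma fermi_signD x y S : y \in S ->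
  fermi_sign K x S = (-1) ^+ ((y != x) && mode_le y x) * fermi_sign K x (S `\ y)%fset.
Proof. by move=> yS; rewrite -fermi_signU ?fsetD1K // !inE eqxx. Qed.

Lemma fermi_sign_sqr x S : fermi_sign K x S * fermi_sign K x S = 1.
Proof. by rewrite -expr2 sqrr_sign. Qed.

Lemma createU x S : create x << S >> =
  if x \in S then 0 else fermi_sign K x S *: << (x |` S)%fset >> :> F.
Proof. exact: linextU. Qed.

Lemma annihilateU x S : annihilate x << S >> =
  if x \in S then fermi_sign K x S *: << (S `\ x)%fset >> else 0 :> F.
Proof. exact: linextU. Qed.

Lemma create_linear x : linear (create x).
Proof. exact: linearP. Qed.

Lemma annihilate_linear x : linear (annihilate x).
Proof. exact: linearP. Qed.

HB.instance Definition _ x :=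
  GRing.isLinear.Build K F F *:%R (create x) (create_linear x).
HB.instance Definition _ x :=
  GRing.isLinear.Build K F F *:%R (annihilate x) (annihilate_linear x).

Lemma signs_cancel x y : x != y ->
  (-1) ^+ ((x != y) && mode_le x y) + (-1) ^+ ((y != x) && mode_le y x) = 0 :> K.
Proof.
move=> xy; rewrite [y == x]eq_sym xy (mode_le_anti xy) /=.
by case: mode_le; rewrite expr1 expr0 ?addNr ?addrN.
Qed.

Lemma signs_mul x y : x != y ->
  (-1) ^+ ((y != x) && mode_le y x) * (-1) ^+ ((x != y) && mode_le x y) = -1 :> K.
Proof.
move=> xy; rewrite [y == x]eq_sym xy (mode_le_anti xy) /=.
by case: mode_le; rewrite expr1 expr0 ?mulr1 ?mul1r.
Qed.

Lemma create_anti x y (v : F) : create x (create y v) + create y (create x v) = 0.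
Proof.
move: v; apply: malg_lin_ext => [a u v|a u v|S].
- by rewrite !create_linear scalerDr addrACA.
- by rewrite scaler0 addr0.
have [<-|xy] := eqVneq x y.
  rewrite createU; case: ifP => xS; first by rewrite !linear0 addr0.
  by rewrite !linearZ /= createU !inE eqxx /= scaler0 addr0.
rewrite [create y << S >>]createU [create x << S >>]createU.
have [yS|yS] := boolP (y \in S); have [xS|xS] := boolP (x \in S).
- by rewrite !linear0 addr0.
- by rewrite linear0 linearZ /= createU !inE yS orbT scaler0 addr0.
- by rewrite linear0 linearZ /= createU !inE xS orbT scaler0 addr0.
rewrite !linearZ /= !createU !inE (negPf xS) (negPf yS) [y == x]eq_sym (negPf xy) /=.
rewrite !fermi_signU // fsetUCA !scalerA -scalerDl.
rewrite [X in X + _]mulrCA [X in _ + X]mulrCA [fermi_sign K y S * _]mulrC.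
by rewrite -mulrDl addrC signs_cancel // mul0r scale0r.
Qed.

Lemma annihilate_anti x y (v : F) :
  annihilate x (annihilate y v) + annihilate y (annihilate x v) = 0.
Proof.
move: v; apply: malg_lin_ext => [a u v|a u v|S].
- by rewrite !annihilate_linear scalerDr addrACA.
- by rewrite scaler0 addr0.
have [<-|xy] := eqVneq x y.
  rewrite annihilateU; case: ifP => xS; last by rewrite !linear0 addr0.
  by rewrite !linearZ /= annihilateU !inE eqxx /= scaler0 addr0.
have yx : y != x by rewrite eq_sym.
rewrite [annihilate y << S >>]annihilateU [annihilate x << S >>]annihilateU.
have [yS|yS] := boolP (y \in S); have [xS|xS] := boolP (x \in S); last first.
- by rewrite !linear0 addr0.
- by rewrite linear0 linearZ /= annihilateU !inE (negPf yS) andbF scaler0 addr0.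
- by rewrite linear0 linearZ /= annihilateU !inE (negPf xS) andbF scaler0 addr0.
rewrite !linearZ /= !annihilateU !inE xS yS xy yx /=.
rewrite [fermi_sign K y S](fermi_signD _ xS) [fermi_sign K x S](fermi_signD _ yS).
rewrite !scalerA !fsetDDl [([fset y] `|` _)%fset]fsetUC -scalerDl.
rewrite -!mulrA [fermi_sign K y _ * _]mulrC -mulrDl signs_cancel // mul0r.
by rewrite scale0r.
Qed.

Lemma create_annihilate x y (v : F) :
  create x (annihilate y v) + annihilate y (create x v) = if x == y then v else 0.
Proof.
move: v; apply: malg_lin_ext => [a u v|a u v|S].
- by rewrite !(create_linear, annihilate_linear) scalerDr addrACA.
- by case: eqP => // _; rewrite scaler0 addr0.
have [<-|xy] := eqVneq x y.
  rewrite createU annihilateU; case: ifP => xS; rewrite linear0 linearZ /=.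
    rewrite createU !inE eqxx /= fsetD1K // scalerA.
    rewrite (fermi_signD x xS) eqxx /= mul1r fermi_sign_sqr scale1r addr0 //.
  rewrite annihilateU !inE eqxx /= fsetU1K ?xS // scalerA.
  by rewrite fermi_signU ?xS // eqxx /= mul1r fermi_sign_sqr scale1r add0r.
have yx : y != x by rewrite eq_sym.
rewrite [annihilate y << S >>]annihilateU [create x << S >>]createU.
have [yS|yS] := boolP (y \in S); have [xS|xS] := boolP (x \in S); last first.
- rewrite linear0 linearZ /= annihilateU !inE (negPf yS) (negPf yx) /=.
  by rewrite scaler0 addr0.
- by rewrite !linear0 addr0.
- rewrite !linearZ /= createU annihilateU !inE yS (negPf xS) andbF orbT /=.
  rewrite fermi_signU // [fermi_sign K x S](fermi_signD _ yS) !scalerA.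
  have -> : ((x |` S) `\ y = x |` (S `\ y))%fset.
    by apply/fsetP => z; rewrite !inE; case: (eqVneq z x) => [->|]; rewrite ?xy.
  rewrite mulrACA signs_mul // mulN1r [fermi_sign K x _ * _]mulrC scaleNr.
  exact: subrr.
- by rewrite linear0 linearZ /= createU !inE xS xy scaler0 addr0.
Qed.

End Fermions.

Section FreeFields.
Variables (K : numFieldType) (l : nat).
Local Notation cmode := (cmode l).
Local Notation F := (Fock K l).
Local Notation psi := (@psi K l).
Local Notation create := (@create K l).
Local Notation annihilate := (@annihilate K l).
Local Notation vac := (Fock_vac K l).
Implicit Types (x y : cmode) (S : {fset cmode}) (i j : 'I_(l + l)).

Lemma psi_linear i m : linear (psi i m).
Proof. by case: m => n; [exact: annihilate_linear | exact: create_linear]. Qed.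

HB.instance Definition _ i m :=
  GRing.isLinear.Build K F F *:%R (psi i m) (psi_linear i m).

(** The condition is m + n + 1 = 0 because [psi i m] is the half-integral mode m + 1/2. *)
Lemma psi_anti i j m n (v : F) : psi i m (psi j n v) + psi j n (psi i m v) =
  if (i == conj_idx j) && (m + n + 1 == 0) then v else 0.
Proof.
case: m => m; case: n => n /=.
- rewrite annihilate_anti; case: eqP => //= _; case: eqP => //; lia.
- rewrite addrC create_annihilate xpair_eqE [j == _]eq_sym conj_idx_eqC.
  by congr (if _ && _ then _ else _); lia.
- rewrite create_annihilate xpair_eqE.
  by congr (if _ && _ then _ else _); lia.
- rewrite create_anti; case: eqP => //= _; case: eqP => //; lia.
Qed.

Lemma psi_swap i j m n (v : F) : psi i m (psi j n v) =
  (if (i == conj_idx j) && (m + n + 1 == 0) then v else 0) - psi j n (psi i m v).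
Proof. by rewrite -psi_anti addrK. Qed.

Lemma psi_vac i (n : nat) : psi i n vac = 0.
Proof. by rewrite /= annihilateU inE. Qed.

Lemma create_min x S : (forall y, y \in S -> y != x -> mode_le x y) ->
  x \notin S -> create x << S >> = << (x |` S)%fset >>.
Proof.
move=> xmin xS; rewrite createU (negPf xS) /fermi_sign.
rewrite (_ : count _ _ = 0%N) ?scale1r //; apply/eqP; rewrite -leqn0 leqNgt -has_count.
apply/hasPn => y yS; have [//|yx /=] := eqVneq y x.
by rewrite mode_le_anti // xmin.
Qed.

Lemma foldr_create (s : seq cmode) : sorted (@mode_le l) s -> uniq s ->
  foldr create vac s = << [fset x in s]%fset >>.
Proof.
elim: s => [|x s IHs] /=.
  by move=> _ _; congr << _ >>; apply/fsetP => y; rewrite !inE.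
move=> xs /andP[xNs us].
rewrite IHs ?(path_sorted xs) // create_min ?inE //.
  by congr << _ >>; apply/fsetP => y; rewrite !inE.
move=> y; rewrite inE => ys _; move: xs; rewrite path_sortedE; last first.
  exact: mode_le_trans.
by move=> /andP[/allP ltxs _]; exact: ltxs.
Qed.

Lemma modes_sorted S : sorted (@mode_le l) (modes S).
Proof. exact/sort_sorted/mode_le_total. Qed.

Lemma modes_uniq S : uniq (modes S).
Proof. by rewrite sort_uniq fset_uniq. Qed.

Lemma mem_modes S : modes S =i S.
Proof. by move=> x; rewrite mem_sort. Qed.

Lemma modes_seq (s : seq cmode) : sorted (@mode_le l) s -> uniq s ->
  modes [fset x in s]%fset = s.
Proof.
move=> ss us; apply: (sorted_eq (@mode_le_trans l)) => //.
- exact: mode_le_antisym.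
- exact: modes_sorted.
- apply: uniq_perm => //; first exact: modes_uniq.
  by move=> x; rewrite mem_modes inE.
Qed.

Lemma Fock_basisE S : << S >> = foldr create vac (modes S) :> F.
Proof.
rewrite foldr_create ?modes_sorted ?modes_uniq //; congr << _ >>.
by apply/fsetP => x; rewrite inE mem_modes.
Qed.

Lemma Fock_ind (P : F -> Prop) : P vac ->
  (forall a u v, P u -> P v -> P (a *: u + v)) ->
  (forall i n v, P v -> P (psi i (Negz n) v)) -> forall v, P v.
Proof.
move=> Pv PL Pc; apply: malg_span => // [|S].
  by rewrite -(subrr vac) addrC -scaleN1r; apply: PL.
rewrite Fock_basisE; elim: modes => //= [[i n] s Ps].
exact: (Pc i n).
Qed.

Definition vac_coef (v : F) : K := v@_fset0.

Lemma vac_coef_linear : linear (vac_coef : F -> K^o).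
Proof. by move=> a u v; rewrite /vac_coef mcoeffD mcoeffZ. Qed.

Lemma vac_coef_vac : vac_coef vac = 1.
Proof. exact: mcoeffUU. Qed.

Lemma vac_coef_create i n v : vac_coef (psi i (Negz n) v) = 0.
Proof.
move: v; apply: (malg_lin_ext (V := K^o)) => [a u v|a u v|S].
- by rewrite psi_linear vac_coef_linear.
- by rewrite scaler0 addr0.
rewrite /= createU; case: ifP => _; rewrite /vac_coef ?mcoeff0 //.
rewrite mcoeffZ mcoeff_basis; case: eqP => [/fsetP/(_ (i, n))|_]; last by rewrite mulr0.
by rewrite !inE eqxx.
Qed.

Lemma mcoeff_annihilate x (v : F) S : (annihilate x v)@_S =
  if x \in S then 0 else fermi_sign K x S * v@_(x |` S)%fset.
Proof.
move: v; apply: (malg_lin_ext (V := K^o)) => [a u v|a u v|T].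
- by rewrite linearP mcoeffD mcoeffZ.
- case: ifP => _; first by rewrite scaler0 addr0.
  by rewrite mcoeffD mcoeffZ mulrDr mulrCA.
rewrite annihilateU; case: ifP => xT; last first.
  rewrite mcoeff0 mcoeff_basis; case: ifP => // xS; case: eqP => [TE|_]; last by rewrite mulr0.
  by move: xT; rewrite TE !inE eqxx.
rewrite mcoeffZ !mcoeff_basis; have [xS|xS] := boolP (x \in S).
  case: eqP => [TE|_]; last by rewrite mulr0.
  by move: xS; rewrite -TE !inE eqxx.
rewrite (_ : (T `\ x == S)%fset = (T == (x |` S)%fset)); last first.
  by apply/eqP/eqP => [<-|->]; rewrite ?fsetD1K ?fsetU1K.
case: eqP => [->|_]; last by rewrite !mulr0.
by rewrite fermi_signU // eqxx mul1r.
Qed.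

Lemma annihilate_eq0 (v : F) : (forall i (n : nat), psi i n v = 0) ->
  v = vac_coef v *: vac.
Proof.
move=> v0; apply/malgP => S; rewrite mcoeffZ [vac]/Fock_vac mcoeff_basis /vac_coef eq_sym.
have [->|[x xS]] := fset_0Vmem S; first by rewrite eqxx mulr1.
have -> : (S == fset0) = false by apply/eqP => S0; rewrite S0 inE in xS.
rewrite mulr0; have := mcoeff_annihilate x v (S `\ x)%fset.
have := v0 (conj_idx x.1) x.2; rewrite /= conj_idxK -surjective_pairing => ->.
rewrite mcoeff0 !inE eqxx /= fsetD1K // => /esym/eqP.
by rewrite mulf_eq0 /fermi_sign signr_eq0 => /eqP.
Qed.

(** Schur's lemma for the Fock space: A sends the vacuum to a vector killed by all annihilators,
    hence to a multiple of the vacuum, and creation operators propagate its value. Operator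
    identities thereby reduce to commutators with [psi] and one vacuum coefficient. *)
Lemma intertwiner_eq0 (A : F -> F) e : linear A ->
  (forall i m v, A (psi i m v) = e *: psi i m (A v)) -> e != 0 ->
  vac_coef (A vac) = 0 -> forall v, A v = 0.
Proof.
move=> AL Apsi e0 Av; apply: Fock_ind => [|a u v Au A_v|i n v A_v].
- have -> : A vac = vac_coef (A vac) *: vac; last by rewrite Av scale0r.
  apply: annihilate_eq0 => i n; apply: (scalerI e0).
  by rewrite -Apsi psi_vac scaler0 (lin_zero AL).
- by rewrite AL Au A_v scaler0 addr0.
- by rewrite Apsi A_v linear0 scaler0.
Qed.

Lemma fset_bound S (f : cmode -> nat) : exists B, forall x, x \in S -> (f x <= B)%N.
Proof. by exists (\max_(x <- S) f x)%N => x xS; exact: leq_bigmax_seq xS _. Qed.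

Lemma lfield_psi i : lfield (psi i).
Proof.
split=> [m|]; first exact: psi_linear.
apply: malg_span => [|a u v [M uM] [N vN]|S].
- by exists 0%N => m _; rewrite linear0.
- by exists (maxn M N) => m mM; rewrite psi_linear uM ?vN ?scaler0 ?addr0 //; lia.
have [B SB] := fset_bound S (fun x => x.2).
exists B.+1 => -[m|//] mM /=; rewrite annihilateU; case: ifP => // xS.
by have := SB _ xS; rewrite /=; lia.
Qed.

Lemma creative_psi i : creative vac (psi i).
Proof. by move=> [n|//] _; rewrite psi_vac. Qed.

(** The anticommutator depends on m and n only through m + n, as a multiple of the delta function
    does, so one factor z - w kills it. *)
Lemma local_psi i j : local true (psi i) (psi j).
Proof.
exists 1%N => v; apply/funext=> m; apply/funext=> n; rewrite /= /dmul /scomm.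
rewrite expr1 !scaleN1r !opprK !psi_anti.
rewrite (_ : m + 1 + n + 1 = m + (n + 1) + 1) ?subrr //; lia.
Qed.

End FreeFields.

(** * Orthogonally invariant bilinears *)

Section BiinfiniteSums.
Variables (K : fieldType) (V : lmodType K).
Implicit Types f g : int -> V.

Definition zsum f : V := nsum f + psum f.
Definition bsupp f := vanish_low f /\ vanish_upp f.

Lemma eq_zsum f g : f =1 g -> zsum f = zsum g.
Proof. by move=> fg; congr (_ + _); [apply: eq_nsum|apply: eq_psum]. Qed.

Lemma zsumP a f g : bsupp f -> bsupp g ->
  zsum (fun j => a *: f j + g j) = a *: zsum f + zsum g.
Proof. by move=> [lf uf] [lg ug]; rewrite /zsum nsumP // psumP // scalerDr addrACA. Qed.

Lemma zsumE (M : nat) f : (forall j : int, j < - M%:Z -> f j = 0) ->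
  (forall j : int, M%:Z <= j -> f j = 0) ->
  zsum f = \sum_(i < M) (f (Negz i) + f (Posz i)).
Proof. by move=> lf uf; rewrite /zsum (nsumE lf) (psumE uf) big_split. Qed.

Lemma bsupp_bound f : bsupp f -> exists M : nat,
  (forall j : int, j < - M%:Z -> f j = 0) /\ (forall j : int, M%:Z <= j -> f j = 0).
Proof.
move=> [[M lf] [N uf]]; exists (maxn M N); split=> j jMN; [apply: lf|apply: uf]; lia.
Qed.

Lemma bsuppS f (c : int -> K) : bsupp f -> bsupp (fun j => c j *: f j).
Proof.
move=> [[M lf] [N uf]]; split; first by exists M => j jM; rewrite lf ?scaler0.
by exists N => j jN; rewrite uf ?scaler0.
Qed.

Lemma bsupp_add f g : bsupp f -> bsupp g -> bsupp (fun j => f j + g j).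
Proof.
move=> /bsupp_bound[M [lf uf]] /bsupp_bound[N [lg ug]].
split; exists (maxn M N) => j jM; first by rewrite lf ?lg ?addr0 //; lia.
by rewrite uf ?ug ?addr0 //; lia.
Qed.

Lemma bsupp_shift f (k : int) : bsupp f -> bsupp (fun j => f (j + k)).
Proof.
move=> [[M lf] [N uf]]; split; first by exists (M + `|k|)%N => j jM; apply: lf; lia.
by exists (N + `|k|)%N => j jM; apply: uf; lia.
Qed.

Lemma zsum_shift f (n : nat) : bsupp f -> zsum (fun j => f (j + n%:Z)) = zsum f.
Proof.
move=> ff; elim: n => [|n <-]; first by apply: eq_zsum => j; rewrite addr0.
have := bsupp_shift n%:Z ff; set g := fun j => f (j + n%:Z) => -[lg ug].
rewrite [RHS]/zsum (psum_shift ug) addrA [nsum g + _]addrC -(nsum_shift lg).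
by congr (_ + _); [apply: eq_nsum|apply: eq_psum] => j _; congr f; lia.
Qed.

Lemma bsupp_delta f j0 : bsupp (fun j => if j == j0 then f j else 0).
Proof.
split; exists `|j0|.+1 => j jj; case: eqP => // jE; lia.
Qed.

Lemma zsum_delta f j0 : zsum (fun j => if j == j0 then f j else 0) = f j0.
Proof.
case: j0 => n; rewrite /zsum.
  rewrite (eq_nsum (g := fun=> 0)) => [|j j0]; last by case: eqP => // jE; lia.
  rewrite nsum0 add0r (@psumE _ _ n.+1) => [|j ?]; last by case: eqP => // jE; lia.
  rewrite big_ord_recr /= eqxx big1 ?add0r // => i _.
  by case: eqP => // -[E]; have := ltn_ord i; rewrite E ltnn.
rewrite (eq_psum (g := fun=> 0)) => [|j j0]; last by case: eqP => // jE; lia.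
rewrite psum0 addr0 (@nsumE _ _ n.+1) => [|j ?]; last by case: eqP => // jE; lia.
rewrite big_ord_recr /= eqxx big1 ?add0r // => i _.
by case: eqP => // -[E]; have := ltn_ord i; rewrite E ltnn.
Qed.

End BiinfiniteSums.

Lemma zsum_lin (K : fieldType) (U V : lmodType K) (g : U -> V) (f : int -> U) :
  linear g -> bsupp f -> g (zsum f) = zsum (fun j => g (f j)).
Proof. by move=> gL [lf uf]; rewrite (lin_add gL) (nsum_lin gL) // (psum_lin gL). Qed.

Lemma bsupp_lin (K : fieldType) (U V : lmodType K) (g : U -> V) (f : int -> U) :
  linear g -> bsupp f -> bsupp (fun j => g (f j)).
Proof.
move=> gL [[M lf] [N uf]]; split; first by exists M => j ?; rewrite lf ?(lin_zero gL).
by exists N => j ?; rewrite uf ?(lin_zero gL).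
Qed.

Lemma zsum_sum (K : fieldType) (V : lmodType K) (I : Type) (r : seq I)
    (f : I -> int -> V) : (forall i, bsupp (f i)) ->
  zsum (fun j => \sum_(i <- r) f i j) = \sum_(i <- r) zsum (f i).
Proof.
move=> ff; suff [] : bsupp (fun j => \sum_(i <- r) f i j) /\
  zsum (fun j => \sum_(i <- r) f i j) = \sum_(i <- r) zsum (f i) by [].
elim: r => [|i r [fr IHr]].
  split; first by split; exists 0%N => j _; rewrite big_nil.
  rewrite big_nil (eq_zsum (g := fun=> 0)) => [|j]; last by rewrite big_nil.
  by rewrite /zsum nsum0 psum0 addr0.
have E : (fun j => \sum_(i' <- i :: r) f i' j) =
    fun j => 1 *: f i j + \sum_(i' <- r) f i' j.
  by apply/funext=> j; rewrite big_cons scale1r.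
split; first by rewrite E; apply: bsupp_add => //; exact: bsuppS.
by rewrite E zsumP // IHr big_cons scale1r.
Qed.

Lemma fin_bound (I : finType) (f : I -> nat) : exists M, forall i, (f i <= M)%N.
Proof. by exists (\max_i f i)%N => i; exact: leq_bigmax. Qed.

Section Bilinears.
Variables (K : numFieldType) (l : nat).
Local Notation F := (Fock K l).
Local Notation psi := (@psi K l).
Implicit Types (i j : 'I_(l + l)) (p q k : int) (v : F) (al : int -> K).

Definition bil_term i p q v : F :=
  if p < 0 then psi (conj_idx i) p (psi i q v) else - psi i q (psi (conj_idx i) p v).

(* The coefficients of [\sum_i :psi^i'(z) psi^i(w):]. *)
Definition bil p q v : F := \sum_i bil_term i p q v.

Lemma bil_term_linear i p q : linear (bil_term i p q).
Proof.
move=> a u v; rewrite /bil_term; case: ifP => _; rewrite !psi_linear //.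
by rewrite scalerN opprD.
Qed.

Lemma bil_linear p q : linear (bil p q).
Proof.
move=> a u v; rewrite /bil scaler_sumr -big_split.
by apply: eq_bigr => i _; rewrite bil_term_linear.
Qed.

HB.instance Definition _ p q :=
  GRing.isLinear.Build K F F *:%R (bil p q) (bil_linear p q).

Lemma sum_conj (f : 'I_(l + l) -> F) : \sum_i f (conj_idx i) = \sum_i f i.
Proof. by rewrite [RHS](reindex_inj (inv_inj (@conj_idxK l))). Qed.

Lemma psi_swap0 i j m n v : ~~ ((i == conj_idx j) && (m + n + 1 == 0)) ->
  psi i m (psi j n v) = - psi j n (psi i m v).
Proof. by move=> /negPf c0; rewrite psi_swap c0 sub0r. Qed.

(** For modes on opposite sides of the normal ordering both expressions are the same product. On the
    same side p + q + 1 is not 0, so the fermions anticommute without contraction. *)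
Lemma bil_anti p q v : bil p q v = - bil q p v.
Proof.
rewrite -sumrN -sum_conj; apply: eq_bigr => i _; rewrite /bil_term conj_idxK.
case: ltP => p0; case: ltP => q0; rewrite ?opprK //.
  by apply: psi_swap0; apply/nandP; right; lia.
by rewrite psi_swap0 ?opprK //; apply/nandP; right; lia.
Qed.

Lemma bil_term_psi i p q j b v :
  bil_term i p q (psi j b v) - psi j b (bil_term i p q v) =
  (if (i == conj_idx j) && (q + b + 1 == 0) then psi (conj_idx i) p v else 0)
  - (if (i == j) && (p + b + 1 == 0) then psi i q v else 0).
Proof.
rewrite /bil_term; case: ltP => p0.
  rewrite (psi_swap i) linearB /= (psi_swap (conj_idx i)) conj_idx_eq.
  rewrite opprB addrA addrAC addrK; congr (_ - _).
  by case: ifP => // _; rewrite linear0.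
rewrite (psi_swap (conj_idx i)) conj_idx_eq linearB /= (psi_swap i).
rewrite linearN /= !opprB opprK addrAC subrK; congr (_ - _).
by case: ifP => // _; rewrite linear0.
Qed.

(** The index j is untouched: the bilinears act on modes only, which is why they commute with the
    orthogonal group. *)
Lemma bil_psi p q j b v : bil p q (psi j b v) - psi j b (bil p q v) =
  (if q + b + 1 == 0 then psi j p v else 0)
  - (if p + b + 1 == 0 then psi j q v else 0).
Proof.
rewrite /bil linear_sum -sumrB.
rewrite (eq_bigr _ (fun i _ => bil_term_psi i p q j b v)) sumrB; congr (_ - _).
  rewrite (bigD1 (conj_idx j)) //= eqxx conj_idxK /= big1 ?addr0 // => i /negPf ->.
  by [].
by rewrite (bigD1 j) //= eqxx /= big1 ?addr0 // => i /negPf ->.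
Qed.

Lemma bil_term_bsupp i k v : bsupp (fun p => bil_term i p (k - p - 1) v).
Proof.
have [M vM] := (lfield_psi K i).2 v; have [N vN] := (lfield_psi K (conj_idx i)).2 v.
split; first exists (M + `|k|)%N => p pM.
  by rewrite /bil_term ifT ?(vM (k - p - 1)) ?linear0 //; lia.
by exists N => p pN; rewrite /bil_term ifF ?vN ?linear0 ?oppr0 //; lia.
Qed.

Lemma bil_bsupp k v : bsupp (fun p => bil p (k - p - 1) v).
Proof.
have /choice[f fM] := fun i => bsupp_bound (bil_term_bsupp i k v).
have [M Mf] := fin_bound f.
split; exists M => p pM; apply: big1 => i _; have := Mf i; have [lf uf] := fM i.
  by move=> fiM; apply: lf; lia.
by move=> fiM; apply: uf; lia.
Qed.

Fact quad_key : unit. Proof. exact: tt. Qed.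
(* Locked, as is [rho] below: comparing the normal forms of two
   vectors of the Fock space is hopeless. *)
Definition quad : int -> (int -> K) -> F -> F := locked_with quad_key
  (fun k al v => zsum (fun p => al p *: bil p (k - p - 1) v)).

Lemma quadE k al v : quad k al v = zsum (fun p => al p *: bil p (k - p - 1) v).
Proof. by rewrite /quad unlock. Qed.

Lemma quad_linear k al : linear (quad k al).
Proof.
move=> a u v; rewrite !quadE -zsumP; try exact/bsuppS/bil_bsupp.
by apply: eq_zsum => p; rewrite linearP scalerDr !scalerA mulrC.
Qed.

Lemma quadP a k al be v :
  quad k (fun p => a * al p + be p) v = a *: quad k al v + quad k be v.
Proof.
rewrite !quadE -zsumP; try exact/bsuppS/bil_bsupp.
by apply: eq_zsum => p; rewrite scalerDl scalerA.
Qed.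

Lemma eq_quad k al be v : al =1 be -> quad k al v = quad k be v.
Proof. by move=> ab; rewrite !quadE; apply: eq_zsum => p; rewrite ab. Qed.

(** Only the part of [al] that is skew under p -> k - p - 1 survives, as [bil] is skew itself. *)
Lemma quad_psi k al j b v : quad k al (psi j b v) - psi j b (quad k al v) =
  (al (k + b) - al (- b - 1)) *: psi j (k + b) v.
Proof.
have fq w : bsupp (fun p => al p *: bil p (k - p - 1) w).
  exact/bsuppS/bil_bsupp.
rewrite !quadE (zsum_lin (psi_linear j b)) // addrC -scaleN1r.
rewrite -zsumP //; last exact: bsupp_lin (psi_linear j b) (fq v).
rewrite (eq_zsum (g := fun p => -1 *: (if p == - b - 1 then al p *: psi j (k - p - 1) v else 0)
   + if p == k + b then al p *: psi j p v else 0)) => [|p].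
  rewrite zsumP; try exact: bsupp_delta.
  rewrite !zsum_delta scaleN1r addrC (_ : k - (- b - 1) - 1 = k + b); last by lia.
  by rewrite -scalerBl.
rewrite linearZ /= !scaleN1r addrC -scalerBr bil_psi scalerBr addrC.
congr (- _ + _).
  have -> : (p + b + 1 == 0) = (p == - b - 1) by apply/eqP/eqP; lia.
  by case: ifP => // _; rewrite scaler0.
have -> : (k - p - 1 + b + 1 == 0) = (p == k + b) by apply/eqP/eqP; lia.
by case: ifP => // _; rewrite scaler0.
Qed.

End Bilinears.

Section FockFields.
Variables (K : numFieldType) (l : nat).
Local Notation F := (Fock K l).
Local Notation psi := (@psi K l).
Local Notation vac := (Fock_vac K l).
Local Notation Wfermi := (@Wfermi K l).
Implicit Types (i : 'I_(l + l)) (v : F) (a b : field F).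

Definition fderiv_coef (n : nat) (j : int) : K := \prod_(i < n) (i%:R - j%:~R).

Lemma fderiv_coef0 n (j : int) : 0 <= j -> j < n%:Z -> fderiv_coef n j = 0.
Proof.
case: j => [j|//] _ jn; rewrite /fderiv_coef (bigD1 (Ordinal (jn : (j < n)%N))) //=.
by rewrite subrr mul0r.
Qed.

Lemma Wfermi_sum n m v : Wfermi n m v =
  2^-1 *: \sum_i nop true (iter n (@fderiv K F) (psi (conj_idx i))) (psi i) m v.
Proof.
rewrite /Defs.Wfermi; congr (_ *: _); rewrite big_split big_split_ord /=.
by apply: f_equal2; apply: eq_bigr => p _; rewrite ?conj_idx_lshift ?conj_idx_rshift.
Qed.

(** [nop] splits according to the mode j of the n-th derivative, [bil_term] according to the mode j
    - n of the fermion. They disagree only for 0 <= j < n, exactly where the coefficient of the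
    derivative vanishes. *)
Lemma Wfermi_quad n m v : Wfermi n m v =
  2^-1 *: quad (m - n%:Z) (fun j => fderiv_coef n (j + n%:Z)) v.
Proof.
rewrite Wfermi_sum quadE; congr (_ *: _).
pose f i j := bil_term i j (m - n%:Z - j - 1) v.
have ff i : bsupp (f i) by exact: bil_term_bsupp.
transitivity (\sum_i zsum (fun j => fderiv_coef n (j + n%:Z) *: f i j)); last first.
  rewrite -zsum_sum => [|i]; last exact: bsuppS.
  by apply: eq_zsum => j; rewrite /bil scaler_sumr.
apply: eq_bigr => i _; pose g j := fderiv_coef n j *: f i (j - n%:Z).
have fg : bsupp g by apply/bsuppS/bsupp_shift.
have -> : zsum (fun j => fderiv_coef n (j + n%:Z) *: f i j) = zsum g.
  by rewrite -(zsum_shift n fg); apply: eq_zsum => j; rewrite /g addrK.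
rewrite nopE /zsum; congr (_ + _).
  apply: eq_nsum => j j0; rewrite iter_fderivE /g /f /bil_term ifT; last by lia.
  by congr (_ *: psi _ _ (psi _ _ _)); lia.
rewrite (psum_lin (g := fun w => (-1) ^+ true *: w)); last 2 first.
- by move=> x u w; rewrite scalerDr !scalerA mulrC.
- apply: lfield_upp; last exact: psi_linear.
  by elim: n {f ff g fg} => [|n IHn]; [exact: lfield_psi | exact: lfield_fderiv].
apply: eq_psum => j j0; rewrite iter_fderivE /g linearZ /= expr1 scaleN1r.
rewrite -[\prod_(i < n) _]/(fderiv_coef n j).
have [jn|jn] := ltP j n%:Z; first by rewrite fderiv_coef0 // !scale0r oppr0.
rewrite /f /bil_term ifF; last by lia.
by rewrite scalerN; congr (- (_ *: psi _ _ _)); lia.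
Qed.

Lemma Wfermi_psi n m (j : 'I_(l + l)) (b : int) v : Wfermi n m (psi j b v) - psi j b (Wfermi n m v) =
  (2^-1 * (fderiv_coef n (m + b) - fderiv_coef n (n%:Z - b - 1))) *: psi j (m - n%:Z + b) v.
Proof.
rewrite !Wfermi_quad linearZ /= -scalerBr quad_psi scalerA.
by congr (_ * (fderiv_coef _ _ - fderiv_coef _ _) *: _); lia.
Qed.

(** This is the image of W^1_{-1}: the mode with index m of W^n(z) is W^n_{m-n}. *)
Definition Ttrans : F -> F := Wfermi 1 0.

Lemma Wfermi_linear n m : linear (Wfermi n m).
Proof.
by move=> a u v; rewrite !Wfermi_quad quad_linear scalerDr !scalerA mulrC.
Qed.

Lemma Ttrans_linear : linear Ttrans.
Proof. exact: Wfermi_linear. Qed.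

Lemma covariant_psi i : covariant Ttrans (psi i).
Proof.
move=> m v; rewrite Wfermi_psi /fderiv /fderiv_coef !big_ord1 !add0r.
rewrite (_ : 2^-1 * _ = - m%:~R :> K); last first.
  by rewrite !intrB mulr1z; field.
by congr (_ *: psi _ _ _); lia.
Qed.

(** Locality is required only against the generators [psi]. That suffices for uniqueness, and Dong's
    lemma passes it on to normally ordered products. *)
Record free_field (s : bool) a : Prop := FreeField {
  ff_lfield : lfield a;
  ff_creative : creative vac a;
  ff_covariant : covariant Ttrans a;
  ff_local : forall i, local s a (psi i) }.

Lemma free_psi i : free_field true (psi i).
Proof.
split; [exact: lfield_psi|exact: creative_psi|exact: covariant_psi|].
exact: local_psi.
Qed.

Lemma free_fid : free_field false (@fid K F).
Proof.
split=> [|m m0|m v|i]; first exact: lfield_fid.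
- by rewrite /fid; case: eqP => // mE; rewrite mE in m0.
- rewrite /fid /fderiv /fid; case: eqP => [->|mN]; last first.
    rewrite (lin_zero Ttrans_linear) subr0.
    case: eqP => [m1|]; last by rewrite scaler0.
    by rewrite (_ : m = 0) ?mulr0z ?oppr0 ?scale0r //; lia.
  by rewrite subrr scaler0.
- exact/local_fid/psi_linear.
Qed.

Lemma free_comb s x a b : free_field s a -> free_field s b ->
  free_field s (fun m v => x *: a m v + b m v).
Proof.
move=> [fa va ca la] [fb vb cb lb]; split; first exact: lfield_comb.
- exact: creative_comb.
- exact: covariant_comb Ttrans_linear _ _ _ _ _.
- by move=> i; apply: local_comb => //; exact: psi_linear.
Qed.

Lemma free_zero s : free_field s (fun _ _ => 0).
Proof.
split=> //; first exact: lfield0.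
- by move=> m v; rewrite (lin_zero Ttrans_linear) subr0 /fderiv scaler0.
- by move=> i; apply: local0; exact: psi_linear.
Qed.

Lemma free_sum s (I : eqType) (r : seq I) (c : I -> K) (a : I -> field F) :
  (forall k, k \in r -> free_field s (a k)) ->
  free_field s (fun m v => \sum_(k <- r) c k *: a k m v).
Proof.
elim: r => [|i r IHr] far.
  rewrite (_ : (fun _ _ => _) = fun _ _ => 0); first exact: free_zero.
  by do 2!apply/funext=> ?; rewrite big_nil.
rewrite (_ : (fun _ _ => _) = fun m v =>
  c i *: a i m v + \sum_(i <- r) c i *: a i m v); last first.
  by do 2!apply/funext=> ?; rewrite big_cons.
apply: free_comb; first by apply: far; rewrite inE eqxx.
by apply: IHr => j jr; apply: far; rewrite inE jr orbT.
Qed.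

Lemma free_fderiv s a : free_field s a -> free_field s (fderiv a).
Proof.
move=> [fa va ca la]; split; first exact: lfield_fderiv.
- exact: creative_fderiv.
- exact: covariant_fderiv Ttrans_linear _ _.
- by move=> i; apply: local_fderiv => //; exact: psi_linear.
Qed.

Lemma free_iter_fderiv s n a : free_field s a -> free_field s (iter n (@fderiv K F) a).
Proof. by move=> fa; elim: n => //= n; exact: free_fderiv. Qed.

Lemma free_fderiv_div s n a : free_field s a -> free_field s (fderiv_div n a).
Proof.
move=> fa; rewrite (_ : fderiv_div n a = fun m v =>
  (n`!%:R)^-1 *: iter n (@fderiv K F) a m v + 0); last first.
  by do 2!apply/funext=> ?; rewrite addr0.
by apply: free_comb; [exact: free_iter_fderiv | exact: free_zero].
Qed.

Lemma free_nop s1 s2 s3 a b : free_field s2 a -> free_field s3 b -> local s1 a b ->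
  free_field (s2 (+) s3) (nop s1 a b).
Proof.
move=> [fa va ca la] [fb vb cb lb] lab; split; first exact: lfield_nop.
- exact: creative_nop.
- exact: covariant_nop Ttrans_linear _ _ _ _ _ _ _.
- move=> i; exact: local_nop fa fb (lfield_psi K i) lab (la i) (lb i).
Qed.

Lemma free_Wfermi n : free_field false (Wfermi n).
Proof.
have E : Wfermi n = fun m v => \sum_i 2^-1 *:
    nop true (iter n (@fderiv K F) (psi (conj_idx i))) (psi i) m v.
  by do 2!apply/funext=> ?; rewrite Wfermi_sum scaler_sumr.
rewrite E; apply: free_sum => i _; apply: (@free_nop true true true).
- exact/free_iter_fderiv/free_psi.
- exact: free_psi.
- exact: ff_local (free_iter_fderiv _ (free_psi _)) _.
Qed.

Lemma Ttrans_vac : Ttrans vac = 0.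
Proof. exact: (ff_creative (free_Wfermi 1)). Qed.

(** The difference of the two fields kills the vacuum by covariance, hence every vector by
    [goddard]. *)
Lemma free_unique s a b : free_field s a -> free_field s b ->
  a (-1) vac = b (-1) vac -> a = b.
Proof.
move=> fa fb ab; have [[fL _] fv cf lf] := free_comb (-1) fb fa.
apply/funext=> m; apply/funext=> v; apply/eqP; rewrite eq_sym -subr_eq0 -opprB oppr_eq0.
apply/eqP; rewrite -[RHS](goddard (vac := vac) (g := psi) _ _ fL lf _ m v).
- by rewrite addrC scaleN1r.
- by move=> P Pv PL Pc; apply: Fock_ind => // i n u; apply: Pc.
- exact: lfield_psi.
apply: creative_covariant_eq0 fL Ttrans_vac fv cf _; first exact: Ttrans_linear.
by rewrite ab scaleN1r addNr.
Qed.

Definition mono_field (s : seq (cmode l)) : field F :=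
  nops [seq (true, fderiv_div x.2 (psi x.1)) | x <- s].

Lemma mono_field_cons x s : mono_field (x :: s) =
  nop (odd (size s)) (fderiv_div x.2 (psi x.1)) (mono_field s).
Proof. by rewrite /mono_field /= count_map count_predT. Qed.

Lemma local_fderiv_div s n a b : (forall m, linear (b m)) ->
  local s a b -> local s (fderiv_div n a) b.
Proof.
move=> bL lab; rewrite (_ : fderiv_div n a = fun m v =>
  (n`!%:R)^-1 *: iter n (@fderiv K F) a m v + 0); last first.
  by do 2!apply/funext=> ?; rewrite addr0.
apply: (local_comb (a := iter n (@fderiv K F) a) (a' := fun _ _ => 0) _ bL);
  last exact: local0.
by elim: n => [|n IHn]; [exact: lab | exact: (local_fderiv bL IHn)].
Qed.

Lemma free_mono_field s : free_field (odd (size s)) (mono_field s).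
Proof.
elim: s => [|x s IHs]; first exact: free_fid.
rewrite mono_field_cons /= -addTb; apply: free_nop => //.
  exact/free_fderiv_div/free_psi.
apply: local_fderiv_div; first exact: (ff_lfield IHs).1.
exact: local_sym (ff_local IHs _).
Qed.

Lemma mono_field_state s : mono_field s (-1) vac = foldr (@create K l) vac s.
Proof.
elim: s => [|x s IHs]; first by rewrite /mono_field /= /fid eqxx.
have fx : free_field true (fderiv_div x.2 (psi x.1)).
  exact/free_fderiv_div/free_psi.
have fs := free_mono_field s.
rewrite mono_field_cons (nop_state _ (ff_lfield fx) (ff_lfield fs)
  (ff_creative fx) (ff_creative fs)).
rewrite IHs fderiv_div_state (_ : -1 - x.2%:Z = Negz x.2); last by lia.
by rewrite /= -surjective_pairing.
Qed.

Local Notation Y := (@Fock_Y K l).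

Lemma Fock_Y_linear m w : linear (fun v => Y v m w).
Proof. exact: linearP. Qed.

Lemma Fock_Y_vac : Y vac = @fid K F.
Proof.
apply/funext=> m; apply/funext=> w; rewrite /Fock_Y linextU.
by rewrite (_ : modes fset0 = [::]) // /modes enum_fset0.
Qed.

Lemma Fock_Y_state v : Y v (-1) vac = v.
Proof.
move: v; apply: malg_lin_ext => // [|S]; first exact: Fock_Y_linear.
by rewrite /Fock_Y linextU [LHS]mono_field_state -Fock_basisE.
Qed.

(** Fields of even vectors are local without signs, as a vertex algebra in the ordinary sense
    demands. *)
Definition even_vector v := forall S, S \in msupp v -> ~~ odd #|` S|.

Lemma size_modes (S : {fset cmode l}) : size (modes S) = #|` S|.
Proof. by rewrite size_sort. Qed.

Lemma free_Fock_Y v : even_vector v -> free_field false (Y v).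
Proof.
move=> ev; rewrite (_ : Y v = fun m w =>
  \sum_(S <- msupp v) v@_S *: mono_field (modes S) m w) //.
apply: free_sum => S /ev /negPf So.
by have := free_mono_field (modes S); rewrite size_modes So.
Qed.

Lemma Fock_Y_eq a : free_field false a -> even_vector (a (-1) vac) ->
  a = Y (a (-1) vac).
Proof.
by move=> fa ev; apply: free_unique fa (free_Fock_Y ev) _; rewrite Fock_Y_state.
Qed.

Lemma local_mono_field s c : free_field false c -> local false (mono_field s) c.
Proof.
move=> fc; have cL := (ff_lfield fc).1; elim: s => [|x s IHs]; first exact: local_fid.
have fx : free_field true (fderiv_div x.2 (psi x.1)).
  exact/free_fderiv_div/free_psi.
have fs := free_mono_field s.
rewrite mono_field_cons -[false]/(false (+) false).
apply: (local_nop (ff_lfield fx) (ff_lfield fs) (ff_lfield fc) _ _ IHs).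
  apply: local_fderiv_div; first exact: (ff_lfield fs).1.
  exact: local_sym (ff_local fs _).
by apply: local_fderiv_div cL _; exact: local_sym (ff_local fc _).
Qed.

Lemma local_Fock_Y u v : even_vector v -> local false (Y u) (Y v).
Proof.
move=> /free_Fock_Y fv; have vL := (ff_lfield fv).1.
rewrite (_ : Y u = fun m w =>
  \sum_(S <- msupp u) u@_S *: mono_field (modes S) m w) //.
elim: (enum_fset _) => [|S r IHr].
  rewrite (_ : (fun _ _ => _) = fun _ _ => 0); first exact: local0.
  by do 2!apply/funext=> ?; rewrite big_nil.
rewrite (_ : (fun _ _ => _) = fun m v =>
  u@_S *: mono_field (modes S) m v
  + \sum_(S <- r) u@_S *: mono_field (modes S) m v); last first.
  by do 2!apply/funext=> ?; rewrite big_cons.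
exact: (local_comb (a := mono_field (modes S)) _ vL (local_mono_field _ fv) IHr).
Qed.

Lemma Fock_TE v : even_vector v -> Fock_T v = Ttrans v.
Proof.
move=> ev; have fv := free_Fock_Y ev.
have := ff_covariant fv (-1) vac; rewrite Fock_Y_state Ttrans_vac.
rewrite (lin_zero ((ff_lfield fv).1 _)) subr0 => ->.
by rewrite /fderiv opprK scale1r.
Qed.

End FockFields.

(** * The representation of D^+ on Fock space *)

Lemma lspan_ind (K : fieldType) (V : lmodType K) (S P : V -> Prop) : P 0 ->
  (forall a u v, P u -> P v -> P (a *: u + v)) -> (forall u, S u -> P u) ->
  forall u, lspan S u -> P u.
Proof. by move=> P0 PL SP u uS; apply: (uS P); split. Qed.

Section CocycleBilinear.
Variable K : numFieldType.

Lemma linext_fun (T : choiceType) (V : lmodType K) (a : K) (f g : T -> V) x :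
  linext (fun k => a *: f k + g k) x = a *: linext f x + linext g x.
Proof.
rewrite /linext scaler_sumr -big_split; apply: eq_bigr => k _ /=.
by rewrite scalerDr !scalerA mulrC.
Qed.

Lemma psi_cocycle_monoN r s (f g : {poly K}) :
  psi_cocycle_mono r s f g = - psi_cocycle_mono s r g f.
Proof.
have pos0 (p q : {poly K}) : psi_cocycle_pos 0 p q = 0 by rewrite /psi_cocycle_pos big_ord0.
rewrite /psi_cocycle_mono addrC; case: eqP => [|_]; last by rewrite oppr0.
case: r s => [r|r] [s|s] sr; try lia.
- have [-> ->] : r = 0%N /\ s = 0%N by lia.
  by rewrite !pos0 oppr0.
- have -> : r = s.+1 by lia.
  by rewrite opprK.
- by have -> : s = r.+1 by lia.
Qed.

Lemma psi_cocycle_monoP r s a (f f' g : {poly K}) :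
  psi_cocycle_mono r s (a *: f + f') g =
  a * psi_cocycle_mono r s f g + psi_cocycle_mono r s f' g.
Proof.
have posl (n : nat) p p' q : psi_cocycle_pos n (a *: p + p') q =
    a * psi_cocycle_pos n p q + psi_cocycle_pos n p' q :> K.
  rewrite /psi_cocycle_pos mulr_sumr -big_split; apply: eq_bigr => i _ /=.
  by rewrite hornerD hornerZ mulrDl mulrA.
have posr (n : nat) p p' q : psi_cocycle_pos n q (a *: p + p') =
    a * psi_cocycle_pos n q p + psi_cocycle_pos n q p' :> K.
  rewrite /psi_cocycle_pos mulr_sumr -big_split; apply: eq_bigr => i _ /=.
  by rewrite hornerD hornerZ mulrDr mulrCA.
rewrite /psi_cocycle_mono; case: ifP => _; last by rewrite mulr0 addr0.
by case: r => r; rewrite ?posl ?posr // mulrN opprD.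
Qed.

Lemma psi_cocycle_monoPr r s a (f f' g : {poly K}) :
  psi_cocycle_mono r s g (a *: f + f') =
  a * psi_cocycle_mono r s g f + psi_cocycle_mono r s g f'.
Proof.
rewrite psi_cocycle_monoN psi_cocycle_monoP opprD -mulrN.
by rewrite -!psi_cocycle_monoN.
Qed.

Lemma psi_cocycleE (x y : diffop K) : psi_cocycle x y =
  linext (fun a : int * nat => linext (fun b : int * nat =>
    psi_cocycle_mono a.1 b.1 'X^(a.2) 'X^(b.2) : K^o) y) x.
Proof.
rewrite /psi_cocycle /linext; apply: eq_bigr => a _; rewrite scaler_sumr.
by apply: eq_bigr => b _; rewrite scalerA.
Qed.

Lemma psi_cocycle_linear_l (y : diffop K) :
  linear ((fun x => psi_cocycle x y) : diffop K -> K^o).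
Proof. by move=> a u v; rewrite !psi_cocycleE linearP. Qed.

Lemma psi_cocycle_linear_r (x : diffop K) :
  linear (psi_cocycle x : diffop K -> K^o).
Proof.
move=> a u v; rewrite !psi_cocycleE -linext_fun.
by apply: eq_bigr => k _; rewrite linearP.
Qed.

Lemma poly_lin_ext (V : lmodType K) (f g : {poly K} -> V) : linear f -> linear g ->
  (forall n, f 'X^n = g 'X^n) -> f =1 g.
Proof.
move=> fL gL fg p; rewrite -[p]coefK poly_def (lin_sum fL) (lin_sum gL).
by apply: eq_bigr => i _; rewrite (lin_scale fL) (lin_scale gL) fg.
Qed.

Lemma tD_Xn k n : tD k 'X^n = << (k, n) >> :> diffop K.
Proof.
rewrite /tD size_polyXn big_ord_recr /= coefXn eqxx scale1r big1 ?add0r // => i _.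
by rewrite coefXn (ltn_eqF (ltn_ord i)) scale0r.
Qed.

Lemma psi_cocycle_tD r s (f g : {poly K}) :
  psi_cocycle (tD r f) (tD s g) = psi_cocycle_mono r s f g.
Proof.
move: f; apply: (poly_lin_ext (V := K^o)) => [a u v|a u v|n].
- by rewrite linearP psi_cocycle_linear_l.
- exact: psi_cocycle_monoP.
move: g; apply: (poly_lin_ext (V := K^o)) => [a u v|a u v|m].
- by rewrite linearP psi_cocycle_linear_r.
- exact: psi_cocycle_monoPr.
by rewrite !tD_Xn psi_cocycleE !linextU.
Qed.

Lemma diffop_mul_linear_l (y : diffop K) : linear (fun x => diffop_mul x y).
Proof. by move=> a u v; rewrite /diffop_mul linearP. Qed.

Lemma diffop_mul_linear_r (x : diffop K) : linear (diffop_mul x).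
Proof.
move=> a u v; rewrite /diffop_mul -linext_fun.
by apply: eq_bigr => k _; rewrite linearP.
Qed.

Lemma Dhat_br_linear_l (y : Dhat K) : linear (fun x => Dhat_br x y).
Proof.
move=> a u v; apply: injective_projections; rewrite /= /Dhat_br /=.
  rewrite diffop_mul_linear_l diffop_mul_linear_r scalerBr opprD addrACA //.
exact: psi_cocycle_linear_l.
Qed.

Lemma Dhat_br_linear_r (x : Dhat K) : linear (Dhat_br x).
Proof.
move=> a u v; apply: injective_projections; rewrite /= /Dhat_br /=.
  rewrite diffop_mul_linear_l diffop_mul_linear_r scalerBr opprD addrACA //.
exact: psi_cocycle_linear_r.
Qed.

Lemma Dhat_br_C_l (y : Dhat K) : Dhat_br (Dhat_C K) y = 0.
Proof.
rewrite /Dhat_br /= (lin_zero (diffop_mul_linear_l _)) (lin_zero (diffop_mul_linear_r _)).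
by rewrite (lin_zero (psi_cocycle_linear_l _)) subr0.
Qed.

Lemma Dhat_br_C_r (x : Dhat K) : Dhat_br x (Dhat_C K) = 0.
Proof.
rewrite /Dhat_br /= (lin_zero (diffop_mul_linear_l _)) (lin_zero (diffop_mul_linear_r _)).
by rewrite (lin_zero (psi_cocycle_linear_r _)) subr0.
Qed.

(* Over the half-integral modes [t^b ~ psi_(b)], the polynomials [f] for which
   [t^k f(D)] is skew for the pairing [(t^a, t^b) = delta_{a+b+1,0}]. *)
Definition skew_poly (k : int) (f : {poly K}) : Prop :=
  forall b : int, f.[(- b - k - 1)%:~R] = - f.[b%:~R].

(** The reflection b -> -b - k - 1 has centre -(k + 1)/2; the shift in the definition of [Dhat_plus]
    turns it into a change of sign. *)
Lemma skew_poly_odd (k : int) (g : {poly K}) : g \Po (- 'X) = - g ->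
  skew_poly k (g \Po ('X + ((k + 1)%:~R / 2)%:P)).
Proof.
move=> g_odd b; rewrite !horner_comp !hornerE -hornerN -g_odd horner_comp !hornerE.
by congr (_.[_]); rewrite -addrA -opprD !intrB !intrD mulrNz; field.
Qed.

Lemma skew_poly_br r s (f g : {poly K}) : skew_poly r f -> skew_poly s g ->
  skew_poly (r + s) ((f \Po ('X + s%:~R%:P)) * g - (g \Po ('X + r%:~R%:P)) * f).
Proof.
move=> fr gs b; rewrite !hornerE !horner_comp !hornerE -!intrD.
have -> : - b - (r + s) - 1 + s = - b - r - 1 by lia.
have -> : - b - (r + s) - 1 + r = - b - s - 1 by lia.
have -> : - b - (r + s) - 1 = - (b + r) - s - 1 by lia.
rewrite gs; have -> : - (b + r) - s - 1 = - (b + s) - r - 1 by lia.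
by rewrite !fr gs !mulrN !mulNr; ring.
Qed.

End CocycleBilinear.

Section Oscillator.
Variables (K : numFieldType) (l : nat).
Local Notation F := (Fock K l).
Local Notation psi := (@psi K l).
Local Notation vac := (Fock_vac K l).
Implicit Types (v : F) (f g : {poly K}).

(** The argument -m - 1 and the factor -1/2 are chosen so that for a skew symbol f the commutator of
    t^k f(D) with [psi j b] is f(b) times [psi j (k + b)]: modes transform as the monomials t^b
    do. *)
Definition rho0 (x : diffop K) v : F :=
  linext (fun p : int * nat =>
    - 2^-1 *: quad p.1 (fun m => (- m - 1)%:~R ^+ p.2) v) x.

Fact rho_key : unit. Proof. exact: tt. Qed.
Definition rho : Dhat K -> F -> F := locked_with rho_key
  (fun x v => rho0 x.1 v + (l%:R * x.2) *: v).

Lemma rhoE x v : rho x v = rho0 x.1 v + (l%:R * x.2) *: v.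
Proof. by rewrite /rho unlock. Qed.

Lemma rho0_linear_l v : linear (rho0^~ v).
Proof. exact: linearP. Qed.

Lemma rho0_linear x : linear (rho0 x).
Proof.
move=> a u v; rewrite /rho0 -linext_fun; apply: eq_bigr => k _.
by rewrite quad_linear scalerDr !scalerA [a * _]mulrC.
Qed.

Lemma rho_linear_l v : linear (rho^~ v).
Proof.
move=> a x y; rewrite !rhoE /= rho0_linear_l mulrDr scalerDl scalerDr addrACA.
by rewrite scalerA mulrCA.
Qed.

Lemma rho_linear x : linear (rho x).
Proof.
move=> a u v; rewrite !rhoE rho0_linear !scalerDr addrACA !scalerA.
by rewrite [a * _]mulrC.
Qed.

Lemma rho0_tD k f v : rho0 (tD k f) v = - 2^-1 *: quad k (fun m => f.[(- m - 1)%:~R]) v.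
Proof.
move: f; apply: poly_lin_ext => [a f g|a f g|n].
- by rewrite linearP rho0_linear_l.
- rewrite (eq_quad k (be := fun m => a * f.[(- m - 1)%:~R] + g.[(- m - 1)%:~R])) => [|m].
    by rewrite quadP scalerDr !scalerA [a * _]mulrC.
  by rewrite hornerD hornerZ.
rewrite tD_Xn /rho0 linextU /=.
rewrite (eq_quad k (be := fun m => ('X^n).[(- m - 1)%:~R])) // => m.
by rewrite hornerXn.
Qed.

Lemma rho_C v : rho (Dhat_C K) v = l%:R *: v.
Proof. by rewrite rhoE (lin_zero (rho0_linear_l _)) add0r mulr1. Qed.

Lemma rho_tD k f v :
  rho (tD k f, 0) v = - 2^-1 *: quad k (fun m => f.[(- m - 1)%:~R]) v.
Proof. by rewrite rhoE mulr0 scale0r addr0 rho0_tD. Qed.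

Lemma rho_psi k f j b v : skew_poly k f ->
  rho (tD k f, 0) (psi j b v) - psi j b (rho (tD k f, 0) v)
  = f.[b%:~R] *: psi j (k + b) v.
Proof.
move=> fk; rewrite !rho_tD (lin_scale (psi_linear j b)).
rewrite -scalerBr quad_psi scalerA; apply: (congr1 (fun c => c *: _)).
have -> : - (k + b) - 1 = - b - k - 1 by lia.
have -> : - (- b - 1) - 1 = b by lia.
by rewrite fk; field.
Qed.

Lemma vac_coef_bil p q v : (p < 0) || (q < 0) -> vac_coef (bil p q v) = 0.
Proof.
move=> pq; rewrite (lin_sum (@vac_coef_linear K l)) big1 // => i _.
rewrite /bil_term; case: ltP pq => [p0 _|_ /= q0].
  by case: p p0 => // p _; exact: vac_coef_create.
rewrite (lin_opp (@vac_coef_linear K l)); case: q q0 => // q _.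
by rewrite vac_coef_create oppr0.
Qed.

Lemma bil_vac p q : (0 <= p) || (0 <= q) -> bil p q vac = 0.
Proof.
move=> pq; apply: big1 => i _; rewrite /bil_term; case: ltP pq => [_ /= q0|p0 _].
  by case: q q0 => // q _; rewrite psi_vac linear0.
by case: p p0 => // p _; rewrite psi_vac linear0 oppr0.
Qed.

Lemma quad_vac k al : 0 <= k -> quad k al vac = 0.
Proof.
move=> k0; rewrite quadE (eq_zsum (g := fun=> 0)) => [|p].
  by rewrite /zsum nsum0 psum0 addr0.
by rewrite bil_vac ?scaler0 //; lia.
Qed.

Lemma vac_coef_quad k al v : k <= 0 -> vac_coef (quad k al v) = 0.
Proof.
move=> k0; rewrite quadE (zsum_lin (@vac_coef_linear K l)); last exact/bsuppS/bil_bsupp.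
rewrite (eq_zsum (V := K^o) (g := fun=> 0)) => [|p].
  by rewrite /zsum nsum0 psum0 addr0.
rewrite (lin_scale (@vac_coef_linear K l)) vac_coef_bil ?scaler0 //; lia.
Qed.

Lemma vac_coef_quad_vac k al : vac_coef (quad k al vac) = 0.
Proof.
have [k0|/ltW k0] := leP 0 k; last exact: vac_coef_quad.
by rewrite quad_vac // (lin_zero (@vac_coef_linear K l)).
Qed.

End Oscillator.

Lemma addr_jacobi (M : zmodType) (a a' z p q u v : M) :
  (a + p + (q + u)) - (a' + q + (p + v)) - (z + (u - v)) = a - a' - z.
Proof.
rewrite !opprD !opprK !addrA.
by rewrite (ACl (1*5*9*(2*7)*(3*6)*(4*10)*(11*8)))%AC /= !subrr !addr0.
Qed.

(** If X and Y move the modes with symbols f and g, then XY - YX moves them with the commutator of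
    the symbols. When Z has that symbol, the defect XY - YX - Z commutes with every mode. *)
Lemma commutator_shift (K : fieldType) (V : lmodType K) (X Y Z : V -> V)
    (p : int -> V -> V) (f g h : int -> K) r s :
  linear X -> linear Y -> (forall b, linear (p b)) ->
  (forall b w, X (p b w) = p b (X w) + f b *: p (r + b) w) ->
  (forall b w, Y (p b w) = p b (Y w) + g b *: p (s + b) w) ->
  (forall b w, Z (p b w) = p b (Z w) + h b *: p (r + s + b) w) ->
  (forall b, h b = g b * f (s + b) - f b * g (r + b)) ->
  forall b w, X (Y (p b w)) - Y (X (p b w)) - Z (p b w)
              = p b (X (Y w) - Y (X w) - Z w).
Proof.
move=> XL YL pL Xp Yp Zp hE b w.
rewrite Yp Xp Zp hE (lin_add XL) (lin_scale XL) (lin_add YL) (lin_scale YL).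
rewrite !Xp !Yp !(lin_sub (pL b)) !scalerDr !scalerA scalerBl.
rewrite (_ : s + (r + b) = r + s + b); last by lia.
by rewrite (_ : r + (s + b) = r + s + b) ?addr_jacobi //; lia.
Qed.

Section Representation.
Variables (K : numFieldType) (l : nat).
Local Notation F := (Fock K l).
Local Notation psi := (@psi K l).
Local Notation vac := (Fock_vac K l).
Local Notation rho := (@rho K l).
Implicit Types (v : F) (f g : {poly K}).

Let vcL := @vac_coef_linear K l.

Lemma rho_vac k f : 0 <= k -> rho (tD k f, 0) vac = 0.
Proof. by move=> k0; rewrite rho_tD quad_vac // scaler0. Qed.

Lemma vac_coef_rho k f v : k <= 0 -> vac_coef (rho (tD k f, 0) v) = 0.
Proof. by move=> k0; rewrite rho_tD (lin_scale vcL) vac_coef_quad // scaler0. Qed.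

Lemma vac_coef_rho_vac k f : vac_coef (rho (tD k f, 0) vac) = 0.
Proof. by rewrite rho_tD (lin_scale vcL) vac_coef_quad_vac scaler0. Qed.

Lemma quad_vac_neg (S : nat) al : quad (- S%:Z) al vac =
  \sum_(a < S) \sum_i al (Negz a) *: psi (conj_idx i) (Negz a) (psi i (a%:Z - S%:Z) vac).
Proof.
rewrite quadE (@zsumE _ _ S) => [|p pS|p pS]; try by rewrite bil_vac ?scaler0 //; lia.
apply: eq_bigr => a _; rewrite [bil (Posz a) _ _]bil_vac // scaler0.
rewrite -[LHS]/(al (Negz a) *: bil (Negz a) (- S%:Z - Negz a - 1) vac + 0) addr0.
rewrite /bil scaler_sumr; apply: eq_bigr => i _; rewrite /bil_term /=.
by have -> : - S%:Z - Negz a - 1 = a%:Z - S%:Z by lia.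
Qed.

Lemma rho_psiE k f i b v : skew_poly k f ->
  rho (tD k f, 0) (psi i b v) = psi i b (rho (tD k f, 0) v) + f.[b%:~R] *: psi i (k + b) v.
Proof. by move=> fk; rewrite -rho_psi // addrC subrK. Qed.

Lemma vac_coef_pair i (p q : int) : q < 0 ->
  vac_coef (psi (conj_idx i) p (psi i q vac)) = (p + q + 1 == 0)%:R.
Proof.
move=> q0; case: p => p; last first.
  by rewrite vac_coef_create; case: eqP => // ?; lia.
rewrite psi_swap eqxx /= (lin_sub vcL); case: q q0 => // q _.
rewrite vac_coef_create subr0; case: eqP => _; first exact: vac_coef_vac.
exact: (lin_zero vcL).
Qed.

(** The second operator creates pairs from the vacuum, and the first one shifts a fermion of a pair
    so that it contracts with its partner. The 2l indices contribute equally, the factor -1/2 leaves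
    -l, and skewness of f turns the sum into the cocycle: this is why C acts by l. *)
Lemma vac_coef_comm_pos r s f g : 0 <= r -> skew_poly r f ->
  vac_coef (rho (tD r f, 0) (rho (tD s g, 0) vac)) = l%:R * psi_cocycle_mono r s f g.
Proof.
move=> r0 fr; have [s0|s0] := leP 0 s.
  rewrite (rho_vac _ s0) (lin_zero (rho_linear _)) (lin_zero vcL).
  rewrite /psi_cocycle_mono; case: eqP => rs; last by rewrite mulr0.
  have -> : r = 0%N%:Z by lia.
  by rewrite /psi_cocycle_pos big_ord0 mulr0.
have [S sS] : exists S : nat, s = - S%:Z by exists `|s|%N; lia.
have SP : (0 < S)%N by lia.
rewrite sS [rho (tD (- S%:Z) g, 0) vac]rho_tD quad_vac_neg.
rewrite (lin_scale (rho_linear _)) (lin_scale vcL) (lin_sum (rho_linear _)) (lin_sum vcL).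
have pairE (a : 'I_S) i : vac_coef (rho (tD r f, 0)
      (psi (conj_idx i) (Negz a) (psi i (a%:Z - S%:Z) vac)))
    = f.[(Negz a)%:~R] * (r == S%:Z)%:R.
  rewrite -[rho _ _](subrK (psi (conj_idx i) (Negz a) (rho (tD r f, 0) (psi i (a%:Z - S%:Z) vac)))).
  rewrite rho_psi // (lin_add vcL) (lin_scale vcL) vac_coef_create addr0.
  rewrite vac_coef_pair; last by have := ltn_ord a; lia.
  have -> : (r + Negz a + (a%:Z - S%:Z) + 1 == 0) = (r == S%:Z) by apply/eqP/eqP; lia.
  by [].
transitivity (- l%:R * \sum_(a < S) g.[a%:R] * (f.[(Negz a)%:~R] * (r == S%:Z)%:R)).
  rewrite (eq_bigr (fun a : 'I_S => (l + l)%:R * (g.[a%:R] * (f.[(Negz a)%:~R] * (r == S%:Z)%:R)))).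
    by rewrite -mulr_sumr natrD -[_ *: _]/(_ * _); field.
  move=> a _; rewrite (lin_sum (rho_linear _)) (lin_sum vcL).
  rewrite (eq_bigr (fun _ => g.[a%:R] * (f.[(Negz a)%:~R] * (r == S%:Z)%:R))).
    by rewrite sumr_const card_ord -[LHS]mulr_natl.
  move=> i _; rewrite (lin_scale (rho_linear _)) (lin_scale vcL) pairE.
  by have -> : - Negz a - 1 = a%:Z by lia.
rewrite /psi_cocycle_mono subr_eq0; case: eqP => [rS|_]; last first.
  by rewrite big1 ?mulr0 // => a _; rewrite !mulr0.
rewrite rS in fr *; rewrite mulNr -mulrN -sumrN /psi_cocycle_pos.
congr (_ * _); apply: eq_bigr => a _; rewrite mulr1 mulrC -mulNr; congr (_ * _).
by rewrite -fr; congr (_.[_%:~R]); lia.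
Qed.

Lemma vac_coef_comm r s f g : skew_poly r f -> skew_poly s g ->
  vac_coef (rho (tD r f, 0) (rho (tD s g, 0) vac))
  - vac_coef (rho (tD s g, 0) (rho (tD r f, 0) vac)) = l%:R * psi_cocycle_mono r s f g.
Proof.
move=> fr gs; have [r0|r0] := leP 0 r.
  rewrite (vac_coef_comm_pos s g r0 fr) (rho_vac f r0) (lin_zero (rho_linear _)).
  by rewrite (lin_zero vcL) subr0.
rewrite (vac_coef_rho _ _ (ltW r0)) sub0r; have [s0|s0] := leP 0 s.
  by rewrite (vac_coef_comm_pos r f s0 gs) -mulrN -psi_cocycle_monoN.
rewrite (vac_coef_rho _ _ (ltW s0)) oppr0 /psi_cocycle_mono.
by case: eqP => ?; [lia | rewrite mulr0].
Qed.

(** The defect commutes with all fermions by [commutator_shift], and its vacuum coefficient is zero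
    by the computation of the cocycle; [intertwiner_eq0] concludes. *)
Lemma rho_br_skew r s f g v : skew_poly r f -> skew_poly s g ->
  rho (tD r f, 0) (rho (tD s g, 0) v) - rho (tD s g, 0) (rho (tD r f, 0) v)
  = rho (Dhat_br (tD r f, 0) (tD s g, 0)) v.
Proof.
move=> fr gs; pose x := (tD r f, 0) : Dhat K; pose y := (tD s g, 0) : Dhat K.
pose h := (f \Po ('X + s%:~R%:P)) * g - (g \Po ('X + r%:~R%:P)) * f.
have hrs : skew_poly (r + s) h by apply: skew_poly_br.
have brE : Dhat_br x y = (psi_cocycle_mono r s f g) *: Dhat_C K + (tD (r + s) h, 0).
  rewrite /Dhat_br /= !diffop_mulE [s + r]addrC psi_cocycle_tD linearB /=.
  apply: injective_projections; first by rewrite /= scaler0 add0r.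
  by rewrite /= addr0 -[RHS]/(_ * 1) mulr1.
have rho_brE w : rho (Dhat_br x y) w =
    (l%:R * psi_cocycle_mono r s f g) *: w + rho (tD (r + s) h, 0) w.
  by rewrite brE rho_linear_l rho_C scalerA mulrC.
pose A w := rho x (rho y w) - rho y (rho x w) - rho (Dhat_br x y) w.
have AL : linear A.
  apply: lin_subf; last exact: rho_linear.
  by apply: lin_subf; apply: lin_comp; exact: rho_linear.
suff A0 : A v = 0 by apply/eqP; rewrite -subr_eq0 -/(A v) A0.
apply: (intertwiner_eq0 AL (e := 1)); rewrite ?oner_eq0 //; last first.
  rewrite /A !(lin_sub vcL) vac_coef_comm // rho_brE (lin_add vcL) (lin_scale vcL).
  by rewrite vac_coef_rho_vac vac_coef_vac addr0 -[_ *: _]/(_ * _) mulr1 subrr.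
move=> i b w; rewrite scale1r /A.
apply: (commutator_shift (X := rho x) (Y := rho y) (p := psi i) (r := r) (s := s)
  (f := fun b => f.[b%:~R]) (g := fun b => g.[b%:~R]) (h := fun b => h.[b%:~R])).
- exact: rho_linear.
- exact: rho_linear.
- exact: psi_linear.
- by move=> c u; exact: rho_psiE.
- by move=> c u; exact: rho_psiE.
- move=> c u; rewrite !rho_brE (rho_psiE i c u hrs) (lin_add (psi_linear i c)).
  by rewrite (lin_scale (psi_linear i c)) addrA.
move=> c; rewrite /h !hornerE !horner_comp !hornerE -!intrD [c + s]addrC [c + r]addrC.
by rewrite [f.[c%:~R] * _]mulrC [g.[c%:~R] * _]mulrC.
Qed.

End Representation.

Lemma lspan_lin_eq0 (K : fieldType) (V U : lmodType K) (S : V -> Prop) (f : V -> U) :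
  linear f -> (forall u, S u -> f u = 0) -> forall u, lspan S u -> f u = 0.
Proof.
move=> fL Sf; apply: (lspan_ind (P := fun u => f u = 0)) => [|a u v fu fv|//]; first exact: (lin_zero fL).
by rewrite fL fu fv scaler0 addr0.
Qed.

Lemma sub_commutators (V : zmodType) (a b c d q : V) :
  a = c + q -> b - d = q -> a - b = c - d.
Proof. by move=> -> <-; rewrite addrA addrAC addrK. Qed.

Section WGenerators.
Variables (K : numFieldType) (l : nat).
Local Notation F := (Fock K l).
Local Notation rho := (@rho K l).
Implicit Types (v : F) (f g : {poly K}).

Let vcL := @vac_coef_linear K l.

Lemma rho_br x y v : Dhat_plus x -> Dhat_plus y ->
  rho x (rho y v) - rho y (rho x v) = rho (Dhat_br x y) v.
Proof.
pose B (x y : Dhat K) := rho x (rho y v) - rho y (rho x v) - rho (Dhat_br x y) v.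
have Bl z : linear (B^~ z).
  apply: lin_subf; last exact: lin_comp (rho_linear_l v) (Dhat_br_linear_l z).
  apply: lin_subf; first exact: rho_linear_l.
  exact: lin_comp (rho_linear z) (rho_linear_l v).
have Br z : linear (B z).
  apply: lin_subf; last exact: lin_comp (rho_linear_l v) (Dhat_br_linear_r z).
  apply: lin_subf; last exact: rho_linear_l.
  exact: lin_comp (rho_linear z) (rho_linear_l v).
have BCl z : B (Dhat_C K) z = 0.
  rewrite /B Dhat_br_C_l (lin_zero (rho_linear_l v)) !rho_C (lin_scale (rho_linear z)).
  by rewrite subr0 subrr.
have BCr z : B z (Dhat_C K) = 0.
  rewrite /B Dhat_br_C_r (lin_zero (rho_linear_l v)) !rho_C (lin_scale (rho_linear z)).
  by rewrite subr0 subrr.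
move=> xP yP; apply/eqP; rewrite -subr_eq0; apply/eqP; rewrite -/(B x y).
move: x xP; apply: lspan_lin_eq0 => // _ [//|r f f_odd].
move: y yP; apply: lspan_lin_eq0 => // _ [//|s g g_odd].
rewrite /B rho_br_skew; [exact: subrr|exact: skew_poly_odd..].
Qed.

Definition ffact_poly (n : nat) : {poly K} := \prod_(i < n) ('X - i%:R%:P).

Lemma horner_ffact_poly n x : (ffact_poly n).[x] = \prod_(i < n) (x - i%:R).
Proof. by rewrite horner_prod; apply: eq_bigr => i _; rewrite !hornerE. Qed.

Lemma ffact_poly_sym n x : odd n -> (ffact_poly n).[n%:R - 1 - x] = - (ffact_poly n).[x].
Proof.
move=> n_odd; rewrite !horner_ffact_poly (reindex_inj rev_ord_inj) /=.
rewrite (eq_bigr (fun i : 'I_n => -1 * (x - i%:R))) => [|i _]; last first.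
  by rewrite natrB ?ltn_ord // -natr1; ring.
by rewrite big_split /= prodr_const card_ord -signr_odd n_odd expr1 mulN1r.
Qed.

Lemma fderiv_coefE n (j : int) : odd n ->
  fderiv_coef K n j = - (ffact_poly n).[j%:~R].
Proof.
move=> n_odd; rewrite horner_ffact_poly /fderiv_coef.
rewrite (eq_bigr (fun i : 'I_n => -1 * (j%:~R - i%:R))) => [|i _].
  by rewrite big_split /= prodr_const card_ord -signr_odd n_odd expr1 mulN1r.
by rewrite mulN1r opprB.
Qed.

(** The symbol of W^n_k for odd n: t^(k+n) d^n is t^k D(D-1)...(D-n+1), and putting the power of t
    on the right of d^n replaces D by D + k + n. *)
Definition Wpoly n (k : int) : {poly K} :=
  - 2^-1 *: (ffact_poly n + (ffact_poly n \Po ('X + (k + n%:Z)%:~R%:P))).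

Lemma W_tD n k : odd n -> W K n k = (tD k (Wpoly n k), 0).
Proof.
move=> n_odd; rewrite /W ddt_powE !diffop_mulE -signr_odd /= n_odd expr0 scale1r.
rewrite comp_polyC mul1r mulr1 -/(ffact_poly n) addrK [_ + (k + _)]addrC addrK.
by rewrite /Wpoly (lin_scale (@tD_is_linear K k)) (lin_add (@tD_is_linear K k)).
Qed.

Lemma skew_Wpoly n k : odd n -> skew_poly k (Wpoly n k).
Proof.
move=> n_odd b; rewrite /Wpoly !hornerZ !hornerD !horner_comp !hornerE -!intrD.
have sym (c : int) : (ffact_poly n).[(n%:Z - 1 - c)%:~R] = - (ffact_poly n).[c%:~R].
  by rewrite -(ffact_poly_sym _ n_odd) !intrB.
have -> : - b - k - 1 + (k + n%:Z) = n%:Z - 1 - b by lia.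
have -> : - b - k - 1 = n%:Z - 1 - (b + (k + n%:Z)) by lia.
by rewrite !sym; ring.
Qed.

(** Both sides have the same commutators with the fermions and no vacuum coefficient on the vacuum,
    so they agree by [intertwiner_eq0]. *)
Lemma rho_W n k v : odd n -> rho (W K n k) v = Wfermi n (k + n%:Z) v.
Proof.
move=> n_odd; rewrite W_tD //; apply/eqP; rewrite -subr_eq0; apply/eqP.
pose A v := rho (tD k (Wpoly n k), 0) v - Wfermi n (k + n%:Z) v.
rewrite -/(A v); apply: (intertwiner_eq0 (A := A) (e := 1)); rewrite ?oner_eq0 //.
- by apply: lin_subf; [exact: rho_linear | exact: Wfermi_linear].
- move=> i b w; rewrite scale1r /A (lin_sub (psi_linear i b)).
  apply: (sub_commutators (rho_psiE i b w (skew_Wpoly k n_odd))).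
  rewrite Wfermi_psi (_ : k + n%:Z - n%:Z + b = k + b); last by lia.
  apply: (congr1 (fun c => c *: _)); rewrite !fderiv_coefE //.
  have -> : n%:Z - b - 1 = n%:Z - 1 - b by lia.
  have -> : (n%:Z - 1 - b)%:~R = n%:R - 1 - b%:~R :> K by rewrite !intrB.
  rewrite ffact_poly_sym // /Wpoly hornerZ hornerD horner_comp !hornerE -intrD.
  by rewrite [b + _]addrC; ring.
rewrite /A (lin_sub vcL) vac_coef_rho_vac Wfermi_quad (lin_scale vcL).
by rewrite vac_coef_quad_vac scaler0 subr0.
Qed.

End WGenerators.

(** * The action of O(2l) *)

Lemma eq_oppr_eq0 (K : numFieldType) (V : lmodType K) (x : V) : x = - x -> x = 0.
Proof.
move=> /eqP; rewrite -subr_eq0 opprK -mulr2n -scaler_nat.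
by rewrite scaler_eq0 pnatr_eq0 => /eqP.
Qed.

Lemma half_skew (K : numFieldType) (V : lmodType K) (c : K) (x : V) :
  - 2^-1 *: (-1 *: (c *: x) + c *: - x) = c *: x.
Proof.
rewrite scalerN scaleN1r -opprD scaleNr scalerN opprK -mulr2n -scaler_nat scalerA.
by rewrite mulVf ?scale1r // pnatr_eq0.
Qed.

(** * Separating the bilinears by odd polynomials *)

Section Interpolation.
Variables (K : numFieldType) (l : nat).
Local Notation F := (Fock K l).
Local Notation rho := (@rho K l).

(** A product of factors X^2 - u^2 is even; omitting those with u^2 = u0^2 keeps it nonzero at u0,
    and the factor X makes it odd. *)
Lemma oddfun_interpolation (us : seq K) (u0 : K) : u0 != 0 ->
  exists2 g : {poly K}, g \Po (- 'X) = - g &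
    g.[u0] != 0 /\ forall u, u \in us -> u != u0 -> u != - u0 -> g.[u] = 0.
Proof.
move=> u0N; pose vs := [seq u <- us | u ^+ 2 != u0 ^+ 2].
exists ('X * \prod_(u <- vs) ('X^2 - (u ^+ 2)%:P)).
  rewrite rmorphM rmorph_prod /= comp_polyX mulNr; congr (- (_ * _)).
  apply: eq_bigr => u _; rewrite rmorphB /= comp_polyC rmorphXn /= comp_polyX.
  by rewrite sqrrN.
have hE x : ('X * \prod_(u <- vs) ('X^2 - (u ^+ 2)%:P)).[x]
    = x * \prod_(u <- vs) (x ^+ 2 - u ^+ 2).
  rewrite hornerM hornerX horner_prod; congr (_ * _); apply: eq_bigr => u _.
  by rewrite !hornerE.
split=> [|u uus uu0 uNu0].
  rewrite hE mulf_neq0 // prodf_seq_neq0; apply/allP => u.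
  by rewrite mem_filter => /andP[uu0 _]; rewrite /= subr_eq0 eq_sym.
have uvs : u \in vs.
  by rewrite mem_filter uus andbT eqf_sqr negb_or uu0.
rewrite hE (big_rem u) //= subrr mul0r mulr0 //.
Qed.

(** On a fixed vector only finitely many terms of a quadratic operator survive, so an odd polynomial
    vanishing at all the other nodes isolates one bilinear. *)
Lemma bil_stable (N : F -> Prop) : N 0 ->
  (forall a u v, N u -> N v -> N (a *: u + v)) ->
  (forall x v, Dhat_plus x -> N v -> N (rho x v)) ->
  forall p q v, N v -> N (bil p q v).
Proof.
move=> N0 NL Nrho p q v Nv; have [->|pq] := eqVneq p q.
  by have -> : bil q q v = 0 by apply: eq_oppr_eq0; exact: bil_anti.
(* This degree k is the one whose quadratic operators contain [bil p q]; the shift c centres the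
   reflection p -> k - p - 1 at 0, so that p and q become opposite nodes. *)
pose k := p + q + 1; pose c : K := (1 - k)%:~R / 2.
pose u (m : int) : K := m%:~R + c.
have uq : u q = - u p by rewrite /u /c /k !intrB !intrD; field.
have u_inj : injective u by move=> m n /addIr/intr_inj.
have u0 : u p != 0.
  apply: contraNneq pq => up; apply/eqP/u_inj; rewrite uq up oppr0 //.
have [M [lM uM]] := bsupp_bound (bil_bsupp k v).
have [g g_odd [gp g0]] := oddfun_interpolation
  [seq u m | m <- [seq Negz i | i <- iota 0 M] ++ [seq Posz i | i <- iota 0 M]] u0.
have gN x : g.[- x] = - g.[x] by rewrite -hornerN -g_odd horner_comp !hornerE.
have rE : rho (tD k (g \Po ('X + ((k + 1)%:~R / 2)%:P)), 0) v = g.[u p] *: bil p q v.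
  rewrite rho_tD quadE.
  pose fp m := g.[u p] *: bil m (k - m - 1) v.
  rewrite (eq_zsum (g := fun m => -1 *: (if m == p then fp m else 0)
                                  + if m == q then fp m else 0)) => [|m].
    rewrite zsumP; try exact: bsupp_delta.
    rewrite !zsum_delta /fp (_ : k - p - 1 = q); last by rewrite /k; lia.
    rewrite (_ : k - q - 1 = p); last by rewrite /k; lia.
    by rewrite (bil_anti q p) half_skew.
  have -> : (g \Po ('X + ((k + 1)%:~R / 2)%:P)).[(- m - 1)%:~R] = - g.[u m].
    rewrite horner_comp !hornerE -gN; congr (_.[_]).
    by rewrite /u /c !intrB !intrD; field.
  have [mM|mM] := boolP ((- M%:Z <= m) && (m < M%:Z)); last first.
    have b0 : bil m (k - m - 1) v = 0.
      by move: mM; rewrite negb_and -!real_ltNge //= => /orP[]; rewrite ?num_real // => ?; [apply: lM|apply: uM; lia].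
    by rewrite /fp b0 !scaler0 !if_same scaler0 addr0.
  have [->|mp] := eqVneq m p.
    by rewrite (negPf pq) addr0 scaleN1r scaleNr.
  have [->|mq] := eqVneq m q; first by rewrite uq gN opprK scaler0 add0r.
  rewrite g0 ?oppr0 ?scale0r ?scaler0 ?addr0 // -?uq ?(inj_eq u_inj) //.
  apply/map_f; rewrite mem_cat; case: m mM {mp mq} => n nM.
    by apply/orP; right; apply: map_f; rewrite mem_iota; lia.
  by apply/orP; left; apply: map_f; rewrite mem_iota; lia.
have -> : bil p q v = (g.[u p])^-1 *: rho (tD k (g \Po ('X + ((k + 1)%:~R / 2)%:P)), 0) v + 0.
  by rewrite rE scalerA mulVf // scale1r addr0.
apply: NL => //; apply: Nrho => //; apply: sub_gen_smallest; exact: DhatPlusOdd.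
Qed.

End Interpolation.

Section LinearCombinations.
Variables (K : fieldType) (V : lmodType K) (I : finType) (P Q : I -> V -> V).
Hypotheses (PL : forall a, linear (P a)) (QL : forall a, linear (Q a)).
Implicit Types (c d : I -> K) (v w : V).

Lemma lincomb_comp c d v :
  \sum_a c a *: P a (\sum_b d b *: Q b v)
  = \sum_a \sum_b (c a * d b) *: P a (Q b v).
Proof.
apply: eq_bigr => a _; rewrite (lin_sum (PL a)) scaler_sumr.
by apply: eq_bigr => b _; rewrite (lin_scale (PL a)) scalerA.
Qed.

Lemma lincomb_anti c d (k : I -> I -> K) v w :
  (forall a b, P a (Q b v) + Q b (P a v) = k a b *: w) ->
  \sum_a c a *: P a (\sum_b d b *: Q b v) + \sum_b d b *: Q b (\sum_a c a *: P a v)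
  = (\sum_a \sum_b c a * d b * k a b) *: w.
Proof.
move=> PQ; rewrite lincomb_comp scaler_suml.
have -> : \sum_b d b *: Q b (\sum_a c a *: P a v) =
    \sum_a \sum_b (c a * d b) *: Q b (P a v).
  rewrite exchange_big; apply: eq_bigr => b _; rewrite (lin_sum (QL b)) scaler_sumr.
  by apply: eq_bigr => a _; rewrite (lin_scale (QL b)) scalerA mulrC.
rewrite -big_split; apply: eq_bigr => a _; rewrite scaler_suml -big_split.
by apply: eq_bigr => b _; rewrite /= -scalerDr PQ scalerA.
Qed.

Lemma lincomb_pair (s : I -> I) (G J : I -> I -> K) v :
  (forall a b, \sum_i G a (s i) * G b i = J a b) ->
  \sum_i \sum_a G a (s i) *: P a (\sum_b G b i *: Q b v)
  = \sum_b \sum_a J a b *: P a (Q b v).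
Proof.
move=> GJ; rewrite (eq_bigr _ (fun i _ => lincomb_comp _ _ v)) exchange_big.
rewrite [RHS]exchange_big; apply: eq_bigr => a _; rewrite exchange_big.
by apply: eq_bigr => b _; rewrite -scaler_suml GJ.
Qed.

End LinearCombinations.

Section OrthogonalAction.
Variables (K : numFieldType) (l : nat).
Local Notation F := (Fock K l).
Local Notation psi := (@psi K l).
Local Notation vac := (Fock_vac K l).
Local Notation O_act := (@O_act K l).
Local Notation cmode := (cmode l).
Implicit Types (i j : 'I_(l + l)) (v : F) (g : 'M[K]_(l + l)).

Lemma form_mxE i j : form_mx K l i j = (i == conj_idx j)%:R.
Proof.
rewrite /form_mx; rewrite -(splitK i) -(splitK j).
case: (split i) => p; case: (split j) => q; rewrite /= /conj_idx.
- rewrite block_mxEul mxE (_ : lshift l q = unsplit (inl q)) // unsplitK.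
  by rewrite eq_lrshift.
- rewrite block_mxEur mxE (_ : rshift l q = unsplit (inr q)) // unsplitK.
  by rewrite eq_lshift.
- rewrite block_mxEdl mxE (_ : lshift l q = unsplit (inl q)) // unsplitK.
  by rewrite eq_rshift.
- rewrite block_mxEdr mxE (_ : rshift l q = unsplit (inr q)) // unsplitK.
  by rewrite eq_rlshift.
Qed.

Lemma form_mx_sqr : form_mx K l *m form_mx K l = 1%:M.
Proof.
apply/matrixP => i j; rewrite !mxE (bigD1 (conj_idx i)) //= big1 => [|a ai].
  by rewrite !form_mxE conj_idxK eqxx mul1r addr0 conj_idx_eq.
by rewrite form_mxE -conj_idx_eqC eq_sym (negPf ai) mul0r.
Qed.

(** The form matrix is its own inverse, so the left inverse of g given by the hypothesis is also a
    right inverse. *)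
Lemma O_group_tr g : O_group g -> g *m form_mx K l *m g^T = form_mx K l.
Proof.
move=> gO; have : (form_mx K l *m g^T *m form_mx K l) *m g = 1%:M.
  by rewrite -!mulmxA (mulmxA g^T) gO form_mx_sqr.
move/mulmx1C => E.
transitivity (g *m (form_mx K l *m g^T *m form_mx K l) *m form_mx K l).
  by rewrite -!mulmxA form_mx_sqr mulmx1.
by rewrite E mul1mx.
Qed.

Definition alternating (th : cmode -> F -> F) :=
  (forall x, linear (th x)) /\ forall x y v, th x (th y v) + th y (th x v) = 0.

Lemma alternating_sqr th x v : alternating th -> th x (th x v) = 0.
Proof.
move=> [_ /(_ x x v)/eqP]; rewrite addr_eq0 => /eqP.
exact: eq_oppr_eq0.
Qed.

(** The scalar and the sorted word are chosen before [th]: the sorting signs depend on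
    anticommutation alone, so the same reordering serves for the creation operators and for their
    transforms under g. *)
Lemma foldr_insert (x : cmode) (s : seq cmode) : sorted (@mode_le l) s -> uniq s ->
  exists e : K, exists2 t : seq cmode,
    [/\ sorted (@mode_le l) t, uniq t & {subset t <= x :: s}] &
    forall th, alternating th -> th x (foldr th vac s) = e *: foldr th vac t.
Proof.
elim: s => [|y s IHs] /=.
  by move=> _ _; exists 1, [:: x]; [split | move=> th _; rewrite scale1r].
move=> ys /andP[yNs us]; have sS := path_sorted ys.
have [->|xy] := eqVneq x y.
  exists 0, [::]; first by split.
  by move=> th th_alt; rewrite alternating_sqr // scale0r.
have [xley|/negPf yltx] := boolP (mode_le x y).
  exists 1, (x :: y :: s) => [|th _]; last by rewrite scale1r.
  split=> //; first by rewrite /= xley.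
  rewrite /= inE negb_or xy yNs us /= !andbT; apply: contraNN xy => xs.
  rewrite -(@mode_le_antisym l x y) ?eqxx // xley /=.
  by move: ys; rewrite path_sortedE => [/andP[/allP/(_ x xs)]|]; last exact: mode_le_trans.
have ylex : mode_le y x by rewrite mode_le_anti ?yltx // eq_sym.
have [e [t [tS ut tsub] tE]] := IHs sS us.
exists (- e), (y :: t) => [|th th_alt /=].
  have yt z : z \in t -> mode_le y z.
    move=> /tsub; rewrite inE => /predU1P[->//|zs].
    by move: ys; rewrite path_sortedE => [/andP[/allP/(_ z zs)]|]; last exact: mode_le_trans.
  split.
  - rewrite /= path_sortedE; last exact: mode_le_trans.
    by rewrite tS andbT; apply/allP.
  - rewrite /= ut andbT; apply/negP => /tsub; rewrite inE (negPf yNs) orbF eq_sym.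
    by rewrite (negPf xy).
  - move=> z; rewrite !inE => /predU1P[->|/tsub]; first by rewrite eqxx orbT.
    by rewrite inE => /orP[->|->]; rewrite ?orbT.
have /eqP := th_alt.2 x y (foldr th vac s); rewrite addr_eq0 => /eqP ->.
by rewrite (tE th th_alt) (lin_scale (th_alt.1 y)) scaleNr.
Qed.

Lemma foldr_sort (s : seq cmode) : exists e : K, exists2 t : seq cmode,
  sorted (@mode_le l) t && uniq t &
  forall th, alternating th -> foldr th vac s = e *: foldr th vac t.
Proof.
elim: s => [|x s [e [t /andP[tS ut] tE]]] /=.
  by exists 1, [::] => // th _; rewrite scale1r.
have [e' [t' [t'S ut' _] t'E]] := foldr_insert x tS ut.
exists (e * e'), t' => [|th th_alt]; first by rewrite t'S.
by rewrite (tE th th_alt) (lin_scale (th_alt.1 x)) (t'E th th_alt) scalerA.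
Qed.

Definition gpsi g i (m : int) v : F := \sum_j g j i *: psi j m v.

Lemma gpsi_linear g i m : linear (gpsi g i m).
Proof.
move=> a u v; rewrite /gpsi scaler_sumr -big_split; apply: eq_bigr => j _.
by rewrite (psi_linear j m) scalerDr !scalerA mulrC.
Qed.

Lemma gpsi_comm g i j m n v : gpsi g i m (gpsi g j n v) + gpsi g j n (gpsi g i m v)
  = if m + n + 1 == 0 then (g^T *m form_mx K l *m g) i j *: v else 0.
Proof.
rewrite /gpsi (@lincomb_anti _ _ _ (psi^~ m) (psi^~ n) (fun a => psi_linear a m) (fun b => psi_linear b n)
  _ _ (fun a b => ((a == conj_idx b) && (m + n + 1 == 0))%:R) v v) => [|a b].
  case: eqP => _; last first.
    rewrite big1 ?scale0r // => a _; rewrite big1 // => b _.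
    by rewrite andbF mulr0.
  apply: (congr1 (fun c => c *: v)); rewrite -mulmxA mxE; apply: eq_bigr => a _.
  rewrite !mxE mulr_sumr; apply: eq_bigr => b _.
  by rewrite form_mxE andbT mulrAC mulrA.
rewrite psi_anti; case: ifP => _; first by rewrite scale1r.
by rewrite scale0r.
Qed.

Lemma O_act_linear g : linear (O_act g).
Proof. exact: linearP. Qed.

Lemma O_actE g S : O_act g << S >> =
  foldr (fun x v => gpsi g x.1 (Negz x.2) v) vac (modes S).
Proof. exact: linextU. Qed.

Lemma O_act_vac g : O_act g vac = vac.
Proof. by rewrite O_actE (_ : modes fset0 = [::]) // /modes enum_fset0. Qed.

Lemma alternating_create : alternating (@create K l).
Proof. by split; [exact: create_linear | exact: create_anti]. Qed.

Lemma alternating_gpsi g : alternating (fun x v => gpsi g x.1 (Negz x.2) v).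
Proof.
split=> [x|x y v]; first exact: gpsi_linear.
by rewrite gpsi_comm; case: eqP => // ?; lia.
Qed.

(** [O_act] is defined on sorted words; universal sorting extends the formula to all words, which
    makes it compatible with creation. *)
Lemma O_act_foldr g s : O_act g (foldr (@create K l) vac s)
  = foldr (fun x v => gpsi g x.1 (Negz x.2) v) vac s.
Proof.
have [e [t /andP[tS ut] tE]] := foldr_sort s.
rewrite (tE _ alternating_create) (tE _ (alternating_gpsi g)).
by rewrite (lin_scale (O_act_linear g)) (foldr_create K tS ut) O_actE (modes_seq tS ut).
Qed.

Lemma O_act_create g i n v : O_act g (psi i (Negz n) v) = gpsi g i (Negz n) (O_act g v).
Proof.
move: v; apply: malg_lin_ext => [||S].
- exact: lin_comp (O_act_linear g) (psi_linear i _).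
- exact: lin_comp (gpsi_linear g i _) (O_act_linear g).
by rewrite Fock_basisE O_act_foldr; exact: (O_act_foldr g ((i, n) :: modes S)).
Qed.

(** For annihilation modes, by induction on the vector: moving the mode past a creation mode yields
    anticommutators that agree because g preserves the form. *)
Lemma O_act_psi g i m v : O_group g -> O_act g (psi i m v) = gpsi g i m (O_act g v).
Proof.
move=> gO; have [m0|] := leP 0 m; last by case: m => // n _; exact: O_act_create.
move: v; apply: Fock_ind => [|a u v IHu IHv|j n v IHv].
- rewrite (creative_psi K i m0) (lin_zero (O_act_linear g)) O_act_vac /gpsi big1 // => j _.
  by rewrite (creative_psi K j m0) scaler0.
- rewrite (psi_linear i m a u v) (O_act_linear g a (psi i m u) (psi i m v)) IHu IHv.
  by rewrite (O_act_linear g a u v) (gpsi_linear g i m a (O_act g u) (O_act g v)).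
have cE w : O_act g (psi j (Negz n) w) = gpsi g j (Negz n) (O_act g w).
  exact: O_act_create.
move: (Negz n) cE => p cE; have gc := gpsi_comm g i j m p (O_act g v).
rewrite gO form_mxE in gc; have ac := psi_anti i j m p v.
apply: (addIr (gpsi g j p (gpsi g i m (O_act g v)))); rewrite cE gc -IHv -cE.
rewrite -(lin_add (O_act_linear g)) ac.
case: (i == conj_idx j); case: (m + p + 1 == 0); rewrite /= ?scale1r ?scale0r //.
- exact: (lin_zero (O_act_linear g)).
- exact: (lin_zero (O_act_linear g)).
- exact: (lin_zero (O_act_linear g)).
Qed.

(** The sum over i is the tensor dual to the form, so its invariance is the transposed relation
    [O_group_tr]. *)
Lemma gpsi_pair g p q v : O_group g ->
  \sum_i gpsi g (conj_idx i) p (gpsi g i q v) = \sum_i psi (conj_idx i) p (psi i q v).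
Proof.
move=> gO; rewrite /gpsi (@lincomb_pair _ _ _ (psi^~ p) (psi^~ q) (fun a => psi_linear a p) _ _
  (fun a b => (a == conj_idx b)%:R)) => [|a b].
  apply: eq_bigr => b _; rewrite (bigD1 (conj_idx b)) //= eqxx scale1r big1 ?addr0 //.
  by move=> a /negPf ->; rewrite scale0r.
rewrite -form_mxE -(O_group_tr gO) mxE; apply: eq_bigr => i _; rewrite !mxE.
rewrite (bigD1 (conj_idx i)) //= form_mxE eqxx mulr1 big1 ?addr0 // => j ji.
by rewrite form_mxE (negPf ji) mulr0.
Qed.

Lemma bil_neg p q v : p < 0 -> bil p q v = \sum_i psi (conj_idx i) p (psi i q v).
Proof. by move=> p0; apply: eq_bigr => i _; rewrite /bil_term p0. Qed.

Lemma bil_pos p q v : 0 <= p -> bil p q v = - \sum_i psi (conj_idx i) q (psi i p v).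
Proof.
move=> p0; rewrite -sumrN; apply: etrans (esym (sum_conj (fun i => bil_term i p q v))) _.
by apply: eq_bigr => i _; rewrite /bil_term ltNge p0 conj_idxK.
Qed.

Lemma O_act_pair g p q v : O_group g ->
  O_act g (\sum_i psi (conj_idx i) p (psi i q v))
  = \sum_i psi (conj_idx i) p (psi i q (O_act g v)).
Proof.
move=> gO; apply: etrans (gpsi_pair p q (O_act g v) gO).
apply: etrans (lin_sum (O_act_linear g) _ _ _) _; apply: eq_bigr => i _.
apply: etrans (O_act_psi (conj_idx i) p (psi i q v) gO) _.
exact: (congr1 (gpsi g (conj_idx i) p) (O_act_psi i q v gO)).
Qed.

Lemma O_act_bil g p q v : O_group g -> O_act g (bil p q v) = bil p q (O_act g v).
Proof.
move=> gO; have [p0|p0] := leP 0 p; last by rewrite !bil_neg // O_act_pair.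
by rewrite !bil_pos // (lin_opp (O_act_linear g)) O_act_pair.
Qed.

Lemma O_act_rho g x v : O_group g -> Dhat_plus x ->
  O_act g (rho x v) = rho x (O_act g v).
Proof.
move=> gO xP; pose B x := O_act g (rho x v) - rho x (O_act g v).
have BL : linear B.
  apply: lin_subf; last exact: rho_linear_l.
  exact: lin_comp (O_act_linear g) (rho_linear_l v).
apply/eqP; rewrite -subr_eq0; apply/eqP; rewrite -/(B x).
move: x xP; apply: lspan_lin_eq0 => // _ [|k f f_odd].
  by rewrite /B !rho_C (lin_scale (O_act_linear g)) subrr.
rewrite /B !rho_tD (lin_scale (O_act_linear g)) !quadE.
rewrite (zsum_lin (O_act_linear g)); last exact/bsuppS/bil_bsupp.
rewrite (eq_zsum (g := fun p => (f \Po ('X + ((k + 1)%:~R / 2)%:P)).[(- p - 1)%:~R]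
  *: bil p (k - p - 1) (O_act g v))) ?subrr // => p.
by rewrite (lin_scale (O_act_linear g)) O_act_bil.
Qed.

Local Notation inv := (@O_invariants K l).

Lemma inv_zero : inv 0.
Proof. by move=> g _; exact: (lin_zero (O_act_linear g)). Qed.

Lemma inv_lin a u v : inv u -> inv v -> inv (a *: u + v).
Proof. by move=> iu iv g gO; rewrite O_act_linear iu ?iv. Qed.

Lemma inv_vac : inv vac.
Proof. by move=> g _; exact: O_act_vac. Qed.

Lemma inv_bil p q v : inv v -> inv (bil p q v).
Proof. by move=> iv g gO; rewrite O_act_bil ?iv. Qed.

Lemma inv_rho x v : Dhat_plus x -> inv v -> inv (rho x v).
Proof. by move=> xP iv g gO; rewrite O_act_rho ?iv. Qed.

End OrthogonalAction.

(** * The Casimir identity *)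

Lemma sum_symmetric (K : fieldType) (V : lmodType K) (N : nat) (f : 'I_N -> 'I_N -> V) :
  (forall a b, f a b = f b a) ->
  \sum_a \sum_b f a b
  = \sum_a f a a + 2 *: \sum_(a < N) \sum_(b < N | (a < b)%N) f a b.
Proof.
move=> fC; rewrite scaler_nat mulr2n [X in _ = _ + (X + _)](eq_bigr (fun a : 'I_N =>
  \sum_(b < N) if (a < b)%N then f a b else 0)) => [|a _]; last by rewrite big_mkcond.
rewrite [X in _ = _ + (X + _)]exchange_big addrA -!big_split /=.
apply: eq_bigr => a _; rewrite (bigID (fun b : 'I_N => (a < b)%N)) /= addrC.
congr (_ + _); rewrite big_mkcond (bigD1 a) //= ltnn; congr (_ + _).
rewrite [RHS](bigD1 a) //= ltnn add0r; apply: eq_bigr => b ba.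
by rewrite -leqNgt leq_eqVlt val_eqE (negPf ba) /= fC; case: ifP.
Qed.

Section Casimir.
Variables (K : fieldType) (V : lmodType K) (I : finType) (c : I -> I) (N : nat).
Variables (th de : I -> 'I_N -> V -> V).
Hypotheses (cK : involutive c) (thL : forall i a, linear (th i a))
  (deL : forall i a, linear (de i a)).
Hypothesis thth : forall i j a b v, th i a (th j b v) = - th j b (th i a v).
Hypothesis dede : forall i j a b v, de i a (de j b v) = - de j b (de i a v).
Hypothesis deth : forall i j a b v, de j b (th i a v) =
  (if (i == j) && (a == b) then v else 0) - th i a (de j b v).

(** [e] spans gl on the indices and [E] spans gl on the slots, the two commuting actions of skew
    duality; [Qs] and [Q] are the pair operators that arise once e_ji is replaced by its
    conjugate. *)
Let e i j v := \sum_a th i a (de j a v).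
Let E a b v := \sum_i th i a (de i b v).
Let Qs a b v := \sum_i th i a (th (c i) b v).
Let Q a b v := \sum_i de i a (de (c i) b v).
Let T a b u := \sum_i \sum_j th i a (th j b (de j a (de i b u))).

(** Normal ordering produces the single contraction [E b b]. For a < b the operator [E a b], which
    acts first, moves fermions down from slot b to slot a. *)
Lemma casimir_T a b u : T a b u = E b a (E a b u) - E b b u.
Proof.
rewrite /T /E; apply/eqP; rewrite eq_sym subr_eq addrC; apply/eqP.
rewrite exchange_big -big_split; apply: eq_bigr => j _ /=.
rewrite (lin_sum (deL j a)) (lin_sum (thL j b)) (bigD1 j) //=.
rewrite deth !eqxx (lin_sub (thL j b)) [in RHS](bigD1 j) //= addrA.
congr (_ + _); first by rewrite [in RHS]thth.
apply: eq_bigr => i ij; rewrite deth (negPf ij) sub0r (lin_opp (thL j b)).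
by rewrite [in RHS]thth.
Qed.

Lemma casimir_TC a b u : T a b u = T b a u.
Proof.
rewrite /T exchange_big; apply: eq_bigr => j _; apply: eq_bigr => i _ /=.
by rewrite thth dede (lin_opp (thL i a)) (lin_opp (thL j b)) opprK.
Qed.

Lemma casimir_l u : \sum_i \sum_j e i j (e j i u) =
  #|I|%:R *: (\sum_a E a a u) - \sum_a \sum_b T a b u.
Proof.
have eE i j : e i j (e j i u) = \sum_a th i a (de i a u)
    - \sum_a \sum_b th i a (th j b (de j a (de i b u))).
  rewrite -sumrB; apply: eq_bigr => a _; rewrite /e.
  rewrite (lin_sum (deL j a)) (lin_sum (thL i a)) (bigD1 a) //= deth !eqxx /=.
  rewrite (lin_sub (thL i a)) [X in _ = _ - X](bigD1 a) //= opprD addrA.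
  congr (_ + _); rewrite -sumrN; apply: eq_bigr => b ba.
  by rewrite deth (negPf ba) andbF sub0r (lin_opp (thL i a)).
rewrite (eq_bigr _ (fun i _ => eq_bigr _ (fun j _ => eE i j))).
rewrite (eq_bigr (fun i => #|I|%:R *: (\sum_a th i a (de i a u))
    - \sum_a \sum_b \sum_j th i a (th j b (de j a (de i b u))))) => [|i _].
  rewrite sumrB -scaler_sumr; congr (_ *: _ - _); first exact: exchange_big.
  rewrite exchange_big; apply: eq_bigr => a _; exact: exchange_big.
rewrite sumrB sumr_const scaler_nat; congr (_ - _).
rewrite exchange_big; apply: eq_bigr => a _; exact: exchange_big.
Qed.

Lemma casimir_r u : \sum_i \sum_j e i j (e (c i) (c j) u) =
  \sum_a E a a u - \sum_a \sum_b Qs a b (Q a b u).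
Proof.
have eE i j : e i j (e (c i) (c j) u) =
    (if c i == j then \sum_a th i a (de i a u) else 0)
    - \sum_a \sum_b th i a (th (c i) b (de j a (de (c j) b u))).
  transitivity (\sum_a \sum_b ((if (c i == j) && (b == a) then th i a (de i a u) else 0)
      - th i a (th (c i) b (de j a (de (c j) b u))))).
    apply: eq_bigr => a _; rewrite (lin_sum (deL j a)) (lin_sum (thL i a)).
    apply: eq_bigr => b _; rewrite deth (lin_sub (thL i a)); congr (_ - _).
    case: eqP => [<-|_] /=; last exact: lin_zero.
    case: eqP => [->|_]; last exact: lin_zero.
    by rewrite cK.
  rewrite (eq_bigr (fun a => (if c i == j then th i a (de i a u) else 0)
      - \sum_b th i a (th (c i) b (de j a (de (c j) b u))))) => [|a _].
    rewrite sumrB; congr (_ - _); case: eqP => // _; exact: big1.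
  rewrite sumrB (bigD1 a) //= eqxx andbT big1 ?addr0 // => b /negPf ->.
  by rewrite andbF.
rewrite (eq_bigr (fun i => \sum_a th i a (de i a u)
    - \sum_j \sum_a \sum_b th i a (th (c i) b (de j a (de (c j) b u))))) => [|i _].
  rewrite sumrB; congr (_ - _); first exact: exchange_big.
  rewrite (eq_bigr (fun i => \sum_a \sum_b \sum_j
      th i a (th (c i) b (de j a (de (c j) b u))))) => [|i _].
    rewrite exchange_big; apply: eq_bigr => a _; rewrite exchange_big.
    apply: eq_bigr => b _; apply: eq_bigr => i _.
    by rewrite (lin_sum (thL (c i) b)) (lin_sum (thL i a)).
  by rewrite exchange_big; apply: eq_bigr => a _; exact: exchange_big.
rewrite (eq_bigr _ (fun j _ => eE i j)) sumrB; congr (_ - _).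
rewrite (bigD1 (c i)) //= eqxx [X in _ + X]big1 ?addr0 // => j.
by rewrite eq_sym => /negPf ->.
Qed.

(** Invariance identifies the sums of [casimir_l] and [casimir_r]. The quartic term [T] is symmetric
    in the slots, so each off-diagonal pair may be written with the lowering operator acting
    first. *)
Lemma casimir u : (forall i j, e j i u = e (c i) (c j) u) ->
  \sum_(a < N) ((#|I| + a.*2)%:R *: E a a u - E a a (E a a u)) =
  2 *: (\sum_(a < N) \sum_(b < N | (a < b)%N) E b a (E a b u))
  - \sum_a \sum_b Qs a b (Q a b u).
Proof.
move=> inv; have -> : \sum_(a < N) ((#|I| + a.*2)%:R *: E a a u - E a a (E a a u)) =
    #|I|%:R *: (\sum_a E a a u) + 2 *: (\sum_(b < N) b%:R *: E b b u)
    - \sum_a E a a (E a a u).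
  rewrite sumrB !scaler_sumr -big_split; congr (_ - _); apply: eq_bigr => a _.
  by rewrite /= scalerA -scalerDl -natrM -natrD mul2n.
have := casimir_l u.
rewrite (eq_bigr _ (fun i _ => eq_bigr _ (fun j _ => congr1 (e i j) (inv i j)))).
rewrite casimir_r (sum_symmetric (fun a b => casimir_TC a b u)).
rewrite (eq_bigr _ (fun a _ => casimir_T a a u)) sumrB.
rewrite (eq_bigr _ (fun a _ => eq_bigr _ (fun b _ => casimir_T a b u))).
rewrite (eq_bigr _ (fun a _ => sumrB _ _ _ _)) sumrB.
(* Slot b is the larger one in exactly b pairs: the origin of the term [a.*2]. *)
have -> : \sum_(a < N) \sum_(b < N | (a < b)%N) E b b u = \sum_(b < N) b%:R *: E b b u.
  rewrite (exchange_big_dep predT) //=; apply: eq_bigr => b _.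
  rewrite (big_ord_narrow (ltnW (ltn_ord b))) sumr_const card_ord.
  by rewrite scaler_nat.
set X := \sum_a E a a u; set Y := \sum_a E a a (E a a u); set W := \sum_(b < N) b%:R *: _.
set Z := \sum_(a < N) \sum_(b < N | _) _; set q := \sum_a _.
move=> /esym/eqP; rewrite subr_eq => /eqP ->; rewrite scalerBr !addrA.
by rewrite (ACl (5*2*(1*4)*(3*8)*(7*6)))%AC /= !subrr !addr0.
Qed.

End Casimir.

(** * First-order terms of polynomial families *)

Section PolynomialFamilies.
Variables (K : numFieldType) (V : lmodType K).
Implicit Types (u : K -> V) (w : V).

(** The value and the derivative at 0 of a family polynomial in t. Allowing every N >= n lets
    families of different degrees be added over a common range. *)
Definition polyfam u (w0 w1 : V) := exists n (B : nat -> V),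
  [/\ B 0 = w0, B 1 = w1 &
      forall N t, (n <= N)%N -> u t = \sum_(k < N) t ^+ k *: B k].

Lemma polyfam_eq u v w0 w1 w0' w1' : u =1 v -> w0 = w0' -> w1 = w1' ->
  polyfam v w0' w1' -> polyfam u w0 w1.
Proof. by move=> /funext -> -> ->. Qed.

Lemma polyfam_const w : polyfam (fun=> w) w 0.
Proof.
exists 1%N, (fun k => if k is 0 then w else 0); split=> // -[//|N] t _.
by rewrite big_ord_recl scale1r big1 ?addr0 // => i _; rewrite scaler0.
Qed.

Lemma polyfam_shift u w0 w1 : polyfam u w0 w1 -> polyfam (fun t => t *: u t) 0 w0.
Proof.
move=> [n [B [B0 B1 uB]]]; exists n.+1, (fun k => if k is k'.+1 then B k' else 0).
split=> // -[//|N] t nN; rewrite big_ord_recl scaler0 add0r (uB N) // scaler_sumr.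
by apply: eq_bigr => i _; rewrite scalerA -exprS.
Qed.

Lemma polyfam_lin a u v w0 w1 w0' w1' : polyfam u w0 w1 -> polyfam v w0' w1' ->
  polyfam (fun t => a *: u t + v t) (a *: w0 + w0') (a *: w1 + w1').
Proof.
move=> [n [B [<- <- uB]]] [m [C [<- <- vC]]].
exists (maxn n m), (fun k => a *: B k + C k); split=> // N t nmN.
rewrite (uB N) ?(vC N) ?(leq_trans _ nmN) ?leq_maxl ?leq_maxr //.
rewrite scaler_sumr -big_split; apply: eq_bigr => k _ /=.
by rewrite scalerDr !scalerA mulrC.
Qed.

Lemma polyfam_map (f : V -> V) u w0 w1 : linear f -> polyfam u w0 w1 ->
  polyfam (fun t => f (u t)) (f w0) (f w1).
Proof.
move=> fL [n [B [<- <- uB]]]; exists n, (fun k => f (B k)); split=> // N t nN.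
by rewrite (uB N) // (lin_sum fL); apply: eq_bigr => k _; rewrite (lin_scale fL).
Qed.

End PolynomialFamilies.

Lemma poly_const_coef1 (K : numFieldType) (N : nat) (b : nat -> K) (c : K) :
  (1 < N)%N -> (forall t, \sum_(k < N) t ^+ k * b k = c) -> b 1 = 0.
Proof.
move=> N1 bc; pose p : {poly K} := \poly_(k < N) b k - c%:P.
have p0 : p = 0.
  (* In characteristic 0 the integers below [size p] are more distinct roots than a nonzero p can
     have. *)
  apply/eqP/contraT => pN0; have := max_poly_roots (rs := [seq i%:R | i <- iota 0 (size p)]) pN0.
  rewrite size_map size_iota ltnn => -> //; last first.
    by rewrite map_inj_uniq ?iota_uniq // => i j /eqP; rewrite eqr_nat => /eqP.
  apply/allP => _ /mapP[i _ ->]; rewrite /root /p hornerD hornerN hornerC horner_poly.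
  by rewrite -(bc i%:R) subr_eq0; apply/eqP/eq_bigr => k _; rewrite mulrC.
have := congr1 (fun q : {poly K} => q`_1) p0; rewrite coef0 /p coefB coef_poly coefC N1 /=.
by rewrite subr0.
Qed.

Lemma polyfam_unique (K : numFieldType) (T : choiceType) (w w0 w1 : {malg K[T]}) :
  polyfam (fun=> w) w0 w1 -> w1 = 0.
Proof.
move=> [n [B [_ <- uB]]]; apply/malgP => k; rewrite mcoeff0.
apply: (@poly_const_coef1 _ (maxn n 2) (fun i => (B i)@_k) w@_k).
  by rewrite leq_max orbT.
move=> t; rewrite [in RHS](uB _ t (leq_maxl n 2)) (raddf_sum (mcoeff k)) /=.
by apply: eq_bigr => i _; rewrite mcoeffZ.
Qed.

Lemma sum_delta3 (K : fieldType) (I : finType) (V : lmodType K) (P : I -> V)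
    (x i k : I) (s r : K) :
  \sum_a ((a == x)%:R + ((a == i)%:R * s - (a == k)%:R * r)) *: P a
  = P x + (s *: P i - r *: P k).
Proof.
have delta y (f : I -> V) : \sum_a (a == y)%:R *: f a = f y.
  rewrite (bigD1 y) //= eqxx scale1r big1 ?addr0 // => a /negPf ->.
  by rewrite scale0r.
rewrite -(delta x P) -(delta i (fun a => s *: P a)) -(delta k (fun a => r *: P a)).
rewrite -sumrB -big_split; apply: eq_bigr => a _ /=.
by rewrite scalerDl scalerBl !scalerA.
Qed.

Lemma root_step (K : fieldType) (V : lmodType K) (c d t : K) (x y z : V) :
  x + ((t * c) *: y - (- t * d) *: z) = 1 *: x + (c *: (t *: y) + (d *: (t *: z) + 0)).
Proof.
by rewrite scale1r addr0 !scalerA mulNr scaleNr opprK [c * t]mulrC [d * t]mulrC.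
Qed.

Lemma root_sub (K : fieldType) (V : lmodType K) (c d : K) (x y z w : V) :
  x + c *: z - (y + d *: w) = 1 *: (x - y) + (c *: z + (- d *: w + 0)).
Proof. by rewrite scale1r addr0 scaleNr opprD addrACA. Qed.

Section InfinitesimalInvariance.
Variables (K : numFieldType) (l : nat).
Local Notation F := (Fock K l).
Local Notation psi := (@psi K l).
Local Notation vac := (Fock_vac K l).
Local Notation O_act := (@O_act K l).
Local Notation inv := (@O_invariants K l).
Implicit Types (i j : 'I_(l + l)) (v : F) (g : 'M[K]_(l + l)).

Lemma psum_delta (V : lmodType K) (f : int -> V) (n : nat) :
  psum (fun a => if a == n then f a else 0) = f n.
Proof.
rewrite (@psumE _ _ n.+1) => [|j ?]; last by case: eqP => // jE; lia.
rewrite big_ord_recr /= eqxx big1 ?add0r // => i _.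
by case: eqP => // -[E]; have := ltn_ord i; rewrite E ltnn.
Qed.

(* The generator E_ij of gl(2l), acting by derivations. *)
Definition glop i j v : F := psum (fun a => psi i (- a - 1) (psi (conj_idx j) a v)).

Lemma glop_upp i j v : vanish_upp (fun a => psi i (- a - 1) (psi (conj_idx j) a v)).
Proof.
have [M vM] := (lfield_psi K (conj_idx j)).2 v.
by exists M => a Ma; rewrite vM // (lin_zero (psi_linear i _)).
Qed.

Lemma glop_linear i j : linear (glop i j).
Proof.
move=> a u v; rewrite /glop -psumP; try exact: glop_upp.
by apply: eq_psum => b _; rewrite (psi_linear (conj_idx j)) (psi_linear i).
Qed.

Lemma glop_vac i j : glop i j vac = 0.
Proof.
rewrite /glop (eq_psum (g := fun=> 0)) ?psum0 // => a a0.
by rewrite (creative_psi K _ a0) (lin_zero (psi_linear i _)).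
Qed.

Lemma glop_create i j x n v : glop i j (psi x (Negz n) v) =
  psi x (Negz n) (glop i j v) + (x == j)%:R *: psi i (Negz n) v.
Proof.
pose fd a : F := if a == n%:Z then (x == j)%:R *: psi i (- a - 1) v else 0.
rewrite /glop (eq_psum (g := fun a => 1 *: psi x (Negz n)
   (psi i (- a - 1) (psi (conj_idx j) a v)) + fd a)) => [|a a0].
  rewrite psumP; last 2 first.
  - have [M vM] := glop_upp i j v; exists M => a Ma.
    by rewrite (vM _ Ma) (lin_zero (psi_linear x _)).
  - by exists n.+1 => a na; rewrite /fd; case: eqP => // aE; lia.
  rewrite scale1r -(psum_lin (psi_linear x (Negz n)) (glop_upp i j v)).
  rewrite [X in _ + X](psum_delta (fun a => (x == j)%:R *: psi i (- a - 1) v)).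
  by rewrite (_ : - n%:Z - 1 = Negz n) //; lia.
have NE : (a + Negz n + 1 == 0) = (a == n%:Z) by apply/eqP/eqP; lia.
have NN : (- a - 1 + Negz n + 1 == 0) = false by apply/eqP; lia.
move: (Negz n) NE NN => q NE NN; rewrite (psi_swap (conj_idx j)) conj_idx_eq NE [j == x]eq_sym.
rewrite (lin_sub (psi_linear i _)) (psi_swap i) NN andbF sub0r opprK addrC scale1r.
congr (_ + _); rewrite /fd; case: (x == j); case: (a == n%:Z); rewrite /= ?scale1r ?scale0r //.
- exact: (lin_zero (psi_linear i _)).
- exact: (lin_zero (psi_linear i _)).
- exact: (lin_zero (psi_linear i _)).
Qed.

Lemma O_groupP g : (forall i j, \sum_a g (conj_idx a) i * g a j = (i == conj_idx j)%:R) ->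
  O_group g.
Proof.
move=> gE; apply/matrixP => i j; rewrite form_mxE -gE -mulmxA mxE.
rewrite (reindex_inj (inv_inj (@conj_idxK l))); apply: eq_bigr => a _.
rewrite !mxE; congr (_ * _); rewrite (bigD1 a) //= form_mxE eqxx mul1r big1 ?addr0 //.
by move=> b /negPf ba; rewrite form_mxE conj_idx_eq eq_sym ba mul0r.
Qed.

(** For i different from j the matrix E_ij - E_j'i' squares to zero, so 1 plus t times it is
    orthogonal for every t. This fails for i = j, where the weights are compared instead. *)
Lemma inv_root i j v : i != j -> inv v -> glop i j v = glop (conj_idx j) (conj_idx i) v.
Proof.
move=> ij iv.
pose g t : 'M[K]_(l + l) := \matrix_(a, b) ((a == b)%:R
   + t * (((a == i) && (b == j))%:R - ((a == conj_idx j) && (b == conj_idx i))%:R)).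
have gO t : O_group (g t).
  apply: O_groupP => a b; pose f d := g t d b.
  have sumd x : \sum_d (conj_idx d == x)%:R * f d = f (conj_idx x).
    rewrite (bigD1 (conj_idx x)) //= conj_idxK eqxx mul1r big1 ?addr0 // => d dx.
    by rewrite conj_idx_eqC (negPf dx) mul0r.
  rewrite (eq_bigr (fun d => (conj_idx d == a)%:R * f d
      + (t * (a == j)%:R * ((conj_idx d == i)%:R * f d)
         - t * (a == conj_idx i)%:R * ((conj_idx d == conj_idx j)%:R * f d)))) => [|d _].
    rewrite big_split sumrB -!mulr_sumr !sumd /f !mxE conj_idxK.
    rewrite /= !conj_idx_eq !conj_idx_neq [j == i]eq_sym (negPf ij) [j == conj_idx j]eq_sym.
    rewrite conj_idx_neq [conj_idx i == b]eq_sym [j == b]eq_sym !conj_idx_eqC.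
    case: (a == conj_idx b); case: (a == conj_idx i); case: (b == j);
      case: (a == j); case: (b == conj_idx i); rewrite /=; ring.
  by rewrite /f; move: (g t d b) => z; rewrite mxE -!mulnb !natrM; ring.
pose M w := glop i j w - glop (conj_idx j) (conj_idx i) w.
have ML : linear M by apply: lin_subf; exact: glop_linear.
(* M is the derivative at t = 0 of the action; on the invariant v the family is constant, which
   forces M v = 0. *)
suff fam w : polyfam (fun t => O_act (g t) w) w (M w).
  have : polyfam (fun=> v) v (M v).
    have [n [B [B0 B1 vB]]] := fam v; exists n, B; split=> // N t nN.
    by rewrite -(vB N) // (iv _ (gO t)).
  by move=> /polyfam_unique/eqP; rewrite subr_eq0 => /eqP.
move: w; apply: Fock_ind => [|a u w Fu Fw|x n w Fw].
- apply: polyfam_eq (polyfam_const vac) => // [t|]; first exact: O_act_vac.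
  by rewrite /M !glop_vac subrr.
- apply: polyfam_eq (polyfam_lin a Fu Fw) => // [t|]; first exact: O_act_linear.
  exact: ML.
pose c1 : K := (x == j)%:R; pose c2 : K := - (x == conj_idx i)%:R.
have pL y : linear (psi y (Negz n)) := psi_linear y (Negz n).
have shifted y := polyfam_map (pL y) (polyfam_shift Fw).
have fam := polyfam_lin 1 (polyfam_map (pL x) Fw) (polyfam_lin c1 (shifted i)
  (polyfam_lin c2 (shifted (conj_idx j)) (polyfam_const 0))).
apply: polyfam_eq fam => [t||].
- rewrite O_act_create /gpsi (eq_bigr (fun a => ((a == x)%:R + ((a == i)%:R * (t * c1)
      - (a == conj_idx j)%:R * (- t * c2))) *: psi a (Negz n) (O_act (g t) w))) => [|a _].
    rewrite sum_delta3 !(lin_scale (pL _)) root_step //.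
  apply: (congr1 (fun d => d *: _)); rewrite mxE -!mulnb !natrM /c1 /c2; ring.
- by rewrite !(lin_zero (pL _)) !scaler0 !addr0 scale1r.
by rewrite /M !glop_create (lin_sub (pL x)) root_sub.
Qed.

End InfinitesimalInvariance.

(** * Weights of invariants under the diagonal torus *)

Section Torus.
Variables (K : numFieldType) (l : nat).
Local Notation F := (Fock K l).
Local Notation psi := (@psi K l).
Local Notation vac := (Fock_vac K l).
Local Notation inv := (@O_invariants K l).
Local Notation cmode := (cmode l).
Implicit Types (i j : 'I_(l + l)) (v : F) (g : 'M[K]_(l + l)) (S : {fset cmode}).

Definition mono (s : seq cmode) : F := foldr (@create K l) vac s.

Lemma mono_cons x s : mono (x :: s) = psi x.1 (Negz x.2) (mono s).
Proof. by case: x. Qed.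

Lemma mono_modes S : << S >> = mono (modes S) :> F.
Proof. exact: Fock_basisE. Qed.

Lemma mcoeff_diag (f : F -> F) (k : {fset cmode} -> K) v S : linear f ->
  (forall S, f << S >> = k S *: << S >>) -> (f v)@_S = k S * v@_S.
Proof.
move=> fL fk; move: v; apply: (malg_lin_ext (V := K^o)) => [a u v|a u v|T].
- by rewrite fL mcoeffD mcoeffZ.
- by rewrite mcoeffD mcoeffZ mulrDr mulrCA.
by rewrite fk mcoeffZ !mcoeff_basis; case: eqP => [->|_]; rewrite ?mulr0.
Qed.

Definition flavor_count i (s : seq cmode) := count (fun x => x.1 == i) s.

Lemma scale_eq_idx (f : 'I_(l + l) -> F) i j : (j == i)%:R *: f i = (j == i)%:R *: f j.
Proof. by case: eqP => [-> //|_]; rewrite scale0r [RHS]scale0r. Qed.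

Lemma glop_mono i s : glop i i (mono s) = (flavor_count i s)%:R *: mono s.
Proof.
elim: s => [|x s IHs]; first by rewrite glop_vac scale0r.
rewrite mono_cons glop_create IHs (lin_scale (psi_linear _ _)).
have -> : flavor_count i (x :: s) = ((x.1 == i) + flavor_count i s)%N by [].
rewrite natrD scalerDl [RHS]addrC.
move: (Negz x.2) (mono s) => q w.
exact: (congr1 (+%R _) (scale_eq_idx (fun j => psi j q w) i x.1)).
Qed.

Lemma gpsi_diag (c : 'I_(l + l) -> K) i m v :
  gpsi (\matrix_(a, b) ((a == b)%:R * c b)) i m v = c i *: psi i m v.
Proof.
rewrite /gpsi (bigD1 i) //= mxE eqxx mul1r big1 ?addr0 // => a /negPf ai.
by rewrite mxE ai mul0r scale0r.
Qed.

(** The diagonal matrix with 2 at i and 1/2 at its conjugate multiplies a monomial by a power of 2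
    whose exponent is the difference of the two counts; in characteristic 0 this is 1 only if the
    counts agree. *)
Lemma inv_flavor i v S : inv v -> S \in msupp v ->
  flavor_count i (modes S) = flavor_count (conj_idx i) (modes S).
Proof.
move=> iv Sv; pose c b : K := if b == i then 2 else if b == conj_idx i then 2^-1 else 1.
pose g : 'M[K]_(l + l) := \matrix_(a, b) ((a == b)%:R * c b).
have ic := conj_idx_neq i; have two : 2 != 0 :> K by rewrite pnatr_eq0.
have cc b : c (conj_idx b) * c b = 1.
  rewrite /c conj_idx_eqC conj_idx_eq; case: (eqVneq b i) => [->|bi].
    by rewrite [i == _]eq_sym ic mulVf.
  by case: eqP => _; rewrite ?mulfV // mulr1.
have gO : O_group g.
  apply: O_groupP => a b; rewrite (bigD1 b) //= big1 => [|d /negPf db].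
    rewrite !mxE eqxx mul1r addr0 [conj_idx b == a]eq_sym.
    by case: eqP => [->|_]; rewrite ?mul0r // mul1r cc.
  by rewrite [g d b]mxE db mul0r mulr0.
pose k (s : seq cmode) : K := 2 ^+ flavor_count i s * 2^-1 ^+ flavor_count (conj_idx i) s.
have gk s : foldr (fun x v => gpsi g x.1 (Negz x.2) v) vac s = k s *: mono s.
  elim: s => [|x s IHs]; first by rewrite /k !expr0 mulr1 scale1r.
  rewrite /= IHs gpsi_diag (lin_scale (psi_linear _ _)) scalerA -mono_cons.
  congr (_ *: _); rewrite /k /flavor_count /= /c; case: (eqVneq x.1 i) => [->|xi].
    by rewrite [i == _]eq_sym ic !add0n add1n exprS mulrA.
  by case: eqP => _; rewrite ?add0n ?add1n ?mul1r // exprS mulrCA.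
have := iv g gO; move/(congr1 (mcoeff S)).
rewrite (mcoeff_diag (k := fun S => k (modes S)) v S (O_act_linear g)) => [|T]; last first.
  by rewrite O_actE gk -mono_modes.
move/eqP; rewrite -subr_eq0 -{2}[v@_S]mul1r -mulrBl mulf_eq0 mcoeff_eq0 Sv orbF subr_eq0.
rewrite /k exprVn => /eqP/(canRL (mulfVK (expf_neq0 _ two))); rewrite mul1r => /eqP.
by rewrite -!natrX eqr_nat eqn_exp2l // => /eqP.
Qed.

Lemma inv_glop i j v : inv v -> glop i j v = glop (conj_idx j) (conj_idx i) v.
Proof.
move=> iv; have [<-|ij] := eqVneq i j; last exact: inv_root.
have gd k S : (glop k k v)@_S = (flavor_count k (modes S))%:R * v@_S.
  apply: (mcoeff_diag (k := fun S => (flavor_count k (modes S))%:R) v S (glop_linear k k)).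
  by move=> T; rewrite mono_modes; exact: glop_mono.
apply/malgP => S; apply: etrans (gd i S) (etrans _ (esym (gd (conj_idx i) S))).
case: (boolP (S \in msupp v)) => [/(inv_flavor i iv) ->//|].
by rewrite -mcoeff_eq0 => /eqP ->; rewrite !mulr0.
Qed.

Lemma sum_flavor_count s : (\sum_i flavor_count i s = size s)%N.
Proof.
elim: s => [|x s IHs]; first by rewrite big1.
rewrite /flavor_count big_split /= IHs (bigD1 x.1) //= eqxx big1 ?add1n // => i.
by rewrite eq_sym => /negPf ->.
Qed.

Lemma inv_even v : inv v -> even_vector v.
Proof.
move=> iv S Sv; rewrite -size_modes -sum_flavor_count big_split_ord /=.
rewrite [X in (X + _)%N](eq_bigr (fun p => flavor_count (rshift l p) (modes S))) => [|p _].
  by rewrite addnn odd_double.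
by rewrite (inv_flavor _ iv Sv) conj_idx_lshift.
Qed.

End Torus.

(** * Generation and irreducibility of the invariants *)

Section LinearSpans.
Variables (K : fieldType) (V : lmodType K).
Implicit Types (S N : V -> Prop) (u v : V).

Lemma lspan0 S : lspan S 0.
Proof. by have [] := subspace_lspan S. Qed.

Lemma lspanP S a u v : lspan S u -> lspan S v -> lspan S (a *: u + v).
Proof. by have [_] := subspace_lspan S; apply. Qed.

Lemma lspan_gen S u : S u -> lspan S u.
Proof. by move=> Su; apply: sub_gen_smallest. Qed.

Lemma sum_closed N (I : Type) (r : seq I) (P : pred I) (f : I -> V) : N 0 ->
  (forall a u v, N u -> N v -> N (a *: u + v)) ->
  (forall k, P k -> N (f k)) -> N (\sum_(k <- r | P k) f k).
Proof.
move=> N0 NL Nf; elim/big_ind: _ => // u v Nu Nv.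
by rewrite -[u]scale1r; apply: NL.
Qed.

End LinearSpans.

Section EnergyFiltration.
Variables (K : numFieldType) (l : nat).
Local Notation F := (Fock K l).
Local Notation psi := (@psi K l).
Local Notation cmode := (cmode l).
Implicit Types (i j : 'I_(l + l)) (v : F) (S : {fset cmode}).

(* Twice the energy: [psi_{-n-1/2}] creates energy [n + 1/2]. *)
Definition energy (s : seq cmode) : nat := \sum_(x <- s) x.2.*2.+1.

Definition Fil (e : int) : F -> Prop :=
  lspan (fun v => exists2 s, (energy s)%:Z <= e & v = mono K s).

Lemma Fil_le e e' v : e <= e' -> Fil e v -> Fil e' v.
Proof.
move=> ee'; apply: (lspan_ind (P := Fil e')) => [|a u w|u [s se ->]].
- exact: lspan0.
- exact: lspanP.
by apply: lspan_gen; exists s => //; exact: le_trans ee'.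
Qed.

Lemma Fil_lt0 e v : e < 0 -> Fil e v -> v = 0.
Proof.
move=> e0; apply: (lspan_ind (P := fun v => v = 0)) => // [a u w -> ->|u [s se _]].
  by rewrite scaler0 addr0.
by lia.
Qed.

Lemma Fil_exists v : exists e : nat, Fil e v.
Proof.
move: v; apply: malg_span => [|a u w [e Fu] [e' Fw]|S].
- by exists 0%N; exact: lspan0.
- by exists (maxn e e'); apply: lspanP; [apply: Fil_le Fu|apply: Fil_le Fw]; lia.
by exists (energy (modes S)); apply: lspan_gen; exists (modes S) => //; exact: mono_modes.
Qed.

Lemma Fil_map (f : F -> F) e e' v : linear f ->
  (forall s, (energy s)%:Z <= e -> Fil e' (f (mono K s))) -> Fil e v -> Fil e' (f v).
Proof.
move=> fL fs; apply: (lspan_ind (P := fun v => Fil e' (f v))) => [|a u w|u [s se ->]].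
- rewrite (lin_zero fL); exact: lspan0.
- rewrite fL; exact: lspanP.
exact: fs.
Qed.

Lemma Fil_create i n e v : Fil e v -> Fil (e + n.*2.+1%:Z) (psi i (Negz n) v).
Proof.
apply: Fil_map => [|s se]; first exact: psi_linear.
apply: lspan_gen; exists ((i, n) :: s); last by rewrite mono_cons.
by rewrite /energy big_cons /= -/(energy s); lia.
Qed.

Lemma Fil_psi i m e v : Fil e v -> Fil (e - m *+ 2 - 1) (psi i m v).
Proof.
have [m0|] := leP 0 m; last first.
  by case: m => // n _ Fv; apply: Fil_le (@Fil_create i n e v Fv); lia.
apply: Fil_map => [|s]; first exact: psi_linear.
elim: s e => [|x s IHs] e se.
  rewrite (creative_psi K i m0); exact: lspan0.
rewrite mono_cons; move: se; rewrite /energy big_cons -/(energy s) => se.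
have cL := @Fil_create x.1 x.2.
have E : -1 *: psi x.1 (Negz x.2) (psi i m (mono K s)) +
    (if (i == conj_idx x.1) && (m + Negz x.2 + 1 == 0) then mono K s else 0)
    = psi i m (psi x.1 (Negz x.2) (mono K s)).
  by move: (Negz x.2) (mono K s) => q w; rewrite [RHS]psi_swap scaleN1r [RHS]addrC.
rewrite -E; apply: lspanP.
  by apply: Fil_le (cL _ _ (IHs (energy s)%:Z (lexx _))); lia.
case: ifP => [/andP[_ /eqP mx]|_]; last exact: lspan0.
apply: lspan_gen; exists s => //; lia.
Qed.

Lemma Fil_bil p q e v : Fil e v -> Fil (e - p *+ 2 - q *+ 2 - 2) (bil p q v).
Proof.
move=> Fv; have Fs (p' q' : int) : p' + q' = p + q ->
    Fil (e - p *+ 2 - q *+ 2 - 2) (\sum_i psi (conj_idx i) p' (psi i q' v)).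
  move=> pq; elim/big_ind: _ => [|u w Fu Fw|i _]; first exact: lspan0.
    by rewrite -[u]scale1r; apply: lspanP.
  by apply: Fil_le (@Fil_psi (conj_idx i) p' _ _ (@Fil_psi i q' e v Fv)); lia.
have [p0|p0] := leP 0 p; last by rewrite bil_neg //; exact: (Fs p q erefl).
rewrite (_ : bil p q v = -1 *: (\sum_i psi (conj_idx i) q (psi i p v)) + 0).
  by apply: lspanP; [exact: (Fs q p (addrC q p)) | exact: lspan0].
by rewrite bil_pos // scaleN1r addr0.
Qed.

End EnergyFiltration.

Section CasimirInvariants.
Variables (K : numFieldType) (l : nat).
Local Notation F := (Fock K l).
Local Notation psi := (@psi K l).
Local Notation inv := (@O_invariants K l).
Local Notation cmode := (cmode l).
Implicit Types (i j : 'I_(l + l)) (v : F) (S : {fset cmode}).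

Definition slotop (a : nat) (v : F) : F := bil (- a%:Z - 1) a v.

Definition Dop (M : nat) (v : F) : F :=
  \sum_(a < M) ((l + l + a.*2)%:R *: slotop a v - slotop a (slotop a v)).

(** The modes are abstract functions [p] and [q], so that [psi] does not reduce to [create] or
    [annihilate] while the general identity is applied. The last hypothesis says that M slots
    suffice to compute [glop] on v. *)
Lemma casimir_inv (M : nat) (p q : 'I_M -> int) v : inv v ->
  (forall a, 0 <= q a) -> (forall a, p a = - q a - 1) -> injective q ->
  (forall i j, \sum_a psi i (p a) (psi (conj_idx j) (q a) v) = glop i j v) ->
  \sum_(a < M) ((l + l + a.*2)%:R *: bil (p a) (q a) v
    - bil (p a) (q a) (bil (p a) (q a) v)) =
  2 *: (\sum_(a < M) \sum_(b < M | (a < b)%N) bil (p b) (q a) (bil (p a) (q b) v))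
  - \sum_a \sum_b bil (p a) (p b) (- bil (q b) (q a) v).
Proof.
move=> iv q0 pq q_inj vM.
have p0 a : p a < 0 by have := q0 a; rewrite pq; lia.
pose th i a := psi i (p a); pose de i a := psi (conj_idx i) (q a).
have thth i j a b w : th i a (th j b w) = - th j b (th i a w).
  by apply: psi_swap0; apply/nandP; right; have := p0 a; have := p0 b; lia.
have dede i j a b w : de i a (de j b w) = - de j b (de i a w).
  by apply: psi_swap0; apply/nandP; right; have := q0 a; have := q0 b; lia.
have deth i j a b w : de j b (th i a w) =
    (if (i == j) && (a == b) then w else 0) - th i a (de j b w).
  rewrite /de /th psi_swap conj_idx_eq [j == i]eq_sym.
  have -> // : (q b + p a + 1 == 0) = (a == b).
  by rewrite pq -(inj_eq q_inj); apply/eqP/eqP; lia.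
have thL i a : linear (th i a) by exact: psi_linear.
have deL i a : linear (de i a) by exact: psi_linear.
have inv_v i j : \sum_a th j a (de i a v) =
    \sum_a th (conj_idx i) a (de (conj_idx j) a v).
  by apply: etrans (vM j i) (etrans (inv_glop j i iv) (esym (vM _ _))).
have := casimir (@conj_idxK l) thL deL thth dede deth inv_v.
rewrite card_ord.
have EB a b w : \sum_i th i a (de i b w) = bil (p a) (q b) w.
  apply: etrans (esym (sum_conj (fun i => th i a (de i b w)))) _.
  rewrite (bil_neg (q b) w (p0 a)); apply: eq_bigr => i _.
  by rewrite /th /de conj_idxK.
have QB a b w : \sum_i de i a (de (conj_idx i) b w) = - bil (q b) (q a) w.
  rewrite (bil_pos (q a) w (q0 b)) opprK; apply: eq_bigr => i _.
  by rewrite /de conj_idxK.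
have QsB a b w : \sum_i th i a (th (conj_idx i) b w) = bil (p a) (p b) w.
  apply: etrans (esym (sum_conj (fun i => th i a (th (conj_idx i) b w)))) _.
  rewrite (bil_neg (p b) w (p0 a)); apply: eq_bigr => i _.
  by rewrite /th conj_idxK.
move=> E; apply: etrans (etrans _ E) _.
- apply: eq_bigr => a _; apply: (f_equal2 +%R).
    exact: (congr1 (fun w => (l + l + a.*2)%:R *: w) (esym (EB a a v))).
  exact: (congr1 -%R (esym (etrans (EB a a _) (congr1 (bil (p a) (q a)) (EB a a v))))).
apply: (f_equal2 +%R).
  apply: (congr1 (fun w => 2 *: w)); apply: eq_bigr => a _; apply: eq_bigr => b _.
  exact: (etrans (EB b a _) (congr1 (bil (p b) (q a)) (EB a b v))).
apply: (congr1 -%R); apply: eq_bigr => a _; apply: eq_bigr => b _.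
exact: (etrans (QsB a b _) (congr1 (bil (p a) (p b)) (QB a b v))).
Qed.

(** v itself need not lie in N. By the Casimir identity [Dop M v] is built by bilinears from vectors
    of smaller energy, obtained by lowering a fermion or by removing a pair; this drives the
    induction on the energy. *)
Lemma Dop_closed (N : F -> Prop) (M : nat) v : N 0 ->
  (forall a u v, N u -> N v -> N (a *: u + v)) ->
  (forall p q v, N v -> N (bil p q v)) -> inv v ->
  (forall i (a : int), M%:Z <= a -> psi i a v = 0) ->
  (forall a b : nat, (a < b)%N -> N (bil (- a%:Z - 1) b v)) ->
  (forall a b : nat, N (bil a b v)) -> N (Dop M v).
Proof.
move=> N0 NL Nbil iv vM Nlow Nann.
have NZ a u : N u -> N (a *: u) by move=> Nu; rewrite -[_ *: _]addr0; apply: NL.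
have NN u : N u -> N (- u) by rewrite -scaleN1r; exact: NZ.
have ND u w : N u -> N w -> N (u + w) by rewrite -{2}[u]scale1r; exact: NL.
rewrite /Dop /slotop.
have E := @casimir_inv M (fun a => - (a : nat)%:Z - 1) (fun a => (a : nat)%:Z) v iv.
rewrite E //; last 2 first.
- by move=> a b [] /val_inj.
- move=> i j; rewrite /glop (@psumE _ _ M) => [|a Ma]; first by [].
  by rewrite vM // (lin_zero (psi_linear i _)).
apply: ND.
  apply: NZ; apply: sum_closed => // a _; apply: sum_closed => // b ab.
  by apply: Nbil; exact: Nlow.
apply: (NN); apply: sum_closed => // a _; apply: sum_closed => // b _.
by apply: Nbil; exact: (NN _ (Nann b a)).
Qed.

Lemma Dop_linear M : linear (Dop M).
Proof.
move=> x u v; rewrite /Dop scaler_sumr -big_split; apply: eq_bigr => a _ /=.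
have sL : linear (slotop a) by exact: bil_linear.
have L : linear (fun v => (l + l + a.*2)%:R *: slotop a v - slotop a (slotop a v)).
  apply: lin_subf; last exact: (lin_comp sL sL).
  by move=> y w z; rewrite sL scalerDr !scalerA mulrC.
exact: L.
Qed.

Definition slot_count (a : nat) (s : seq cmode) := count (fun x => x.2 == a) s.

Lemma slotop_mono a s : slotop a (mono K s) = (slot_count a s)%:R *: mono K s.
Proof.
elim: s => [|x s IHs].
  by rewrite scale0r /slotop; apply: bil_vac; rewrite /= orbT.
have -> : slot_count a (x :: s) = ((x.2 == a) + slot_count a s)%N by [].
have := bil_psi (- a%:Z - 1) a x.1 (Negz x.2) (mono K s).
have -> : (a%:Z + Negz x.2 + 1 == 0) = (x.2 == a) by apply/eqP/eqP; lia.
have -> : (- a%:Z - 1 + Negz x.2 + 1 == 0) = false by apply/eqP; lia.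
have q1 : x.2 = a -> - a%:Z - 1 = Negz x.2 by lia.
move: q1; rewrite -/(slotop a _) -/(slotop a _) IHs mono_cons.
move: (Negz x.2) (mono K s) => q w q1 /eqP; rewrite subr0 subr_eq => /eqP ->.
rewrite (lin_scale (psi_linear _ _)) natrD scalerDl.
have ifE : (if x.2 == a then psi x.1 (- a%:Z - 1) w else 0) = (x.2 == a)%:R *: psi x.1 q w.
  by case: eqP => [xa|_]; [rewrite (q1 xa) scale1r | rewrite scale0r].
by rewrite ifE.
Qed.

(** Truncated subtraction is harmless on [modes S], where a slot holds at most 2l fermions by
    [slot_count_le]. *)
Definition casimir_value (M : nat) (s : seq cmode) : nat :=
  \sum_(a < M) slot_count a s * (l + l + a.*2 - slot_count a s).

Lemma slot_count_le a S : (slot_count a (modes S) <= l + l)%N.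
Proof.
rewrite /slot_count -size_filter -(size_map fst) -[X in (_ <= X)%N]card_ord cardE.
apply: uniq_leq_size => [|i _]; last by rewrite mem_enum.
rewrite map_inj_in_uniq ?filter_uniq ?modes_uniq // => -[i m] [j n].
by rewrite !mem_filter /= => /andP[/eqP -> _] /andP[/eqP -> _] ->.
Qed.

Lemma slot_count_full S i : slot_count 0 (modes S) = (l + l)%N -> (i, 0%N) \in S.
Proof.
rewrite /slot_count -size_filter -(size_map fst) => sz.
have [] := @uniq_min_size _ [seq x.1 | x <- modes S & x.2 == 0%N] (enum 'I_(l + l)).
- rewrite map_inj_in_uniq ?filter_uniq ?modes_uniq // => -[j m] [k n].
  by rewrite !mem_filter /= => /andP[/eqP -> _] /andP[/eqP -> _] ->.
- by move=> j _; rewrite mem_enum.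
- by rewrite sz -cardE card_ord.
move=> _ /(_ i); rewrite mem_enum => /mapP[[j m]].
by rewrite mem_filter /= mem_modes => /andP[/eqP -> jS] ->.
Qed.

Lemma Dop_coef M v S : (Dop M v)@_S = (casimir_value M (modes S))%:R * v@_S.
Proof.
apply: (mcoeff_diag (k := fun S => (casimir_value M (modes S))%:R) v S (Dop_linear M)).
move=> T; rewrite mono_modes /Dop /casimir_value natr_sum scaler_suml.
apply: eq_bigr => a _; have sL : linear (slotop a) by exact: bil_linear.
rewrite slotop_mono (lin_scale sL) slotop_mono !scalerA -scalerBl.
apply: (congr1 (fun c => c *: _)); rewrite mulnBr natrB; last first.
  by rewrite leq_mul2l (leq_trans (slot_count_le a T)) ?leq_addr ?orbT.
by rewrite !natrM mulrC.
Qed.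

End CasimirInvariants.

Lemma mcoeff_comb2 (K : fieldType) (T : choiceType) (a b : K) (x y z : T) :
  (a *: << x >> + b *: << y >> : {malg K[T]})@_z = a * (x == z)%:R + b * (y == z)%:R.
Proof. by rewrite mcoeffD !mcoeffZ !mcoeff_basis. Qed.

(** * Reflections and the invariant kernel of the Casimir operator *)

Section Reflection.
Variables (K : numFieldType) (l : nat).
Local Notation F := (Fock K l).
Local Notation psi := (@psi K l).
Local Notation vac := (Fock_vac K l).
Local Notation O_act := (@O_act K l).
Local Notation inv := (@O_invariants K l).
Local Notation cmode := (cmode l).
Implicit Types (i j : 'I_(l + l)) (v : F) (S : {fset cmode}).

Definition reflection i : 'M[K]_(l + l) :=
  \matrix_(a, b) (a == tperm i (conj_idx i) b)%:R.

Lemma gpsi_reflection i j m v : gpsi (reflection i) j m v = psi (tperm i (conj_idx i) j) m v.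
Proof.
rewrite /gpsi (bigD1 (tperm i (conj_idx i) j)) //= mxE eqxx scale1r big1 ?addr0 //.
by move=> a /negPf aj; rewrite mxE aj scale0r.
Qed.

Lemma O_group_reflection i : O_group (reflection i).
Proof.
apply: O_groupP => a b; rewrite (bigD1 (tperm i (conj_idx i) b)) //= big1 => [|d /negPf db].
  rewrite !mxE eqxx mulr1 addr0 (inj_tperm _ _ _ (inv_inj (@conj_idxK l))) conj_idxK tpermC.
  by rewrite (inj_eq perm_inj) eq_sym.
by rewrite [reflection i d b]mxE db mulr0.
Qed.

(** Of the two exchanged indices S contains precisely the two fermions in slot 0, so the reflection
    merely swaps two anticommuting factors. *)
Lemma O_act_reflection i S : (forall j, (j == i) || (j == conj_idx i) -> (j, 0%N) \in S) ->
  (forall x, x \in S -> (x.1 == i) || (x.1 == conj_idx i) -> x.2 = 0%N) ->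
  O_act (reflection i) << S >> = - << S >>.
Proof.
move=> inS onlyS; pose x0 : cmode := (i, 0%N); pose x1 : cmode := (conj_idx i, 0%N).
pose S1 := (S `\ x0)%fset; pose S0 := (S1 `\ x1)%fset.
have x0S : x0 \in S by apply: inS; rewrite eqxx.
have x1S : x1 \in S by apply: inS; rewrite eqxx orbT.
have only0 k (x : cmode) : (k == i) || (k == conj_idx i) -> x \in S -> x.1 = k -> x = (k, 0%N).
  by case: x => a n ki xS /= ak; rewrite -ak; congr (_, _); apply: (onlyS (a, n) xS); rewrite /= ak.
have x10 : x1 != x0 by rewrite xpair_eqE conj_idx_neq.
have x1S1 : x1 \in S1 by apply/fsetD1P.
have E1 : << S1 >> = fermi_sign K x1 S0 *: psi (conj_idx i) (Negz 0) << S0 >> :> F.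
  rewrite [psi _ _ _]createU !inE eqxx /= scalerA fermi_sign_sqr scale1r.
  by rewrite fsetD1K.
have E0 : << S >> = fermi_sign K x0 S1 *: psi i (Negz 0) << S1 >> :> F.
  rewrite [psi _ _ _]createU !inE eqxx /= scalerA fermi_sign_sqr scale1r.
  by rewrite fsetD1K.
have fix0 : O_act (reflection i) << S0 >> = << S0 >>.
  rewrite O_actE [RHS]Fock_basisE; have : {subset modes S0 <= S0} by move=> x; rewrite mem_modes.
  elim: (modes S0) => [//|x s IHs] sS0 /=.
  have xS0 : x \in S0 by apply: sS0; rewrite inE eqxx.
  rewrite IHs => [|y ys]; last by apply: sS0; rewrite inE ys orbT.
  move: xS0; rewrite !inE => /and3P[xx1 xx0 xS].
  rewrite gpsi_reflection tpermD; first by case: (x).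
    by apply: contraNneq xx0 => /esym xi; apply/eqP/(only0 i); rewrite ?eqxx.
  by apply: contraNneq xx1 => /esym xi; apply/eqP/(only0 (conj_idx i)); rewrite ?eqxx ?orbT.
have OL := O_act_linear (reflection i).
have swap : O_act (reflection i) (psi i (Negz 0) (psi (conj_idx i) (Negz 0) << S0 >>))
    = - psi i (Negz 0) (psi (conj_idx i) (Negz 0) << S0 >>).
  rewrite !O_act_create fix0 !gpsi_reflection tpermL tpermR.
  by apply: psi_swap0; apply/nandP; right.
rewrite E0 E1 (lin_scale (psi_linear i _)) !(lin_scale OL) swap.
by rewrite !scalerN.
Qed.

Definition top_set : {fset cmode} := [fset x in [seq (i, 0%N) | i <- enum 'I_(l + l)]]%fset.

Lemma mem_top_set x : (x \in top_set) = (x.2 == 0%N).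
Proof.
rewrite inE; case: x => i n; apply/mapP/eqP => /= [[j _ [_ ->]] //|->].
by exists i; rewrite ?mem_enum.
Qed.

(** A slot a > 0 must be empty because its count is at most 2l < 2l + 2a; slot 0 may be empty or
    full. *)
Lemma casimir_value_eq0 M S : (forall x, x \in S -> (x.2 < M)%N) ->
  casimir_value M (modes S) = 0%N -> S = fset0 \/ S = top_set.
Proof.
move=> SM /eqP; rewrite /casimir_value sum_nat_eq0 => /forallP cv.
have cnt0 a : (0 < a)%N -> forall x, x \in S -> x.2 != a.
  move=> a0 x xS; apply/negP => /eqP xa; have aM : (a < M)%N by rewrite -xa SM.
  have : (0 < slot_count a (modes S))%N.
    by rewrite -has_count; apply/hasP; exists x; rewrite ?mem_modes //= xa.
  have := cv (Ordinal aM); have := slot_count_le a S; rewrite /= muln_eq0; lia.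
have [->|[x xS]] := fset_0Vmem S; first by left.
right; have x0 : x.2 = 0%N by apply/eqP/contraT; rewrite -lt0n => /cnt0/(_ x xS); rewrite eqxx.
have M0 : (0 < M)%N by rewrite -x0 SM.
have full : slot_count 0 (modes S) = (l + l)%N.
  have : (0 < slot_count 0 (modes S))%N.
    by rewrite -has_count; apply/hasP; exists x; rewrite ?mem_modes //= x0.
  have := cv (Ordinal M0); have := slot_count_le 0 S; rewrite /= muln_eq0; lia.
apply/fsetP => y; rewrite mem_top_set; apply/idP/eqP => [yS|y0].
  by apply/eqP/contraT; rewrite -lt0n => /cnt0/(_ y yS); rewrite eqxx.
by case: y y0 => i n /= ->; exact: slot_count_full.
Qed.

Lemma inv_harmonic M v : (0 < l)%N -> inv v ->
  (forall S, S \in msupp v ->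
     casimir_value M (modes S) = 0%N /\ forall x, x \in S -> (x.2 < M)%N) ->
  v = vac_coef v *: vac.
Proof.
move=> l0 iv vS; pose i0 : 'I_(l + l) := lshift l (Ordinal l0).
have ne : fset0 != top_set.
  apply/eqP => /fsetP/(_ (i0, 0%N)); by rewrite mem_top_set inE eqxx.
have cE (a b : K) S : (a *: vac + b *: << top_set >> : F)@_S =
    a * (fset0 == S)%:R + b * (top_set == S)%:R.
  exact: mcoeff_comb2.
have vE : v = vac_coef v *: vac + v@_top_set *: << top_set >>.
  apply/malgP => S; rewrite cE.
  have [S0|SN] := eqVneq fset0 S.
    by rewrite -S0 eq_sym (negPf ne) mulr1 mulr0 addr0.
  have [ST|SNT] := eqVneq top_set S; first by rewrite -ST mulr1 mulr0 add0r.
  rewrite !mulr0 addr0; apply/eqP; rewrite mcoeff_eq0; apply/negP => /vS[c0 SM].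
  by have [S0|ST] := casimir_value_eq0 SM c0; [rewrite S0 eqxx in SN|rewrite ST eqxx in SNT].
have : O_act (reflection i0) v = v by apply: iv; exact: O_group_reflection.
rewrite {1}vE (O_act_linear _) (lin_scale (O_act_linear _)) O_act_vac.
rewrite O_act_reflection => [|j _|x]; try by rewrite mem_top_set.
  move/(congr1 (mcoeff top_set)); rewrite scalerN -scaleNr cE.
  rewrite (negPf ne) mulr0 add0r eqxx mulr1 => /esym/(eq_oppr_eq0 (V := K^o)) t0.
  by rewrite {1}vE t0 scale0r addr0.
by rewrite mem_top_set => /eqP.
Qed.

Lemma exists_slot_bound v : exists M : nat,
  (forall i (a : int), M%:Z <= a -> psi i a v = 0) /\
  forall S x, S \in msupp v -> x \in S -> (x.2 < M)%N.
Proof.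
have /choice[f fM] := fun i => (lfield_psi K i).2 v.
have [M Mf] := fin_bound f; exists M.
have vM i (a : int) : M%:Z <= a -> psi i a v = 0.
  by move=> Ma; apply: fM; have := Mf i; lia.
split=> // S x Sv xS; rewrite ltnNge; apply/negP => Mx.
have := mcoeff_annihilate x v (S `\ x)%fset.
have := vM (conj_idx x.1) x.2 Mx; rewrite /= conj_idxK -surjective_pairing => ->.
rewrite mcoeff0 !inE eqxx /= fsetD1K // => /esym/eqP.
by rewrite mulf_eq0 /fermi_sign signr_eq0 /= mcoeff_eq0 Sv.
Qed.

End Reflection.

(** Eigenvectors with nonzero eigenvalues need not lie in N one by one, but f can be inverted on
    their sum inside N. The eigenvalues may repeat. *)
Lemma eigen_sum (K : fieldType) (V : lmodType K) (f : V -> V) (N : V -> Prop)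
    (s : seq (K * V)) : linear f -> N 0 ->
  (forall a u v, N u -> N v -> N (a *: u + v)) -> (forall v, N v -> N (f v)) ->
  (forall x, x \in s -> f x.2 = x.1 *: x.2 /\ x.1 != 0) ->
  N (\sum_(x <- s) x.1 *: x.2) -> N (\sum_(x <- s) x.2).
Proof.
move=> fL N0 NL Nf; have [n sz] := ubnP (size s); elim: n s sz => // n IHn [|[w x] s] sz es Ng.
  by rewrite big_nil.
have [/= fx w0] := es (w, x) (mem_head _ _).
have es' y : y \in s -> f y.2 = y.1 *: y.2 /\ y.1 != 0.
  by move=> ys; apply: (es y); rewrite inE ys orbT.
(* Applying 1 - f/w removes x and rescales each other y by [c y]; the inductive hypothesis gives the
   sum of the [c y *: y], and adding 1/w times the given vector restores the full sum. *)
pose c (y : K * V) := 1 - y.1 / w.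
have fg : f (\sum_(y <- (w, x) :: s) y.1 *: y.2) =
    w *: (w *: x) + \sum_(y <- s) y.1 *: (y.1 *: y.2).
  rewrite big_cons fL fx; congr (_ + _); rewrite (lin_sum fL).
  apply: eq_big_seq => y /es'[fy _]; by rewrite (lin_scale fL) fy.
have : N (\sum_(y <- [seq (y.1, c y *: y.2) | y <- s]) y.2).
  apply: IHn; first by rewrite size_map.
    move=> _ /mapP[y ys ->] /=; have [fy y0] := es' y ys.
    by rewrite (lin_scale fL) fy !scalerA mulrC.
  have := NL (- w^-1) _ _ (Nf _ Ng) Ng; rewrite fg big_cons /= big_map /=.
  rewrite scaleNr scalerDr [w^-1 *: (w *: _)]scalerA mulVf // scale1r.
  rewrite opprD addrACA addNr add0r scaler_sumr -sumrN -big_split /=.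
  congr N; apply: eq_bigr => y _; rewrite !scalerA -scaleNr -scalerDl.
  by congr (_ *: _); rewrite /c; field.
move/(NL w^-1 _ _ Ng); rewrite big_map !big_cons /= scalerDr scalerA mulVf // scale1r.
rewrite -addrA scaler_sumr -big_split /=; congr (N (_ + _)); apply: eq_bigr => y _.
by rewrite scalerA -scalerDl; rewrite /c [w^-1 * _]mulrC addrC subrK scale1r.
Qed.

Lemma malg_lin_sum (K : fieldType) (T : choiceType) (V : lmodType K)
    (f : {malg K[T]} -> V) u : linear f -> f u = \sum_(k <- msupp u) u@_k *: f << k >>.
Proof.
move=> fL; apply: (malg_lin_ext fL (linearP (linext (fun k => f << k >>)))) => k.
exact: esym (linextU (fun k => f << k >>) k).
Qed.

Section Generation.
Variables (K : numFieldType) (l : nat).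
Hypothesis l_gt0 : (0 < l)%N.
Local Notation F := (Fock K l).
Local Notation vac := (Fock_vac K l).
Local Notation inv := (@O_invariants K l).
Local Notation cmode := (cmode l).
Implicit Types (v : F) (S : {fset cmode}).

(** The witness is the component of v in the kernel of [Dop M]. It is chosen independently of N, so
    the same z can be used for several N. *)
Lemma Dop_harmonic (M : nat) v : exists z : F,
  (forall S, S \in msupp z -> S \in msupp v /\ casimir_value M (modes S) = 0%N) /\
  forall N : F -> Prop, N 0 -> (forall a u w, N u -> N w -> N (a *: u + w)) ->
    (forall w, N w -> N (Dop M w)) -> N (Dop M v) -> N (v - z).
Proof.
pose c S := casimir_value M (modes S).
have DU S : Dop M << S >> = (c S)%:R *: << S >>.
  by apply/malgP => T; rewrite Dop_coef mcoeffZ mcoeff_basis; case: eqP => [->|]; rewrite ?mulr0.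
pose zf S : F := if c S == 0%N then << S >> else 0.
have zU S : linext zf << S >> = zf S by exact: linextU.
exists (linext zf v); split.
  move=> S; rewrite -mcoeff_neq0.
  rewrite (mcoeff_diag (k := fun S => (c S == 0%N)%:R) v S (linearP (linext zf))).
    by rewrite mulf_eq0 negb_or pnatr_eq0 eqb0 negbK mcoeff_neq0 => /andP[/eqP].
  by move=> T; apply: etrans (zU T) _; rewrite /zf; case: eqP => _; rewrite ?scale1r ?scale0r.
move=> N N0 NL Nf NDv.
pose s := [seq ((c A)%:R : K, v@_A *: << A >> : F) | A <- msupp v & c A != 0%N].
have vz : v - linext zf v = \sum_(x <- s) x.2.
  have L : linear (fun w : F => w - linext zf w).
    by apply: lin_subf; [move=> a u w|exact: linearP].
  rewrite big_map big_filter big_mkcond; apply: etrans (malg_lin_sum v L) _.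
  apply: eq_bigr => S _.
  rewrite zU /zf; case: eqP => _ /=.
    by rewrite subrr scaler0.
  by rewrite subr0.
rewrite vz; apply: (eigen_sum (Dop_linear M) N0 NL Nf).
  move=> x /mapP[S]; rewrite mem_filter => /andP[cS _] ->; split; last by rewrite pnatr_eq0.
  by rewrite /= (lin_scale (Dop_linear M)) DU !scalerA mulrC.
rewrite big_map big_filter big_mkcond; move: NDv; congr N.
apply: etrans (malg_lin_sum v (Dop_linear M)) _; apply: eq_bigr => S _.
rewrite DU; case: eqP => [->|_] /=; first by rewrite scale0r scaler0.
by rewrite !scalerA mulrC.
Qed.

Lemma inv_generated (N : F -> Prop) v : N 0 ->
  (forall a u w, N u -> N w -> N (a *: u + w)) ->
  (forall p q w, N w -> N (bil p q w)) -> N vac -> inv v -> N v.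
Proof.
move=> N0 NL Nbil Nvac iv; have [n Fv] := Fil_exists v.
elim/ltn_ind: n v iv Fv => n IHn v iv Fv.
have low (e : int) w : e < n%:Z -> inv w -> Fil e w -> N w.
  have [e0|] := ltP e 0; first by move=> _ _ /(Fil_lt0 e0) ->.
  by case: e => // e _ en; apply: IHn; rewrite ltz_nat in en.
have [M [vM SM]] := exists_slot_bound v.
have NDop (N' : F -> Prop) w : N' 0 -> (forall a u w, N' u -> N' w -> N' (a *: u + w)) ->
    (forall p q w, N' w -> N' (bil p q w)) -> N' w -> N' (Dop M w).
  move=> N0' L' Nbil' Nw; apply: sum_closed => // a _; rewrite -scaleN1r addrC.
  apply: (L'); first by apply: (Nbil'); apply: (Nbil').
  by rewrite -[_ *: _]addr0; apply: (L') => //; apply: Nbil'.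
have [z [Sz Nz]] := Dop_harmonic M v.
(* The harmonic part of an invariant vector is invariant: take the invariants themselves for N. *)
have iz : inv z.
  have ivz : inv (v - z).
    have iD w : inv w -> inv (Dop M w).
      by apply: (NDop inv w (@inv_zero K l) (@inv_lin K l)); exact: inv_bil.
    exact: (Nz inv (@inv_zero K l) (@inv_lin K l) iD (iD v iv)).
  rewrite -[z](subKr v) -scaleN1r addrC; exact: (inv_lin (-1) ivz iv).
rewrite -[v](subrK z) -[v - z]scale1r; apply: (NL).
  apply: (Nz N N0 NL (fun w => NDop N w N0 NL Nbil)).
  apply: (Dop_closed N0 NL Nbil iv vM) => [a b ab|a b].
    by apply: low (@Fil_bil _ _ (- a%:Z - 1) b _ _ Fv); [lia|exact: inv_bil].
  by apply: low (@Fil_bil _ _ a b _ _ Fv); [lia|exact: inv_bil].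
rewrite (inv_harmonic (M := M) l_gt0 iz) => [|S /Sz[Sv cS]].
  by rewrite -[_ *: _]addr0; apply: NL.
by split=> // x; exact: SM.
Qed.

(** If N missed the vacuum, its vectors of smaller energy would vanish by induction, so [Dop M v]
    would be 0 by the Casimir identity and v a nonzero harmonic invariant, that is, a multiple of
    the vacuum. *)
Lemma inv_irreducible (N : F -> Prop) v : N 0 ->
  (forall a u w, N u -> N w -> N (a *: u + w)) ->
  (forall p q w, N w -> N (bil p q w)) -> (forall w, N w -> inv w) ->
  N v -> v != 0 -> N vac.
Proof.
move=> N0 NL Nbil Ninv Nv; have [n Fv] := Fil_exists v.
elim/ltn_ind: n v Nv Fv => n IHn v Nv Fv v0.
have low (e : int) w : e < n%:Z -> N w -> Fil e w -> w = 0 \/ N vac.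
  have [e0|] := ltP e 0; first by move=> _ _ /(Fil_lt0 e0) ->; left.
  case: e => // e _; rewrite ltz_nat => en Nw Fw.
  by have [->|w0] := eqVneq w 0; [left|right; exact: IHn en w Nw Fw w0].
have [//|nvac] := pselect (N vac).
have low0 e w : e < n%:Z -> N w -> Fil e w -> w = 0 by move=> en Nw /(low e w en Nw)[].
have [M [vM SM]] := exists_slot_bound v.
have [z [Sz Nz]] := Dop_harmonic M v.
have lin0 (a : K) (u w : F) : u = 0 -> w = 0 -> a *: u + w = 0.
  by move=> -> ->; rewrite scaler0 add0r.
have vz : v = z.
  apply/eqP; rewrite -subr_eq0; apply/eqP; apply: (Nz (fun w => w = 0) erefl lin0) => [w ->|].
    exact: lin_zero (Dop_linear M).
  have bil0 p q (w : F) : w = 0 -> bil p q w = 0.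
    by move=> ->; exact: lin_zero (bil_linear p q).
  apply: (Dop_closed (N := fun w => w = 0) erefl lin0 bil0 (Ninv v Nv) vM) => [a b ab|a b].
    by apply: low0 (@Fil_bil _ _ (- a%:Z - 1) b _ _ Fv); [lia|exact: Nbil].
  by apply: low0 (@Fil_bil _ _ a b _ _ Fv); [lia|exact: Nbil].
have vE : v = vac_coef v *: vac.
  apply: (inv_harmonic (M := M) l_gt0 (Ninv v Nv)) => S Sv.
  have [_ cS] := Sz S (eq_ind v (fun z => S \in msupp z) Sv z vz).
  by split=> // x; exact: SM.
have c0 : vac_coef v != 0 by apply: contraNneq v0 => c0; rewrite vE c0 scale0r.
have := NL (vac_coef v)^-1 v 0 Nv N0; rewrite addr0 {2}vE scalerA mulVf // scale1r.
exact.
Qed.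

End Generation.

(** * The induced module and its map to Fock space *)

Section WSpan.
Variable K : numFieldType.
Implicit Types (f g : {poly K}) (x y : Dhat K).

Inductive W_gen : Dhat K -> Prop :=
| WgenC : W_gen (Dhat_C K)
| WgenW (n : nat) (k : int) : odd n -> W_gen (W K n k).

Lemma poly_nat_ext f g : (forall n : nat, f.[n%:R] = g.[n%:R]) -> f = g.
Proof.
move=> fg; apply/eqP; rewrite -subr_eq0; apply/eqP.
apply: (@roots_geq_poly_eq0 _ _ [seq i%:R | i <- iota 0 (size (f - g))]).
- by apply/allP => _ /mapP[i _ ->]; rewrite rootE hornerD hornerN fg subrr.
- by rewrite map_inj_uniq ?iota_uniq // => i j /eqP; rewrite eqr_nat => /eqP.
by rewrite size_map size_iota.
Qed.

(** Substituting -X - (k + 1) multiplies the leading coefficient by (-1)^n, while skewness asks for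
    -1. *)
Lemma skew_poly_size k f n : skew_poly k f -> size f = n.+1 -> odd n.
Proof.
move=> fk sf; pose q : {poly K} := - 'X - ((k + 1)%:~R)%:P.
have qE : q = - ('X + ((k + 1)%:~R)%:P) by rewrite opprD.
have fq : f \Po q = - f.
  apply: poly_nat_ext => m; rewrite horner_comp hornerN !hornerE -[RHS](fk m).
  congr (f.[_]); rewrite /= !intrD !mulrNz !mulr1z; ring.
have sq : (1 < size q)%N by rewrite qE size_polyN size_XaddC.
have := lead_coef_comp f sq; rewrite fq lead_coefN qE lead_coefN lead_coefXaddC sf /=.
have f0 : lead_coef f != 0 by rewrite lead_coef_eq0 -size_poly_eq0 sf.
rewrite -signr_odd; case: (odd n) => //; rewrite expr0 mulr1 => /esym/(eq_oppr_eq0 (V := K^o)) f1.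
by rewrite f1 eqxx in f0.
Qed.

Lemma size_ffact_poly n : size (ffact_poly K n) = n.+1.
Proof. rewrite /ffact_poly -(big_mkord xpredT (fun i => 'X - i%:R%:P)) size_prod_XsubC.
by rewrite size_iota subn0. Qed.

Lemma lead_ffact_poly n : lead_coef (ffact_poly K n) = 1.
Proof. by apply/eqP; exact: monic_prod_XsubC. Qed.

Lemma Wpoly_coef n k : (Wpoly K n k)`_n = -1.
Proof.
have sq : size ('X + (k + n%:Z)%:~R%:P : {poly K}) = 2 by exact: size_XaddC.
have lq : (ffact_poly K n \Po ('X + (k + n%:Z)%:~R%:P))`_n = 1.
  have := lead_coef_comp (ffact_poly K n) (q := 'X + (k + n%:Z)%:~R%:P).
  rewrite sq lead_ffact_poly lead_coefXaddC expr1n mulr1 => /(_ isT).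
  by rewrite lead_coefE size_comp_poly2 // size_ffact_poly.
have l1 : (ffact_poly K n)`_n = 1.
  by rewrite -[RHS](lead_ffact_poly n) lead_coefE size_ffact_poly.
by rewrite /Wpoly coefZ coefD lq l1; field.
Qed.

Lemma size_Wpoly n k : (size (Wpoly K n k) <= n.+1)%N.
Proof.
rewrite (leq_trans (size_scale_leq _ _)) // (leq_trans (size_polyD _ _)) //.
by rewrite size_comp_poly2 ?size_XaddC // size_ffact_poly maxnn.
Qed.

(** In every odd degree there is a W with leading coefficient -1, and skew symbols have odd degree,
    so the leading terms can be removed one after another. *)
Lemma skew_span k f : skew_poly k f -> lspan W_gen (tD k f, 0).
Proof.
have [n] := ubnP (size f); elim: n f => // n IHn f sf fk.
have [f0|f0] := eqVneq f 0.
  rewrite f0 (lin_zero (@tD_is_linear K k)); exact: lspan0.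
have [m sm] : exists m, size f = m.+1 by case: (size f) (size_poly_gt0 f) => [|m]; [rewrite f0|exists m].
have m_odd := skew_poly_size fk sm.
pose g := lead_coef f *: Wpoly K m k + f.
have gk : skew_poly k g.
  have := skew_Wpoly K k m_odd; rewrite /g; move: (Wpoly K m k) => p pk b.
  by rewrite !hornerD !hornerZ fk pk mulrN opprD.
have sg : (size g <= m)%N.
  apply/leq_sizeP => j; rewrite leq_eqVlt => /orP[/eqP <-|mj].
    by rewrite coefD coefZ Wpoly_coef lead_coefE sm mulrN1 addNr.
  rewrite coefD coefZ !nth_default ?sm ?mulr0 ?addr0 //.
  exact: leq_trans (size_Wpoly m k) mj.
have -> : (tD k f, 0) = - lead_coef f *: W K m k + (tD k g, 0) :> Dhat K.
  rewrite (W_tD K k m_odd) /g; move: (Wpoly K m k) => p; rewrite (lin_add (@tD_is_linear K k)) (lin_scale (@tD_is_linear K k)).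
  congr (_, _) => /=; last by rewrite scaler0 addr0.
  by rewrite scaleNr addKr.
apply: lspanP; first by apply: lspan_gen; exact: WgenW.
by apply: IHn => //; rewrite sm ltnS in sf; exact: leq_ltn_trans sg sf.
Qed.

Lemma Dhat_plus_W x : Dhat_plus x -> lspan W_gen x.
Proof.
apply: (lspan_ind (P := lspan W_gen)) => [|a u v|_ [|k g g_odd]].
- exact: lspan0.
- exact: lspanP.
- by apply: lspan_gen; exact: WgenC.
by apply: skew_span; exact: skew_poly_odd.
Qed.

Lemma W_gen_Dhat_plus x : lspan W_gen x -> Dhat_plus x.
Proof.
apply: (lspan_ind (P := fun x => Dhat_plus x)) => [|a u v|_ [|n k n_odd]].
- exact: lspan0.
- exact: lspanP.
- by apply: lspan_gen; exact: DhatPlusC.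
by apply: W_Dhat_plus; rewrite ?pnatr_eq0.
Qed.

Lemma parabolic_Dhat_plus x : Dhat_parabolic x -> Dhat_plus x.
Proof.
apply: (lspan_ind (P := fun x => Dhat_plus x)) => [|a u v|_ [|n k n_odd _]].
- exact: lspan0.
- exact: lspanP.
- by apply: lspan_gen; exact: DhatPlusC.
by apply: W_Dhat_plus; rewrite ?pnatr_eq0.
Qed.

Lemma Dhat_plus_br x y : Dhat_plus x -> Dhat_plus y -> Dhat_plus (Dhat_br x y).
Proof.
have D0 : Dhat_plus (0 : Dhat K) by exact: lspan0.
move=> xP yP; move: x xP; apply: (lspan_ind (P := fun x => Dhat_plus (Dhat_br x y))).
- by rewrite (lin_zero (Dhat_br_linear_l y)).
- by move=> a u v uP vP; rewrite (Dhat_br_linear_l y); exact: lspanP.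
move=> _ [|r f f_odd]; first by rewrite Dhat_br_C_l.
move: y yP; apply: lspan_ind.
- by rewrite (lin_zero (Dhat_br_linear_r _)).
- by move=> a u v uP vP; rewrite (Dhat_br_linear_r _); exact: lspanP.
move=> _ [|s g g_odd]; first by rewrite Dhat_br_C_r.
have [fk gk] := (skew_poly_odd r f_odd, skew_poly_odd s g_odd).
move: (f \Po _) (g \Po _) fk gk => {f_odd} f' {g_odd} g' fk gk.
rewrite /Dhat_br /= !diffop_mulE [s + r]addrC.
set d := _ - _; set c := psi_cocycle _ _.
have -> : (d, c) = c *: Dhat_C K + (tD (r + s) ((f' \Po ('X + s%:~R%:P)) * g'
    - (g' \Po ('X + r%:~R%:P)) * f'), 0).
  rewrite /d (lin_sub (@tD_is_linear K _)); congr (_, _) => /=.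
    by rewrite scaler0 add0r.
  by rewrite addr0 [RHS]mulr1.
apply: lspanP; first by apply: lspan_gen; exact: DhatPlusC.
exact: (W_gen_Dhat_plus (skew_span (skew_poly_br fk gk))).
Qed.

(** The symbol of W^1_0 is -D - 1/2, so it measures the degree in t; in degree 0 the cocycle is an
    empty sum. *)
Lemma Dhat_br_W10 n k : odd n -> Dhat_br (W K 1 0) (W K n k) = - k%:~R *: W K n k.
Proof.
move=> n_odd; rewrite !W_tD // /Dhat_br /= !diffop_mulE add0r addr0; congr (_, _); last first.
  rewrite psi_cocycle_tD /psi_cocycle_mono scaler0; case: eqP => // _ /=.
  by rewrite /psi_cocycle_pos big_ord0.
rewrite -(lin_sub (@tD_is_linear K _)) -(lin_scale (@tD_is_linear K _)) /=.
apply: congr1; rewrite mulr0z polyC0 addr0 comp_polyXr [Wpoly K n k * _]mulrC -mulrBl.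
rewrite -mul_polyC; congr (_ * _).
rewrite /Wpoly /ffact_poly big_ord1 polyC0 subr0 add0r mulr1z comp_polyX comp_polyZ.
rewrite comp_polyD comp_polyX comp_polyD comp_polyX comp_polyC -scalerBr -mul_polyC.
have h2 : (2^-1)%:P + (2^-1)%:P = 1 :> {poly K} by rewrite -polyCD; congr (_%:P); field.
rewrite !polyCN; rewrite -[RHS]mulr1 -h2; ring.
Qed.

End WSpan.

Section WStates.
Variables (K : numFieldType) (l : nat).
Local Notation F := (Fock K l).
Local Notation vac := (Fock_vac K l).
Local Notation inv := (@O_invariants K l).
Implicit Types (v : F) (s : seq (nat * nat)).

Definition W_state s : F := foldr (fun p => Wfermi p.1 (- p.2%:Z - 1)) vac s.

Definition W_state_field s : field F :=
  nops [seq (false, fderiv_div p.2 (@Wfermi K l p.1)) | p <- s].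

Lemma Wfermi_rho n m v : odd n -> Wfermi n m v = rho (W K n (m - n%:Z)) v.
Proof. by move=> n_odd; have := rho_W (m - n%:Z) v n_odd; rewrite subrK. Qed.

Lemma inv_Wfermi n m v : odd n -> inv v -> inv (Wfermi n m v).
Proof.
move=> n_odd iv; rewrite (Wfermi_rho _ _ n_odd); apply: inv_rho; last exact: iv.
by apply: W_Dhat_plus; rewrite ?pnatr_eq0.
Qed.

Lemma inv_W_state s : all (fun p => odd p.1) s -> inv (W_state s).
Proof.
elim: s => [_|p s IHs /andP[p_odd s_odd]]; first exact: inv_vac.
exact: (inv_Wfermi _ p_odd (IHs s_odd)).
Qed.

(** By uniqueness: each normally ordered product is a free field with the prescribed state, and
    invariance makes that state even. *)
Lemma W_state_fieldE s : all (fun p => odd p.1) s -> W_state_field s = @Fock_Y K l (W_state s).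
Proof.
elim: s => [_|p s IHs /andP[p_odd s_odd]]; first by rewrite /W_state_field /W_state /= Fock_Y_vac.
have {}IHs := IHs s_odd; have is_ := inv_W_state s_odd.
pose a := fderiv_div p.2 (@Wfermi K l p.1).
have fa : free_field false a by exact/free_fderiv_div/free_Wfermi.
have aE v : a (-1) v = Wfermi p.1 (- p.2%:Z - 1) v.
  by rewrite /a fderiv_div_state addrC.
have ea : even_vector (a (-1) vac).
  by apply: inv_even; rewrite aE; apply: inv_Wfermi => //; exact: inv_vac.
have fs : free_field false (W_state_field s) by rewrite IHs; exact/free_Fock_Y/inv_even.
have E : nop false a (W_state_field s) (-1) vac = W_state (p :: s).
  rewrite (nop_state _ (ff_lfield fa) (ff_lfield fs) (ff_creative fa) (ff_creative fs)).
  by rewrite aE IHs Fock_Y_state.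
apply: etrans (_ : nop false a (W_state_field s) = _); first by [].
rewrite -E; apply: Fock_Y_eq.
  apply: (@free_nop _ _ false false false) => //.
  by rewrite (Fock_Y_eq fa ea) IHs; apply/local_Fock_Y/inv_even.
by rewrite E; apply: inv_even; exact: (inv_Wfermi _ p_odd is_).
Qed.

End WStates.

Section InducedModuleToFock.
Variables (K : numFieldType) (l : nat) (M : lmodType K) (c : K).
Variables (act : Dhat K -> M -> M) (gen : M) (Phi : M -> Fock K l).
Local Notation vac := (Fock_vac K l).
Local Notation inv := (@O_invariants K l).
Hypothesis act_linear : forall x, linear (act x).
Hypothesis act_lin : forall a x y m, Dhat_plus x -> Dhat_plus y ->
  act (a *: x + y) m = a *: act x m + act y m.
Hypothesis act_br : forall x y m, Dhat_plus x -> Dhat_plus y ->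
  act x (act y m) - act y (act x m) = act (Dhat_br x y) m.
Hypothesis act_gen : forall x, Dhat_parabolic x -> act x gen = vac_char c x *: gen.
Hypothesis gen_span : forall N : M -> Prop, N 0 ->
  (forall a u v, N u -> N v -> N (a *: u + v)) -> N gen ->
  (forall x m, Dhat_plus x -> N m -> N (act x m)) -> forall m, N m.
Hypothesis Phi_linear : linear Phi.
Hypothesis Phi_gen : Phi gen = vac.
Hypothesis Phi_act : forall x m, Dhat_plus x -> Phi (act x m) = rho x (Phi m).
Implicit Types (s : seq (nat * int)) (m : M).

Let W_plus n k : odd n -> Dhat_plus (W K n k).
Proof. by apply: W_Dhat_plus; rewrite pnatr_eq0. Qed.

Let act0 m : act 0 m = 0.
Proof.
have D0 : Dhat_plus (0 : Dhat K) by exact: lspan0.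
by have := act_lin (-1) m D0 D0; rewrite scaler0 addr0 scaleN1r addNr.
Qed.

Definition wact s : M := foldr (fun p => act (W K p.1 p.2)) gen s.

Lemma wact_cons p s : wact (p :: s) = act (W K p.1 p.2) (wact s).
Proof. by []. Qed.

Definition negative s : bool := all (fun p => odd p.1 && (p.1%:Z + p.2 < 0)) s.

(** The spanning half of the Poincare-Birkhoff-Witt theorem, without any ordering of the words; the
    bound on the length is the induction parameter. *)
Definition wordspan (n : nat) : M -> Prop :=
  lspan (fun m => exists2 s, (size s <= n)%N && negative s & m = wact s).

Lemma wordspan_lin n a u v : wordspan n u -> wordspan n v -> wordspan n (a *: u + v).
Proof. exact: lspanP. Qed.

Lemma wordspan0 n : wordspan n 0.
Proof. exact: lspan0. Qed.

Lemma wordspan_map f n n' m : linear f -> wordspan n m ->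
  (forall s, (size s <= n)%N -> negative s -> wordspan n' (f (wact s))) -> wordspan n' (f m).
Proof.
move=> fL wm ws; apply: (lspan_ind (P := fun m => wordspan n' (f m)) _ _ _ wm) => [|a u v|u].
- rewrite (lin_zero fL); exact: wordspan0.
- rewrite fL; exact: wordspan_lin.
by move=> [s /andP[sn sneg] ->]; exact: ws.
Qed.

Lemma wordspan_neg n p m : odd p.1 -> p.1%:Z + p.2 < 0 -> wordspan n m ->
  wordspan n.+1 (act (W K p.1 p.2) m).
Proof.
move=> p1 p2 wm; apply: (wordspan_map (act_linear _) wm) => s sn sneg.
by apply: lspan_gen; exists (p :: s); rewrite //= ltnS sn p1 p2.
Qed.

Lemma wordspan_le n m : wordspan n m -> wordspan n.+1 m.
Proof.
move=> wm; apply: (wordspan_map (f := id) _ wm) => // s sn sneg.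
by apply: lspan_gen; exists s; rewrite ?sneg ?(leqW sn).
Qed.

(** The first hypothesis is [wordspan_par] at length n; assuming it unties the mutual induction of
    the two statements. *)
Lemma wordspan_plus n x m :
  (forall y m', Dhat_parabolic_gen y -> wordspan n m' -> wordspan n (act y m')) ->
  Dhat_plus x -> wordspan n m -> wordspan n.+1 (act x m).
Proof.
move=> par xP wm; suff [] : Dhat_plus x /\ wordspan n.+1 (act x m) by [].
have := Dhat_plus_W xP; move: x {xP}; apply: lspan_ind => [|a x y [xP wx] [yP wy]|_ []].
- split; first exact: lspan0.
  rewrite act0; exact: wordspan0.
- by split; [exact: lspanP | rewrite act_lin //; exact: wordspan_lin].
- split; first by apply: lspan_gen; exact: DhatPlusC.
  by apply: wordspan_le; apply: par (ParabolicC K) wm.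
move=> n' k n_odd; split; first exact: W_plus.
have [nk|nk] := ltP (n'%:Z + k) 0; first exact: (@wordspan_neg n (n', k)).
by apply: wordspan_le; apply: par (ParabolicW K n_odd nk) wm.
Qed.

(** A parabolic element is moved to the right until the generator absorbs it as a scalar; each
    bracket acts on a word shorter by one, which pays for the letter it may add. *)
Lemma wordspan_par n y m : Dhat_parabolic_gen y -> wordspan n m -> wordspan n (act y m).
Proof.
elim: n y m => [|n IHn] y m yg wm.
  apply: (wordspan_map (act_linear _) wm) => -[|//] _ _ /=.
  rewrite act_gen; last exact: lspan_gen.
  rewrite -[_ *: _]addr0; apply: wordspan_lin; last exact: wordspan0.
  by apply: lspan_gen; exists [::].
have yP : Dhat_plus y by apply: parabolic_Dhat_plus; exact: lspan_gen.
apply: (wordspan_map (act_linear _) wm) => -[|p s] /=.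
  move=> _ _; rewrite act_gen; last exact: lspan_gen.
  rewrite -[_ *: _]addr0; apply: wordspan_lin; last exact: wordspan0.
  by apply: lspan_gen; exists [::].
rewrite ltnS => sn /andP[/andP[p1 p2] sneg].
have ws : wordspan n (wact s) by apply: lspan_gen; exists s; rewrite ?sn.
have /eqP := act_br (wact s) yP (W_plus p.2 p1); rewrite subr_eq => /eqP ->.
rewrite -[X in X + _]scale1r; apply: wordspan_lin.
  by apply: wordspan_plus => //; exact: Dhat_plus_br yP (W_plus _ _).
by apply: wordspan_neg => //; exact: IHn.
Qed.

Lemma wordspan_full m : exists n, wordspan n m.
Proof.
have le n n' m' : (n <= n')%N -> wordspan n m' -> wordspan n' m'.
  move=> /subnK <-; elim: (n' - n)%N => // d IHd wm; exact: wordspan_le (IHd wm).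
move: m; apply: gen_span => [|a u v [n wu] [n' wv]||x m xP [n wm]].
- exists 0%N; exact: wordspan0.
- exists (n + n')%N; apply: wordspan_lin; [apply: le wu|apply: le wv]; lia.
- by exists 0%N; apply: lspan_gen; exists [::].
by exists n.+1; apply: wordspan_plus => // y m'; exact: wordspan_par.
Qed.

Lemma act_W10 s : negative s ->
  act (W K 1 0) (wact s) = (- \sum_(p <- s) p.2)%:~R *: wact s.
Proof.
elim: s => [_|p s IHs /andP[/andP[p1 p2] sneg]].
  rewrite /wact /= big_nil act_gen; last by apply: lspan_gen; exact: ParabolicW.
  by rewrite W_tD // /vac_char mulr0 oppr0.
have L0 : Dhat_plus (W K 1 0) by exact: W_plus.
have Wp := W_plus p.2 p1.
have br := act_br (wact s) L0 Wp; rewrite (Dhat_br_W10 K p.2 p1) in br.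
have D0 : Dhat_plus (0 : Dhat K) by exact: lspan0.
have scl := act_lin (- p.2%:~R) (wact s) Wp D0; rewrite addr0 act0 addr0 in scl.
have := IHs sneg; rewrite wact_cons.
move: br scl; move: (wact s) (W K p.1 p.2) (W K 1 0) => w x y br scl IH.
rewrite -[LHS](subrK (act x (act y w))) br scl IH (lin_scale (act_linear _)) -scalerDl.
by rewrite big_cons opprD intrD !mulrNz.
Qed.

Definition charged (x : K * M) : Prop :=
  [/\ act (W K 1 0) x.2 = x.1 *: x.2, x.1 != 0 & vac_coef (Phi x.2) = 0].

(** In a nonempty negative word every k is negative, so W^1_0 acts by a positive integer, and its
    image has no vacuum coefficient. *)
Lemma charged_decomposition m : exists (a : K) (s : seq (K * M)),
  m = a *: gen + \sum_(x <- s) x.2 /\ forall x, x \in s -> charged x.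
Proof.
have [n] := wordspan_full m; move: m.
apply: lspan_ind => [|a u v [b [s [-> cs]]] [b' [s' [-> cs']]]|_ [s /andP[_ sneg] ->]].
- by exists 0, [::]; rewrite big_nil scale0r addr0.
- exists (a * b + b'), ([seq (x.1, a *: x.2) | x <- s] ++ s'); split.
    by rewrite big_cat big_map /= -scaler_sumr scalerDr scalerA scalerDl addrACA.
  move=> x; rewrite mem_cat => /orP[/mapP[y ys ->]|]; last exact: cs'.
  have [ey y0 vy] := cs y ys; split=> //=.
    by rewrite (lin_scale (act_linear _)) ey !scalerA mulrC.
  by rewrite (lin_scale Phi_linear) (lin_scale (@vac_coef_linear K l)) vy scaler0.
case: s sneg => [_|p s sneg].
  by exists 1, [::]; rewrite big_nil scale1r addr0.
exists 0, [:: ((- \sum_(q <- p :: s) q.2)%:~R, wact (p :: s))].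
rewrite big_seq1 scale0r add0r; split=> // x; rewrite inE => /eqP ->; split.
- exact: act_W10.
- rewrite intr_eq0 oppr_eq0 lt_eqF //.
  have neg_sum : forall s', negative s' -> \sum_(q <- s') q.2 <= 0.
    move=> s'; elim: s' => [|q s' IHs] /=; first by rewrite big_nil.
    by move=> /andP[/andP[_ q2] /IHs]; rewrite big_cons; move: (\sum_(_ <- s') _) => t; lia.
  move: sneg => /= /andP[/andP[_ p2] /neg_sum]; rewrite big_cons; move: (\sum_(_ <- s) _) => t; lia.
move: sneg => /= /andP[/andP[p1 p2] _]; rewrite Phi_act; last exact: W_plus.
by rewrite W_tD // vac_coef_rho //; lia.
Qed.

Lemma Phi_inv m : inv (Phi m).
Proof.
move: m; apply: gen_span => [|a u v iu iv||x m xP im].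
- rewrite (lin_zero Phi_linear); exact: inv_zero.
- by rewrite Phi_linear; exact: inv_lin.
- by rewrite Phi_gen; exact: inv_vac.
by rewrite Phi_act //; exact: inv_rho.
Qed.

Lemma Phi_surj v : (0 < l)%N -> inv v -> exists m, Phi m = v.
Proof.
move=> l0; apply: (inv_generated (N := fun v => exists m, Phi m = v) l0).
- by exists 0; exact: lin_zero Phi_linear.
- by move=> a _ _ [m <-] [m' <-]; exists (a *: m + m'); exact: Phi_linear.
- apply: bil_stable => [|a _ _ [m <-] [m' <-]|x _ xP [m <-]].
  + by exists 0; exact: lin_zero Phi_linear.
  + by exists (a *: m + m'); exact: Phi_linear.
  by exists (act x m); exact: Phi_act.
by exists gen.
Qed.

(** Irreducibility of the invariants puts the vacuum in the image of N. A preimage is the generator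
    plus charged vectors, and the latter are removed by [eigen_sum]. *)
Lemma submodule_full (N : M -> Prop) m : (0 < l)%N -> N 0 ->
  (forall a u v, N u -> N v -> N (a *: u + v)) ->
  (forall x m, Dhat_plus x -> N m -> N (act x m)) ->
  N m -> Phi m != 0 -> forall m', N m'.
Proof.
move=> l0 N0 NL Nact Nm Pm; apply: (gen_span N0 NL) => //.
pose N' v := exists2 m, N m & Phi m = v.
have N'0 : N' 0 by exists 0 => //; exact: lin_zero Phi_linear.
have N'L a u v : N' u -> N' v -> N' (a *: u + v).
  move=> [m1 Nm1 <-] [m2 Nm2 <-]; exists (a *: m1 + m2); [exact: NL|exact: Phi_linear].
have N'bil : forall p q v, N' v -> N' (bil p q v).
  apply: bil_stable => // x _ xP [m1 Nm1 <-]; exists (act x m1); first exact: Nact.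
  exact: Phi_act.
have [n' Nn' Pn'] : N' vac.
  apply: (inv_irreducible l0 N'0 N'L N'bil _ _ Pm); last by exists m.
  by move=> _ [m1 _ <-]; exact: Phi_inv.
have [a [s [nE cs]]] := charged_decomposition n'.
have vL := @vac_coef_linear K l.
have a1 : a = 1.
  have := congr1 (@vac_coef K l) Pn'; rewrite vac_coef_vac nE Phi_linear Phi_gen vL vac_coef_vac.
  rewrite (lin_sum Phi_linear) (lin_sum vL) big1_seq => [|x /= /cs[]//].
  by rewrite addr0 [LHS]mulr1.
(* W^1_0 kills the generator, so applied to the preimage it gives the charged vectors weighted by
   their nonzero eigenvalues. *)
have Ns : N (\sum_(x <- s) x.2).
  apply: (eigen_sum (act_linear (W K 1 0)) N0 NL) => [v||].
  - by apply: Nact; exact: W_plus.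
  - by move=> x /cs[].
  have := Nact _ _ (W_plus 0 (erefl : odd 1)) Nn'.
  rewrite nE act_linear (act_W10 (s := [::])) // big_nil oppr0 scale0r scaler0 add0r.
  rewrite (lin_sum (act_linear _)); congr N; apply: eq_big_seq => x /cs[-> //].
have := NL (-1) _ _ Ns Nn'; rewrite nE a1 scale1r scaleN1r addrC addrK.
exact.
Qed.

(** This brings the image to the states on which the state-field map is prescribed; a letter with n
    + k < 0 becomes a derivative of order -n - k - 1. *)
Lemma Phi_states m :
  lspan (fun v => exists2 s, all (fun p => odd p.1) s & v = W_state K l s) (Phi m).
Proof.
have [n wm] := wordspan_full m.
apply: (lspan_ind (P := fun m => lspan _ (Phi m)) _ _ _ wm) => [|a u v Pu Pv|_ [s /andP[_ sneg] ->]].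
- rewrite (lin_zero Phi_linear); exact: lspan0.
- rewrite Phi_linear; exact: lspanP.
apply: lspan_gen; exists [seq (p.1, absz (- p.1%:Z - p.2 - 1)%R) | p <- s].
  by rewrite all_map; apply: sub_all sneg => p /andP[].
elim: s sneg => [_|p s IHs /andP[/andP[p1 p2] sneg]]; first exact: Phi_gen.
rewrite wact_cons Phi_act; last exact: W_plus.
have absE (q : nat) (k : int) : q%:Z + k < 0 ->
    - (absz (- q%:Z - k - 1)%R)%:Z - 1 = k + q%:Z by lia.
by rewrite (IHs sneg) (rho_W _ _ p1) map_cons [RHS]/= absE.
Qed.

End InducedModuleToFock.

Lemma lin_combf (K : fieldType) (V U : lmodType K) (f g : V -> U) (a : K) :
  linear f -> linear g -> linear (fun v => a *: f v + g v).
Proof.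
by move=> fL gL b u v; rewrite fL gL !scalerDr !scalerA [a * b]mulrC addrACA.
Qed.

Section QuotientLift.
Variables (K : fieldType) (V U : lmodType K) (S : V -> Prop) (f : V -> U).
Hypotheses (fL : linear f) (fS : forall u, S u -> f u = 0).

Lemma lrepr_lift v : f (lrepr (lclass S v)) = f v.
Proof.
apply/eqP; rewrite -subr_eq0 -(lin_sub fL); apply/eqP.
exact: (lspan_lin_eq0 fL fS (u := lrepr (lclass S v) - v)) (@lrepr_lclass K V S v).
Qed.

Lemma lrepr_lift_linear : linear (fun q : lquot S => f (lrepr q)).
Proof.
move=> a p q; rewrite -[p]lreprK -[q]lreprK.
have -> : a *: lclass S (lrepr p) + lclass S (lrepr q) = lclass S (a *: lrepr p + lrepr q).
  by rewrite lclass_is_linear.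
by rewrite !lrepr_lift fL.
Qed.

End QuotientLift.

Section VacuumModule.
Variables (K : numFieldType) (l : nat).
Hypothesis l_gt0 : (0 < l)%N.
Local Notation c := (l%:R : K).
Local Notation vac := (Fock_vac K l).
Local Notation inv := (@O_invariants K l).
Local Notation A := (set_type (@Dhat_plus K)).
Local Notation rel := (@induced_rel K _ (@Dhat_br K) (@Dhat_plus K) (@Dhat_parabolic K) (vac_char c)).
Local Notation words := {malg K[seq A]}.
Local Notation M := (vac_induced c).
Local Notation gen := (induced_gen (@Dhat_br K) (@Dhat_plus K) (@Dhat_parabolic K) (vac_char c)).

Definition ind_class : words -> M := lclass rel.
Local Notation cl := ind_class.

Lemma ind_classK m : cl (lrepr m) = m.
Proof. exact: lreprK. Qed.

Definition plus_elt x (xP : Dhat_plus x) : A := SigSub (mem_set xP).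

Definition ind_act (x : Dhat K) (m : M) : M :=
  if insub x is Some y then induced_act (y : A) m else 0.

Lemma ind_actT x m (xP : Dhat_plus x) : ind_act x m = induced_act (plus_elt xP) m.
Proof.
rewrite /ind_act; case: insubP => [y _ yx|]; last by rewrite (mem_set xP).
have -> : y = plus_elt xP by apply: val_inj; exact: yx.
reflexivity.
Qed.

Lemma ind_act_cl x (xP : Dhat_plus x) w : ind_act x (cl w) = cl (word_cons (plus_elt xP) w).
Proof. by rewrite ind_actT; exact: induced_actE. Qed.

Lemma ind_act_val (y : A) m : ind_act (val y) m = induced_act y m.
Proof.
rewrite (ind_actT m (set_mem (valP y))).
have -> : plus_elt (set_mem (valP y)) = y by exact: val_inj.
reflexivity.
Qed.

Lemma cl_linear : linear cl.
Proof. exact: lclass_is_linear. Qed.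

Lemma word_cons_linear (y : A) : linear (word_cons y).
Proof. exact: linearP. Qed.

Lemma word_consU (y : A) s : word_cons y << s >> = << y :: s >> :> words.
Proof. exact: linextU. Qed.

Lemma ind_act_linear x : linear (ind_act x).
Proof.
have [xP|nxP] := pselect (Dhat_plus x); last first.
  move=> a u v; rewrite /ind_act insubF ?scaler0 ?addr0 //.
  by apply/negP => /set_mem.
move=> a u v; rewrite -[u]ind_classK -[v]ind_classK.
move: (lrepr u) (lrepr v) => w1 w2.
apply: etrans (congr1 (ind_act x) (esym (cl_linear a w1 w2))) _.
apply: etrans (ind_act_cl xP _) _.
apply: etrans (congr1 cl (word_cons_linear _ a w1 w2)) _.
apply: etrans (cl_linear a _ _) _.
by rewrite !(ind_act_cl xP).
Qed.

Lemma ind_ext (V : lmodType K) (f g : M -> V) : linear f -> linear g ->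
  (forall s, f (cl << s >>) = g (cl << s >>)) -> f =1 g.
Proof.
move=> fL gL fg m; rewrite -[m]ind_classK; move: (lrepr m).
exact: (malg_lin_ext (lin_comp fL cl_linear) (lin_comp gL cl_linear) fg).
Qed.

Lemma ind_act_lin a x y m : Dhat_plus x -> Dhat_plus y ->
  ind_act (a *: x + y) m = a *: ind_act x m + ind_act y m.
Proof.
move=> xP yP; have zP : Dhat_plus (a *: x + y) by exact: lspanP.
have L : linear (fun m => a *: ind_act x m + ind_act y m).
  exact: lin_combf (ind_act_linear x) (ind_act_linear y).
move: m; apply: (ind_ext (ind_act_linear _) L) => s.
rewrite !ind_act_cl !word_consU; apply/eqP.
rewrite -subr_eq0 opprD addrA -(lin_scale cl_linear) -!(lin_sub cl_linear).
rewrite -(lin_zero cl_linear); apply/eqP/lclass_eqP; rewrite subr0.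
exact: lspan_gen (@IndLinear _ _ _ _ _ _ a (plus_elt xP) (plus_elt yP) (plus_elt zP) [::] s erefl).
Qed.

Lemma ind_act_br x y m : Dhat_plus x -> Dhat_plus y ->
  ind_act x (ind_act y m) - ind_act y (ind_act x m) = ind_act (Dhat_br x y) m.
Proof.
move=> xP yP; have zP := Dhat_plus_br xP yP.
have L : linear (fun m => ind_act x (ind_act y m) - ind_act y (ind_act x m)).
  by apply: lin_subf; exact: (lin_comp (ind_act_linear _) (ind_act_linear _)).
move: m; apply: (ind_ext L (ind_act_linear _)) => s.
rewrite !ind_act_cl !word_consU; apply/eqP.
rewrite -subr_eq0 -!(lin_sub cl_linear) -(lin_zero cl_linear); apply/eqP/lclass_eqP.
rewrite subr0.
exact: lspan_gen (@IndBracket _ _ _ _ _ _ (plus_elt xP) (plus_elt yP) (plus_elt zP) [::] s erefl).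
Qed.

Lemma ind_act_gen x : Dhat_parabolic x -> ind_act x gen = vac_char c x *: gen.
Proof.
move=> xP; rewrite (ind_act_cl (parabolic_Dhat_plus xP)) word_consU.
rewrite -(lin_scale cl_linear); apply/lclass_eqP.
exact: lspan_gen (@IndCharacter _ _ _ _ _ _ (plus_elt (parabolic_Dhat_plus xP)) [::] xP).
Qed.

Lemma ind_span (N : M -> Prop) : N 0 -> (forall a u v, N u -> N v -> N (a *: u + v)) ->
  N gen -> (forall x m, Dhat_plus x -> N m -> N (ind_act x m)) -> forall m, N m.
Proof.
move=> N0 NL Ngen Nact m; rewrite -[m]ind_classK; move: (lrepr m).
apply: malg_span => [|a u v Nu Nv|s].
- by rewrite (lin_zero cl_linear).
- by rewrite cl_linear; exact: NL.
elim: s => [|y s Ns]; first exact: Ngen.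
have yP := set_mem (valP y); have := Nact _ _ yP Ns.
rewrite (ind_act_cl yP) word_consU.
have -> : plus_elt yP = y by exact: val_inj.
exact.
Qed.

Definition word_Fock : words -> Fock K l :=
  linext (fun s : seq A => foldr (fun x v => rho (val x) v) vac s).

Lemma word_Fock_linear : linear word_Fock.
Proof. exact: linearP. Qed.

Lemma word_FockU s : word_Fock << s >> = foldr (fun x v => rho (val x) v) vac s.
Proof. exact: linextU. Qed.

(** For k < 0 <= n + k the energy does not force W^n_k to kill the vacuum; it does because W^n(z)
    has no singular part on it. *)
Lemma rho_parabolic x : Dhat_parabolic x -> rho x vac = vac_char c x *: vac.
Proof.
move=> xP; apply/eqP; rewrite -subr_eq0; apply/eqP.
have L : linear (fun x => rho x vac - vac_char c x *: vac).
  apply: lin_subf; first exact: rho_linear_l.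
  by move=> a u v; rewrite /vac_char /= mulrDr mulrCA scalerDl scalerA.
apply: (lspan_lin_eq0 L _ xP) => _ [|n k n_odd nk].
  by rewrite rho_C /vac_char /= mulr1 subrr.
rewrite rho_W // (ff_creative (free_Wfermi K l n)); last by lia.
by rewrite W_tD // /vac_char /= mulr0 scale0r subrr.
Qed.

Lemma foldr_rho_linear (s : seq A) : linear (fun v : Fock K l => foldr (fun x v => rho (val x) v) v s).
Proof. by elim: s => // x s IHs; exact: (lin_comp (rho_linear (val x)) IHs). Qed.

Lemma word_Fock_rel w : rel w -> word_Fock w = 0.
Proof.
case=> [a x y z u v zE|x y z u v zE|x u xP].
- rewrite !(lin_sub word_Fock_linear) (lin_scale word_Fock_linear) !word_FockU !foldr_cat /=.
  have FL := foldr_rho_linear u.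
  by rewrite zE rho_linear_l FL -addrA -opprD subrr.
- rewrite !(lin_sub word_Fock_linear) !word_FockU !foldr_cat /=.
  have FL := foldr_rho_linear u.
  rewrite -(lin_sub FL) rho_br; [|exact: set_mem (valP x)|exact: set_mem (valP y)].
  by rewrite zE subrr.
rewrite (lin_sub word_Fock_linear) (lin_scale word_Fock_linear) !word_FockU -cats1 foldr_cat /=.
by rewrite rho_parabolic // (lin_scale (foldr_rho_linear u)) subrr.
Qed.

Definition ind_Fock (m : M) : Fock K l := word_Fock (lrepr m).

Lemma ind_Fock_cl w : ind_Fock (cl w) = word_Fock w.
Proof. exact: (lrepr_lift word_Fock_linear word_Fock_rel). Qed.

Lemma ind_Fock_linear : linear ind_Fock.
Proof. exact: (lrepr_lift_linear word_Fock_linear word_Fock_rel). Qed.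

Lemma ind_Fock_gen : ind_Fock gen = vac.
Proof. by rewrite ind_Fock_cl word_FockU. Qed.

Lemma ind_Fock_act x m : Dhat_plus x -> ind_Fock (ind_act x m) = rho x (ind_Fock m).
Proof.
move=> xP; move: m; apply: ind_ext => [||s].
- exact: (lin_comp ind_Fock_linear (ind_act_linear x)).
- exact: (lin_comp (rho_linear x) ind_Fock_linear).
by rewrite ind_act_cl word_consU !ind_Fock_cl !word_FockU.
Qed.

Lemma max_submodule_Fock m : max_submodule (@induced_act _ _ (@Dhat_br K) (@Dhat_plus K)
  (@Dhat_parabolic K) (vac_char c)) m -> ind_Fock m = 0.
Proof.
move=> [N [[[N0 NL] Nact] NT] Nm]; apply/eqP/contraT => Pm; exfalso; apply: NT.
apply/seteqP; split=> // m' _.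
apply: (submodule_full ind_act_linear ind_act_lin ind_act_br ind_act_gen ind_span
  ind_Fock_linear ind_Fock_gen ind_Fock_act l_gt0 N0 NL _ Nm Pm).
by move=> x m1 xP Nm1; rewrite ind_actT; exact: Nact.
Qed.

(** The kernel is a submodule, proper because the generator maps to the vacuum. With
    [max_submodule_Fock], the union of the proper submodules is the kernel. *)
Lemma ker_Fock_max m : ind_Fock m = 0 -> max_submodule (@induced_act _ _ (@Dhat_br K)
  (@Dhat_plus K) (@Dhat_parabolic K) (vac_char c)) m.
Proof.
move=> Pm; exists (fun m => ind_Fock m = 0); last exact: Pm.
split.
  split; first split=> [|a u v /= Pu Pv].
  - exact: (lin_zero ind_Fock_linear).
  - by rewrite ind_Fock_linear Pu Pv scaler0 addr0.
  move=> x m1 /= Pm1; have xP := set_mem (valP x).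
  by rewrite -ind_act_val ind_Fock_act // Pm1 (lin_zero (rho_linear _)).
move/seteqP => -[_ /(_ gen I)]; rewrite /= ind_Fock_gen => /(congr1 (@vac_coef K l)).
by rewrite vac_coef_vac (lin_zero (@vac_coef_linear K l)) => /eqP; rewrite oner_eq0.
Qed.

Definition Vc_Fock (v : Vc c) : Fock K l := ind_Fock (lrepr v).

Lemma Vc_Fock_lclass m : Vc_Fock (lclass _ m) = ind_Fock m.
Proof. exact: (lrepr_lift ind_Fock_linear max_submodule_Fock). Qed.

Lemma Vc_Fock_linear : linear Vc_Fock.
Proof. exact: (lrepr_lift_linear ind_Fock_linear max_submodule_Fock). Qed.

Lemma Vc_Fock_inj : injective Vc_Fock.
Proof.
move=> u v uv; have P0 : ind_Fock (lrepr u - lrepr v) = 0.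
  apply: etrans (lin_sub ind_Fock_linear _ _) _; apply/eqP; rewrite subr_eq0; apply/eqP.
  exact: uv.
rewrite -[u]lreprK -[v]lreprK; exact: lclass_eqP (lspan_gen (ker_Fock_max P0)).
Qed.

Lemma Vc_Fock_inv v : inv (Vc_Fock v).
Proof.
exact: (Phi_inv ind_span ind_Fock_linear ind_Fock_gen ind_Fock_act).
Qed.

Lemma Vc_Fock_states v :
  lspan (fun u => exists2 s, all (fun p => odd p.1) s & u = W_state K l s) (Vc_Fock v).
Proof.
exact: (Phi_states ind_act_linear ind_act_lin ind_act_br ind_act_gen ind_span
  ind_Fock_linear ind_Fock_gen ind_Fock_act).
Qed.

Lemma Vc_Fock_surj u : inv u -> exists v, Vc_Fock v = u.
Proof.
move=> iu; have [m <-] := Phi_surj ind_Fock_linear ind_Fock_gen ind_Fock_act l_gt0 iu.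
by exists (lclass _ m); exact: Vc_Fock_lclass.
Qed.

Lemma Vc_Fock_vac : Vc_Fock (Vc_vac c) = vac.
Proof. by rewrite Vc_Fock_lclass ind_Fock_gen. Qed.

Lemma Vc_Fock_act x v : Dhat_plus x -> Vc_Fock (Vc_act x v) = rho x (Vc_Fock v).
Proof.
move=> xP; rewrite /Vc_act; case: insubP => [y _ yx|]; last by rewrite (mem_set xP).
rewrite /irr_act Vc_Fock_lclass.
have <- : ind_act x (lrepr v) = induced_act y (lrepr v).
  by rewrite -yx; exact: ind_act_val.
exact: ind_Fock_act.
Qed.

End VacuumModule.

(** * The vertex algebra *)

Section FieldTransport.
Variables (K : fieldType) (V U : lmodType K) (f : V -> U).
Hypotheses (fL : linear f) (f_inj : injective f).

(** Injectivity replaces any finiteness hypothesis: both families have the same support, so both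
    sums take the default value 0 when it is infinite. *)
Lemma inj_fsum (D : set int) (F : int -> V) :
  f (\sum_(j \in D) F j) = \sum_(j \in D) f (F j).
Proof.
rewrite (lin_sum fL) /finite_support unlock.
have -> // : (F @^-1` [set~ 0] = (fun j => f (F j)) @^-1` [set~ 0])%classic.
apply/seteqP; split=> j /= F0.
  by rewrite -(lin_zero fL) => /f_inj.
by move=> E; apply: F0; rewrite E (lin_zero fL).
Qed.

Lemma inj_linear (W : lmodType K) (h : W -> V) (h' : W -> U) :
  linear h' -> (forall w, f (h w) = h' w) -> linear h.
Proof. by move=> hL hf a u v; apply: f_inj; rewrite fL !hf hL. Qed.

Definition intertwines (a : field V) (a' : field U) := forall m v, f (a m v) = a' m (f v).

Lemma intertwines_fid : intertwines (@fid K V) (@fid K U).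
Proof. by move=> m v; rewrite /fid; case: eqP => // _; exact: (lin_zero fL). Qed.

Lemma intertwines_fderiv_div k (a : field V) (a' : field U) : intertwines a a' ->
  intertwines (fderiv_div k a) (fderiv_div k a').
Proof.
move=> aa m v; rewrite /fderiv_div (lin_scale fL); congr (_ *: _).
elim: k m v => [|k IHk] m v /=; first exact: aa.
by rewrite /fderiv (lin_scale fL) IHk.
Qed.

Lemma intertwines_nop s (a b : field V) (a' b' : field U) : intertwines a a' -> intertwines b b' ->
  intertwines (nop s a b) (nop s a' b').
Proof.
move=> aa bb m v; rewrite /nop (lin_add fL) (lin_scale fL) !inj_fsum.
by congr (_ + _ *: _); apply: eq_fsbigr => j _; rewrite ?aa ?bb ?aa.
Qed.

Lemma intertwines_nops (I : Type) (A : I -> field V) (A' : I -> field U) (p : I -> bool)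
    (s : seq I) (odd_idx : I -> bool) :
  (forall i, odd_idx i -> intertwines (A i) (A' i)) -> all odd_idx s ->
  intertwines (nops [seq (p i, A i) | i <- s]) (nops [seq (p i, A' i) | i <- s]).
Proof.
move=> AA; elim: s => [|i s IHs] /= => [_|/andP[i_odd s_odd]].
  exact: intertwines_fid.
rewrite !count_map; apply: intertwines_nop; [exact: AA | exact: IHs].
Qed.

End FieldTransport.

Section VacuumVertexAlgebra.
Variables (K : numFieldType) (l : nat).
Hypothesis l_gt0 : (0 < l)%N.
Local Notation c := (l%:R : K).
Local Notation inv := (@O_invariants K l).
Local Notation phi := (@Vc_Fock K l).
Local Notation YF := (@Fock_Y K l).

Let phiL := @Vc_Fock_linear K l l_gt0.
Let phi_inj := @Vc_Fock_inj K l l_gt0.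

Lemma Vc_Fock_W n m v : odd n -> phi (Wfield c n m v) = Wfermi n m (phi v).
Proof.
move=> n_odd; apply: etrans (Vc_Fock_act l_gt0 v _) (esym (Wfermi_rho m _ n_odd)).
by apply: W_Dhat_plus; rewrite ?pnatr_eq0.
Qed.

Lemma Vc_Fock_T v : phi (Vc_T v) = Ttrans (phi v).
Proof.
apply: etrans (Vc_Fock_act l_gt0 v _) _; first by apply: W_Dhat_plus; rewrite ?pnatr_eq0.
exact: (rho_W (-1) (phi v) (isT : odd 1)).
Qed.

Lemma Vc_Fock_state s : all (fun p => odd p.1) s -> phi (Vc_state c s) = W_state K l s.
Proof.
elim: s => [_|p s IHs /andP[p_odd s_odd]]; first exact: Vc_Fock_vac.
have E : - p.2%:Z - p.1%:Z - 1 = (- p.2%:Z - 1) - p.1%:Z by lia.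
have := Vc_Fock_W (- p.2%:Z - 1) (Vc_state c s) p_odd.
by rewrite /Wfield -E IHs.
Qed.

Lemma Vc_Fock_state_field s m v : all (fun p => odd p.1) s ->
  phi (Vc_state_field c s m v) = W_state_field s m (phi v).
Proof.
move=> s_odd; have AA (p : nat * nat) : odd p.1 -> intertwines phi
    (fderiv_div p.2 (Wfield c p.1)) (fderiv_div p.2 (@Wfermi K l p.1)).
  move=> p_odd; apply: (intertwines_fderiv_div phiL) => m' v'; exact: Vc_Fock_W.
exact: (intertwines_nops phiL phi_inj (fun=> false) AA s_odd m v).
Qed.

(** The invariants are spanned by W-states, whose fields are normally ordered products of W-fields
    and hence correspond to fields on V_c; their values on invariants are images of vectors of
    V_c. *)
Lemma inv_Fock_Y u v m : inv u -> inv v -> inv (YF u m v).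
Proof.
move=> iu iv; have [u' uE] := Vc_Fock_surj l_gt0 iu.
have := Vc_Fock_states l_gt0 u'; rewrite uE.
move: u {iu u' uE}; apply: lspan_ind => [|a u w iu iw|_ [s s_odd ->]].
- rewrite (lin_zero (Fock_Y_linear m v)); exact: inv_zero.
- rewrite (Fock_Y_linear m v); exact: inv_lin.
have [v' <-] := Vc_Fock_surj l_gt0 iv.
rewrite -W_state_fieldE // -Vc_Fock_state_field //; exact: Vc_Fock_inv.
Qed.

Lemma even_Vc_Fock v : even_vector (phi v).
Proof. by apply: inv_even; exact: Vc_Fock_inv. Qed.

Lemma free_Vc_Fock v : free_field false (YF (phi v)).
Proof. exact: (free_Fock_Y (@even_Vc_Fock v)). Qed.

Lemma pulled_back_vertex_algebra (Y : Vc c -> field (Vc c)) :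
  (forall u m v, phi (Y u m v) = YF (phi u) m (phi v)) ->
  vertex_algebra (Vc_vac c) (@Vc_T K c) Y.
Proof.
move=> phiY; have phi0 := lin_zero phiL.
have phiV := @Vc_Fock_vac K l l_gt0; have ff v := free_Vc_Fock v; split.
- exact: (inj_linear phiL phi_inj (lin_comp (@Ttrans_linear K l) phiL) Vc_Fock_T).
- move=> m b; have L := lin_comp (Fock_Y_linear m (phi b)) phiL.
  exact: (inj_linear phiL phi_inj L (fun a => phiY a m b)).
- move=> a m; have L := lin_comp ((ff_lfield (ff a)).1 m) phiL.
  exact: (inj_linear phiL phi_inj L (phiY a m)).
- move=> a b; have [N YN] := (ff_lfield (ff a)).2 (phi b).
  by exists N%:Z => m Nm; apply: phi_inj; rewrite phiY phi0 YN.
- apply/funext => m; apply/funext => v; apply: phi_inj; rewrite phiY phiV.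
  apply: etrans (congr1 (fun F => F m (phi v)) (Fock_Y_vac K l)) _.
  exact: esym (intertwines_fid phiL m v).
- have T0 : phi (Vc_T (Vc_vac c)) = 0 by rewrite Vc_Fock_T phiV; exact: Ttrans_vac.
  exact: (phi_inj (etrans T0 (esym phi0))).
- by move=> a m m0; apply: phi_inj; rewrite phiY phiV phi0 (ff_creative (ff a)).
- by move=> a; apply: phi_inj; rewrite phiY phiV Fock_Y_state.
- move=> a m b; apply: phi_inj; rewrite (lin_sub phiL) Vc_Fock_T !phiY Vc_Fock_T.
  by rewrite /fderiv (lin_scale phiL) phiY; exact: (ff_covariant (ff a)).
move=> a b; have [N YN] := local_Fock_Y (phi a) (@even_Vc_Fock b).
exists N => m n v; apply: phi_inj; rewrite (lin_sum phiL) phi0.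
have := congr1 (fun F => F m n) (YN (phi v)); rewrite iter_dmulE /scomm => E.
apply: etrans E; apply: eq_bigr => j _; rewrite (lin_scale phiL) (lin_sub phiL) !phiY.
by rewrite scale1r.
Qed.

End VacuumVertexAlgebra.

Theorem proposition14p1 (R : realType) (l : nat) : (1 <= l)%N ->
  exists2 Y : Vc (l%:R : R[i]) -> field (Vc (l%:R : R[i])),
    (forall s : seq (nat * nat), all (fun p => odd p.1) s ->
       Y (Vc_state l%:R s) = Vc_state_field l%:R s) /\
    vertex_algebra (Vc_vac l%:R) (@Vc_T R[i] l%:R) Y
  & exists2 phi : Vc (l%:R : R[i]) -> Fock R[i] l,
      vertex_iso_onto (Vc_vac l%:R) (@Vc_T R[i] l%:R) Y
        (Fock_vac R[i] l) (@Fock_T R[i] l) (@Fock_Y R[i] l)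
        (@O_invariants R[i] l) phi
    & forall (n : nat) (m : int) (v : Vc (l%:R : R[i])), odd n ->
        phi (Wfield l%:R n m v) = Wfermi n m (phi v).
Proof.
move=> l0; pose phi := @Vc_Fock R[i] l.
have phi_inj : injective phi by exact: Vc_Fock_inj.
(* [g] picks preimages under [phi], with value 0 outside the invariants. As [phi] is injective and
   the invariants are closed under [Fock_Y], the structure pulled back through [g] is the only
   possible one. *)
have /choice[g gK] : forall u, exists v, O_invariants u -> phi v = u.
  move=> u; have [iu|niu] := pselect (O_invariants u); last by exists 0.
  by have [v vu] := Vc_Fock_surj l0 iu; exists v.
pose Y u m v := g (Fock_Y (phi u) m (phi v)).
have phiY u m v : phi (Y u m v) = Fock_Y (phi u) m (phi v).
  by apply: gK; apply: inv_Fock_Y => //; exact: Vc_Fock_inv.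
exists Y; first split.
- move=> s s_odd; apply/funext => m; apply/funext => v; apply: phi_inj.
  by rewrite phiY /phi Vc_Fock_state_field // Vc_Fock_state // W_state_fieldE.
- exact: pulled_back_vertex_algebra.
exists phi; last by move=> n m v; exact: Vc_Fock_W.
split=> //.
- exact: Vc_Fock_linear.
- apply/seteqP; split=> [_ [v _ <-]|u /(Vc_Fock_surj l0)[v <-]]; first exact: Vc_Fock_inv.
  by exists v.
- exact: Vc_Fock_vac.
by move=> v; rewrite /phi Vc_Fock_T // (Fock_TE (@even_Vc_Fock R[i] l l0 v)).
Qed.
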